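(* Let $s\ge0$ be sufficiently large and let $v\in C([0,T];H^s(\mathbb R))$ solve $$i\partial_tv+\partial_{xx}v+|D|(|v|^2)v-\tfrac14|v|^4v=0.$$ Then, with the operators $$\widetilde{\mathbf D}_vf=\partial_xf+\tfrac12v\mathcal H(\overline vf),\qquad H_vf=-\partial_{xx}f+\tfrac14|v|^4f-v|D|(\overline vf),$$ one has $$\partial_t(-i\widetilde{\mathbf D}_v)=[-iH_v,-i\widetilde{\mathbf D}_v].$$
   Context: Functions are complex-valued on $\mathbb R$; no frequency-support (chirality) condition is imposed on $v$. $\mathcal H$ is the Hilbert transform (Fourier symbol $-i\,\mathrm{sgn}(\xi)$) and $|D|$ is the Fourier multiplier with symbol $|\xi|$. $[A,B]=AB-BA$; the identity is an identity of operators acting on sufficiently regular functions $f=f(x)$, where $\partial_t(-i\widetilde{\mathbf D}_v)$ is the time derivative of the operator-valued map $t\mapsto-i\widetilde{\mathbf D}_{v(t)}$. *)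

(* Defs.v *)
From HB Require Import structures.
From mathcomp Require Import all_boot all_order all_algebra.
From mathcomp Require Import all_classical all_reals all_analysis.
From mathcomp Require Export complex.

Set Implicit Arguments.
Unset Strict Implicit.
Unset Printing Implicit Defensive.

Import Order.TTheory GRing.Theory Num.Theory.
Import numFieldNormedType.Exports.

Local Open Scope classical_set_scope.
Local Open Scope ring_scope.
Local Open Scope complex_scope.

Definition cfun (R : realType) : Type := R -> R[i].
Definition operator (R : realType) : Type := cfun R -> cfun R.

Section ComplexFunctions.
Context {R : realType}.
Implicit Types (f : cfun R) (D : set R).

Definition cmeasurable f : Prop :=
  measurable_fun setT (fun x => complex.Re (f x)) /\
  measurable_fun setT (fun x => complex.Im (f x)).

Definition ccontinuous f : Prop :=
  continuous (fun x => complex.Re (f x)) /\ continuous (fun x => complex.Im (f x)).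

Definition cintegral D f : R[i] :=
  (\int[lebesgue_measure]_(x in D) complex.Re (f x)) +i*
  (\int[lebesgue_measure]_(x in D) complex.Im (f x)).

Definition cderiv f : cfun R :=
  fun x => derive1 (fun y => complex.Re (f y)) x +i*
           derive1 (fun y => complex.Im (f y)) x.

Definition L2norm f : \bar R :=
  Lnorm (@lebesgue_measure R) 2%:E (fun x => (Normc.normc (f x))%:E).

Definition L2 f : Prop := cmeasurable f /\ (L2norm f < +oo)%E.

(* exp(i * theta) *)
Definition cis (theta : R) : R[i] := cos theta +i* sin theta.

End ComplexFunctions.

Section Fourier.
Context {R : realType}.
Implicit Types (f F : cfun R) (m : R -> R[i]).

(* The Fourier-Plancherel transform on L^2: F is the L^2 limit, as N tends to
   infinity, of the integrals of exp(-i x xi) f(x) over [-N, N].  It is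
   determined by f up to a null set. *)
Definition is_fourier f F : Prop :=
  L2 F /\
  L2norm (fun xi =>
      cintegral `[- N%:R, N%:R] (fun x => cis (- (x * xi)) * f x) - F xi)
    @[N --> \oo] --> 0%E.

Definition fourier f : cfun R := xget (fun=> 0) [set F | is_fourier f F].

(* The Fourier multiplier with symbol m.  Fourier inversion is written as a
   Lebesgue integral, so this is meant for f in L^2 with m * fourier f
   integrable; it then yields the continuous representative. *)
Definition multiplier m : operator R := fun f x =>
  ((2 * pi)^-1)%:C *
  cintegral setT (fun xi => cis (x * xi) * (m xi * fourier f xi)).

Definition hilbert : operator R := multiplier (fun xi => - 'i%C * (Num.sg xi)%:C).

Definition absD : operator R := multiplier (fun xi => `|xi|%:C).

Definition sobolev_norm (s : R) f : \bar R :=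
  L2norm (fun xi => ((1 + xi ^+ 2) `^ (s / 2))%:C * fourier f xi).

(* H^s(R) for s >= 0; membership does not depend on the representative. *)
Definition Hs (s : R) f : Prop := L2 f /\ (sobolev_norm s f < +oo)%E.

End Fourier.

Section TimeDependence.
Context {R : realType}.
Implicit Types (s T t : R) (u : R -> cfun R).

(* u belongs to C([0,T]; H^s) *)
Definition Hs_continuous s T u : Prop :=
  (forall t, t \in `[0, T] -> Hs s (u t)) /\
  forall t, t \in `[0, T] ->
    sobolev_norm s (fun x => u t' x - u t x)
      @[t' --> within `[0, T] (nbhs t)] --> 0%E.

(* w is the derivative at t, in the norm of H^s, of the curve u on [0,T]
   (one-sided at the end points) *)
Definition Hs_derivative s T u t (w : cfun R) : Prop :=
  [/\ forall t', t' \in `[0, T] -> Hs s (u t'), Hs s w &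
    sobolev_norm s (fun x => ((t' - t)^-1)%:C * (u t' x - u t x) - w x)
      @[t' --> within `[0, T] t^'] --> 0%E].

(* B is the strong derivative at t of the operator-valued map A on [0,T]:
   t' |-> A t' f is differentiable in L^2 = H^0 with derivative B f, for every
   f in H^s.  Elements of H^s are taken in their continuous representative, so
   that the differential operators act classically on them. *)
Definition op_derivative s T (A : R -> operator R) t (B : operator R) : Prop :=
  forall f : cfun R, ccontinuous f -> Hs s f ->
    Hs_derivative 0 T (fun t' => A t' f) t (B f).

End TimeDependence.

Section Equation.
Context {R : realType}.
Implicit Types (c : R[i]) (f v : cfun R) (A B : operator R).

Definition scale_op c A : operator R := fun f x => c * A f x.

Definition commutator A B : operator R := fun f x => A (B f) x - B (A f) x.

(* v is continuous in time with values in H^s, hence differentiable in time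
   with values in H^(s-2), where the equation
   i v_t + v_xx + |D|(|v|^2) v - |v|^4 v / 4 = 0 takes place. *)
Definition solution (s T : R) (v : R -> cfun R) : Prop :=
  [/\ forall t : R, t \in `[0, T] -> ccontinuous (v t),
      Hs_continuous s T v &
      exists vt : R -> cfun R, forall t : R, t \in `[0, T] ->
        Hs_derivative (s - 2) T v t (vt t) /\
        forall x, 'i%C * vt t x + cderiv (cderiv (v t)) x
          + absD (fun y => `|v t y| ^+ 2) x * v t x
          - 4^-1 * `|v t x| ^+ 4 * v t x = 0].

Definition Dtilde v : operator R := fun f x =>
  cderiv f x + 2^-1 * v x * hilbert (fun y => conjc (v y) * f y) x.

Definition Hop v : operator R := fun f x =>
  - cderiv (cderiv f) x + 4^-1 * `|v x| ^+ 4 * f x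
  - v x * absD (fun y => conjc (v y) * f y) x.

End Equation.

(* Main.v *)
(* A continuous function in H^s with s >= k+1 is the inverse transform of some F
   for which (1+|xi|)^k F is in L^1 and in L^2.  On such functions d/dx, H and |D|
   act by symbols, products are convolutions, and |D| = H d/dx.

   Since i v_t is given by the equation, the commutator is a polynomial expression
   in v, its conjugate, f, d/dx and H.  Expanding with the Leibniz rule, every term
   cancels by means of Cotlar's identity H(a Hb + (Ha) b) = (Ha)(Hb) - ab except
   -(i/2) (v_t H(conj v f) + v H(conj v_t f)), which is the derivative of
   -(i/2) v H(conj v f) in t.

   That derivative is strong in L^2: with q = (v(t') - v(t))/(t' - t) - v_t, the
   error of the difference quotient is
     -(i/2) (q H(conj v(t') f) + v_t H(conj (v(t') - v(t)) f) + v(t) H(conj q f)),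
   and q tends to 0 in H^(s-2), hence in L^2 and uniformly. *)
Require Import Defs.
From HB Require Import structures.
From mathcomp Require Import all_boot all_order all_algebra.
From mathcomp Require Import all_classical all_reals all_analysis.
From mathcomp Require Import measurable_realfun ring lra.

Set Implicit Arguments.
Unset Strict Implicit.
Unset Printing Implicit Defensive.

Import Order.TTheory GRing.Theory Num.Theory.
Import numFieldNormedType.Exports.

Local Open Scope classical_set_scope.
Local Open Scope ring_scope.
Local Open Scope complex_scope.

(** * Complex-valued integrals *)

(** [fourier] is chosen by [xget] among L2 limits of truncated integrals, so it is known only up to
    a null set, whereas the operators of the theorem are evaluated pointwise. Two facts bridge this
    gap. [inversion] recovers a continuous function from its transform, and [is_fourier_ift] says
    that [ift F] has transform [F]; the latter lets a multiplier act on [ift F] by its symbol. Both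
    rest on one damping argument: the factor [exp (- e |xi|)] turns pairings of transforms into
    averages against the Poisson kernel, which is explicit, positive and of mass [2 * pi].

    L2 bounds serve only to show that something is finite or tends to 0. Bessel's inequality
    therefore carries the whole L2 theory, and constants are not kept sharp.

    In the algebra the conjugate of [v] is an independent function [w]. That [v w] and [|D| (v w)]
    are real is used only once, to derive the equation for [w] from the one for [v]; the commutator
    computation itself is a polynomial identity in unknowns on which [D] and [H] act formally. *)

Section ComplexBasics.
Context {R : realType}.
Implicit Types z w : R[i].

Notation cn := Normc.normc.

Lemma normc_ge0 z : 0 <= cn z.
Proof. by case: z => a b; exact: sqrtr_ge0. Qed.

Lemma normc_norm z : `|z| = (cn z)%:C.
Proof. by case: z => a b. Qed.

Lemma normcD z w : cn (z + w) <= cn z + cn w.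
Proof.
by rewrite -lecR rmorphD/= -!normc_norm ler_normD.
Qed.

Lemma normcN z : cn (- z) = cn z.
Proof. by apply: complexI; rewrite -!normc_norm normrN. Qed.

Lemma normcB z w : cn (z - w) = cn (w - z).
Proof. by rewrite -normcN opprB. Qed.

Lemma normc0E z : (cn z == 0) = (z == 0).
Proof.
by apply/eqP/eqP => [/Normc.eq0_normc //|->]; rewrite Normc.normc0.
Qed.

Lemma normc_sqr z : cn z ^+ 2 = complex.Re z ^+ 2 + complex.Im z ^+ 2.
Proof. by case: z => a b /=; rewrite sqr_sqrtr// addr_ge0// sqr_ge0. Qed.

Lemma Re_le_normc z : `|complex.Re z| <= cn z.
Proof.
rewrite -(@ler_pXn2r _ 2)// ?nnegrE ?normc_ge0// normc_sqr real_normK ?num_real//.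
by rewrite lerDl sqr_ge0.
Qed.

Lemma Im_le_normc z : `|complex.Im z| <= cn z.
Proof.
rewrite -(@ler_pXn2r _ 2)// ?nnegrE ?normc_ge0// normc_sqr real_normK ?num_real//.
by rewrite lerDr sqr_ge0.
Qed.

Lemma normc_le_ReIm z : cn z <= `|complex.Re z| + `|complex.Im z|.
Proof.
rewrite -(@ler_pXn2r _ 2)// ?nnegrE ?normc_ge0 ?addr_ge0// normc_sqr sqrrD.
rewrite !real_normK ?num_real// addrAC lerDl mulrn_wge0// mulr_ge0//.
Qed.

Lemma normc_real (a : R) : cn a%:C = `|a|.
Proof. by rewrite /= expr0n/= addr0 sqrtr_sqr. Qed.

Lemma normc_conj z : cn (conjc z) = cn z.
Proof. by case: z => a b; rewrite /= sqrrN. Qed.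

Lemma normc_i : cn ('i%C : R[i]) = 1.
Proof. by rewrite /= expr0n/= add0r expr1n sqrtr1. Qed.

Lemma ReD z w : complex.Re (z + w) = complex.Re z + complex.Re w.
Proof. by case: z; case: w. Qed.
Lemma ImD z w : complex.Im (z + w) = complex.Im z + complex.Im w.
Proof. by case: z; case: w. Qed.
Lemma ReN z : complex.Re (- z) = - complex.Re z.
Proof. by case: z. Qed.
Lemma ImN z : complex.Im (- z) = - complex.Im z.
Proof. by case: z. Qed.
Lemma ReM z w : complex.Re (z * w) =
  complex.Re z * complex.Re w - complex.Im z * complex.Im w.
Proof. by case: z; case: w. Qed.
Lemma ImM z w : complex.Im (z * w) =
  complex.Re z * complex.Im w + complex.Im z * complex.Re w.
Proof. by case: z; case: w. Qed.
Lemma Re_conj z : complex.Re (conjc z) = complex.Re z.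
Proof. by case: z. Qed.
Lemma Im_conj z : complex.Im (conjc z) = - complex.Im z.
Proof. by case: z. Qed.

Lemma complexP z w : complex.Re z = complex.Re w ->
  complex.Im z = complex.Im w -> z = w.
Proof. by case: z; case: w => a b c d /= -> ->. Qed.

Lemma conjcD z w : (conjc (z + w)) = (conjc z) + (conjc w).
Proof. exact: rmorphD. Qed.
Lemma conjcM z w : (conjc (z * w)) = (conjc z) * (conjc w).
Proof. exact: rmorphM. Qed.

Lemma normc_sqrE z : (cn z ^+ 2)%:C = z * (conjc z).
Proof. by apply: complexP; rewrite normc_sqr ?ReM ?ImM Re_conj Im_conj/=; ring. Qed.

Lemma cisD (a b : R) : cis (a + b) = cis a * cis b.
Proof. by apply: complexP; rewrite ?ReM ?ImM /= ?cosD ?sinD//; ring. Qed.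

Lemma cis_conj (a : R) : (conjc (cis a)) = cis (- a).
Proof. by rewrite /cis cosN sinN. Qed.

Lemma normc_cis (a : R) : cn (cis a) = 1.
Proof. by rewrite /= cos2Dsin2 sqrtr1. Qed.

Lemma normcM_ler2 z w : cn z * cn w <= cn z ^+ 2 + cn w ^+ 2.
Proof.
have := normc_ge0 z; have := normc_ge0 w; move: (cn z) (cn w) => a b b0 a0.
by nra.
Qed.

Lemma normcD_sqr z w : cn (z + w) ^+ 2 <= 2 * cn z ^+ 2 + 2 * cn w ^+ 2.
Proof.
have h : cn (z + w) ^+ 2 <= (cn z + cn w) ^+ 2.
  by rewrite ler_pXn2r// ?nnegrE ?addr_ge0 ?normc_ge0// normcD.
have := sqr_ge0 (cn z - cn w); move: h; rewrite sqrrD sqrrB; lra.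
Qed.

End ComplexBasics.

Section ComplexMeasurable.
Context {R : realType} d (T : measurableType d).
Implicit Types f g : T -> R[i].
Notation cn := Normc.normc.

(** Stated over an arbitrary measurable space, unlike [cmeasurable], because Fubini's theorem needs
    it on [R * R]. *)
Definition cmeas f := measurable_fun setT (fun x => complex.Re (f x)) /\
  measurable_fun setT (fun x => complex.Im (f x)).

Lemma cmeas_cst (c : R[i]) : cmeas (fun=> c).
Proof. by split; exact: measurable_cst. Qed.

Lemma cmeasD f g : cmeas f -> cmeas g -> cmeas (fun x => f x + g x).
Proof.
move=> [f1 f2] [g1 g2]; split.
- under eq_fun do rewrite ReD; exact: measurable_funD.
- under eq_fun do rewrite ImD; exact: measurable_funD.
Qed.

Lemma cmeasM f g : cmeas f -> cmeas g -> cmeas (fun x => f x * g x).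
Proof.
move=> [f1 f2] [g1 g2]; split.
- under eq_fun do rewrite ReM; apply: measurable_funB; exact: measurable_funM.
- under eq_fun do rewrite ImM; apply: measurable_funD; exact: measurable_funM.
Qed.

Lemma cmeasN f : cmeas f -> cmeas (fun x => - f x).
Proof.
move=> [f1 f2]; split.
- by under eq_fun do rewrite ReN; exact: measurableT_comp.
- by under eq_fun do rewrite ImN; exact: measurableT_comp.
Qed.

Lemma cmeasB f g : cmeas f -> cmeas g -> cmeas (fun x => f x - g x).
Proof. by move=> mf mg; apply: cmeasD => //; exact: cmeasN. Qed.

Lemma cmeas_conj f : cmeas f -> cmeas (fun x => (conjc (f x))).
Proof.
move=> [f1 f2]; split.
- by under eq_fun do rewrite Re_conj.
- by under eq_fun do rewrite Im_conj; exact: measurableT_comp.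
Qed.

Lemma cmeas_real (g : T -> R) : measurable_fun setT g -> cmeas (fun x => (g x)%:C).
Proof. by move=> mg; split => //=; exact: measurable_cst. Qed.

Lemma cmeas_cis (g : T -> R) : measurable_fun setT g -> cmeas (fun x => cis (g x)).
Proof.
move=> mg; split => /=.
- apply: (measurableT_comp _ mg); apply: continuous_measurable_fun.
  exact: continuous_cos.
- apply: (measurableT_comp _ mg); apply: continuous_measurable_fun.
  exact: continuous_sin.
Qed.

Lemma measurable_normc f : cmeas f -> measurable_fun setT (fun x => cn (f x)).
Proof.
move=> [f1 f2].
have -> : (fun x => cn (f x)) = (fun x => Num.sqrt
    (complex.Re (f x) ^+ 2 + complex.Im (f x) ^+ 2)).
  by apply/funext => x; case: (f x).
apply: (@measurableT_comp _ _ _ _ _ _ (@Num.sqrt R)) => //.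
  apply: continuous_measurable_fun; exact: sqrt_continuous.
by apply: measurable_funD; exact: measurable_funX.
Qed.

End ComplexMeasurable.

Lemma cmeas_comp {R : realType} d d' (T : measurableType d)
    (T' : measurableType d') (f : T' -> R[i]) (g : T -> T') :
  cmeas f -> measurable_fun setT g -> cmeas (fun x => f (g x)).
Proof.
move=> [f1 f2] mg; split.
- exact: (measurableT_comp f1 mg).
- exact: (measurableT_comp f2 mg).
Qed.

Section ComplexIntegral.
Context {R : realType}.
Notation mu := (@lebesgue_measure R).
Notation cn := Normc.normc.
Implicit Types (f g : cfun R).

Definition rL1 (g : R -> R) := mu.-integrable setT (EFin \o g).

Definition cL1 f := cmeas f /\ rL1 (fun x => cn (f x)).

Notation J f := (cintegral setT f).

Lemma rL1_measurable (g : R -> R) : rL1 g -> measurable_fun setT g.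
Proof. by move=> /measurable_int/measurable_EFinP. Qed.

Lemma rL1_le (h g : R -> R) : measurable_fun setT h ->
  (forall x, `|h x| <= g x) -> rL1 g -> rL1 h.
Proof.
move=> mh hg ig; apply: (@le_integrable _ _ _ mu setT _ _ (EFin \o g)) => //.
- exact/measurable_EFinP.
- by move=> x _ /=; rewrite lee_fin (le_trans (hg x))// ler_norm.
Qed.

Lemma rL1D (h g : R -> R) : rL1 h -> rL1 g -> rL1 (fun x => h x + g x).
Proof.
move=> ih ig; rewrite /rL1.
have -> : EFin \o (fun x => h x + g x) = ((EFin \o h) \+ (EFin \o g))%E by [].
exact: integrableD.
Qed.

Lemma rL1Z (k : R) (g : R -> R) : rL1 g -> rL1 (fun x => k * g x).
Proof.
move=> ig; rewrite /rL1.
have -> : EFin \o (fun x => k * g x) = (fun x => k%:E * (EFin \o g) x)%E.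
  by apply/funext => x /=; rewrite EFinM.
exact: integrableZl.
Qed.

Lemma rL1_norm (g : R -> R) : rL1 g -> rL1 (fun x => `|g x|).
Proof. by move=> ig; exact: (integrable_abse ig). Qed.

Lemma rL1_lty (g : R -> R) : measurable_fun setT g -> (forall x, 0 <= g x) ->
  (\int[mu]_x (g x)%:E < +oo)%E -> rL1 g.
Proof.
move=> mg g0 gy; apply/integrableP; split; first exact/measurable_EFinP.
by under eq_integral do rewrite /= ger0_norm//.
Qed.

Lemma rL1_lty_inv (g : R -> R) : (forall x, 0 <= g x) -> rL1 g ->
  (\int[mu]_x (g x)%:E < +oo)%E.
Proof.
move=> g0 /integrableP[_]; by under eq_integral do rewrite /= ger0_norm//.
Qed.

Lemma rL1_EFin (g : R -> R) : rL1 g ->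
  (\int[mu]_x (g x)%:E)%E = (\int[mu]_x g x)%:E.
Proof. by move=> ig; rewrite /Rintegral fineK//; exact: integrable_fin_num. Qed.

Lemma cL1_le f (g : R -> R) : cmeas f -> (forall x, cn (f x) <= g x) -> rL1 g ->
  cL1 f.
Proof.
move=> mf fg ig; split => //; apply: rL1_le ig; first exact: measurable_normc.
by move=> x; rewrite ger0_norm ?normc_ge0.
Qed.

Lemma cL1_Re f : cL1 f -> rL1 (fun x => complex.Re (f x)).
Proof.
move=> [[f1 _]]; apply: rL1_le => // x; exact: Re_le_normc.
Qed.

Lemma cL1_Im f : cL1 f -> rL1 (fun x => complex.Im (f x)).
Proof.
move=> [[_ f1]]; apply: rL1_le => // x; exact: Im_le_normc.
Qed.

Lemma cL1D f g : cL1 f -> cL1 g -> cL1 (fun x => f x + g x).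
Proof.
move=> [mf If] [mg ig]; apply: (@cL1_le _ (fun x => cn (f x) + cn (g x))).
- exact: cmeasD.
- by move=> x; exact: normcD.
- exact: rL1D.
Qed.

Lemma cL1Z (c : R[i]) f : cL1 f -> cL1 (fun x => c * f x).
Proof.
move=> [mf If]; apply: (@cL1_le _ (fun x => cn c * cn (f x))).
- by apply: cmeasM => //; exact: cmeas_cst.
- by move=> x; rewrite Normc.normcM.
- exact: rL1Z.
Qed.

Lemma cL1N f : cL1 f -> cL1 (fun x => - f x).
Proof. by move=> /(@cL1Z (-1)); under eq_fun do rewrite mulN1r. Qed.

Lemma cL1B f g : cL1 f -> cL1 g -> cL1 (fun x => f x - g x).
Proof. by move=> If /cL1N; exact: cL1D. Qed.

Lemma cL1_conj f : cL1 f -> cL1 (fun x => (conjc (f x))).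
Proof.
move=> [mf If]; split; first exact: cmeas_conj.
by under eq_fun do rewrite normc_conj.
Qed.

Lemma cL1M_bounded f g (M : R) : cL1 f -> cmeas g -> (forall x, cn (g x) <= M) ->
  cL1 (fun x => g x * f x).
Proof.
move=> [mf If] mg gM; apply: (@cL1_le _ (fun x => M * cn (f x))).
- exact: cmeasM.
- by move=> x; rewrite Normc.normcM ler_wpM2r ?normc_ge0.
- exact: rL1Z.
Qed.

Lemma cL1_cis f (p : R -> R) : measurable_fun setT p -> cL1 f ->
  cL1 (fun x => cis (p x) * f x).
Proof.
move=> mp If; apply: (@cL1M_bounded _ _ 1) => //.
- exact: cmeas_cis.
- by move=> x; rewrite normc_cis.
Qed.

Lemma cintegralD f g : cL1 f -> cL1 g -> J (fun x => f x + g x) = J f + J g.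
Proof.
move=> If Ig; rewrite /cintegral; apply: complexP => /=.
- under eq_Rintegral do rewrite ReD.
  by rewrite RintegralD//; exact: cL1_Re.
- under eq_Rintegral do rewrite ImD.
  by rewrite RintegralD//; exact: cL1_Im.
Qed.

Lemma RintegralZ (k : R) (g : R -> R) : rL1 g ->
  \int[mu]_x (k * g x) = k * \int[mu]_x g x.
Proof. by move=> ig; rewrite RintegralZl. Qed.

Lemma cintegralZ (c : R[i]) f : cL1 f -> J (fun x => c * f x) = c * J f.
Proof.
move=> If; have r := cL1_Re If; have i := cL1_Im If.
rewrite /cintegral; apply: complexP; rewrite ?ReM ?ImM /=.
- under eq_Rintegral do rewrite ReM.
  by rewrite RintegralB//; [rewrite !RintegralZ|exact: rL1Z..].
- under eq_Rintegral do rewrite ImM.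
  by rewrite RintegralD//; [rewrite !RintegralZ|exact: rL1Z..].
Qed.

Lemma cintegralN f : cL1 f -> J (fun x => - f x) = - J f.
Proof.
move=> If; rewrite -mulN1r -cintegralZ//.
by under [in RHS]eq_fun do rewrite mulN1r.
Qed.

Lemma cintegralB f g : cL1 f -> cL1 g -> J (fun x => f x - g x) = J f - J g.
Proof. by move=> If Ig; rewrite cintegralD ?cintegralN//; exact: cL1N. Qed.

Lemma cintegral_conj f : cL1 f -> J (fun x => (conjc (f x))) = (conjc (J f)).
Proof.
move=> If; apply: complexP; rewrite /= ?Re_conj ?Im_conj/=.
- by apply: eq_Rintegral => x _; rewrite Re_conj.
- rewrite -mulN1r -RintegralZ; last exact: cL1_Im.
  by apply: eq_Rintegral => x _; rewrite Im_conj mulN1r.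
Qed.

Lemma eq_cintegral f g : f =1 g -> J f = J g.
Proof. by move=> /funext ->. Qed.

Lemma le_rintegral (h g : R -> R) : rL1 h -> rL1 g -> (forall x, h x <= g x) ->
  \int[mu]_x h x <= \int[mu]_x g x.
Proof. by move=> ih ig hg; apply: le_Rintegral. Qed.

(* After rotating by the conjugate of [J f] only the real part matters. *)
Lemma normc_cintegral f : cL1 f -> cn (J f) <= \int[mu]_x cn (f x).
Proof.
move=> If; have [_ In] := If.
have [j0|j0] := eqVneq (cn (J f)) 0.
  by rewrite j0; apply: Rintegral_ge0 => x _; exact: normc_ge0.
have jp : 0 < cn (J f) by rewrite lt_neqAle eq_sym j0 normc_ge0.
rewrite -(ler_pM2l jp) -expr2.
have -> : cn (J f) ^+ 2 = complex.Re (J (fun x => (conjc (J f)) * f x)).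
  by rewrite cintegralZ// mulrC -normc_sqrE.
rewrite -RintegralZ//; apply: le_rintegral.
- exact/cL1_Re/cL1Z.
- exact: rL1Z.
- move=> x; apply: le_trans (ler_norm _) _; apply: le_trans (Re_le_normc _) _.
  by rewrite Normc.normcM normc_conj.
Qed.

Lemma ae_mono (P Q : R -> Prop) : (forall x, P x -> Q x) ->
  {ae mu, forall x, P x} -> {ae mu, forall x, Q x}.
Proof. by move=> PQ; apply: filterS => //; exact: (ae_filter_ringOfSetsType mu). Qed.

Lemma ae_mono2 (P Q S : R -> Prop) : (forall x, P x -> Q x -> S x) ->
  {ae mu, forall x, P x} -> {ae mu, forall x, Q x} -> {ae mu, forall x, S x}.
Proof.
by move=> PQ; apply: filterS2 => //; exact: (ae_filter_ringOfSetsType mu).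
Qed.

Lemma ae_eq_cintegral f g : cmeas f -> cmeas g ->
  {ae mu, forall x, f x = g x} -> J f = J g.
Proof.
move=> [f1 f2] [g1 g2] fg; rewrite /cintegral /Rintegral; congr (fine _ +i* fine _).
- apply: ae_eq_integral => //; [exact/measurable_EFinP..|].
  by apply: ae_mono fg => x -> _.
- apply: ae_eq_integral => //; [exact/measurable_EFinP..|].
  by apply: ae_mono fg => x -> _.
Qed.

End ComplexIntegral.

(** * Fubini's theorem, affine substitutions and dominated convergence *)

Section Fubini.
Context {R : realType}.
Notation mu := (@lebesgue_measure R).
Notation cn := Normc.normc.
Notation J f := (cintegral setT f).

Definition L1_prod (k : R * R -> R) :=
  (mu \x mu)%E.-integrable setT (EFin \o k).

Lemma L1_prod_le (h k : R * R -> R) : measurable_fun setT h ->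
  (forall z, `|h z| <= k z) -> L1_prod k -> L1_prod h.
Proof.
move=> mh hg; rewrite /L1_prod => ig; apply: le_integrable ig => //.
- exact/measurable_EFinP.
- by move=> x _ /=; rewrite lee_fin (le_trans (hg x))// ler_norm.
Qed.

(** The inner [Rintegral] replaces an infinite value by 0. By Fubini the inner integrals are finite
    for almost every [x], so this alters the iterated integral only on a null set. *)
Lemma rintegral_prod (k : R * R -> R) : L1_prod k ->
  rL1 (fun x => \int[mu]_y k (x, y)) /\
  (\int[mu]_x (\int[mu]_y k (x, y)))%:E = (\int[(mu \x mu)%E]_z (k z)%:E)%E.
Proof.
move=> ik.
have iF : mu.-integrable setT (fubini_F mu (EFin \o k)).
  exact: integrable_fubini_F.
have aeF : {ae mu, forall x, (\int[mu]_y k (x, y))%:E = fubini_F mu (EFin \o k) x}.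
  have := integrable_ae measurableT iF; apply: ae_mono => x /(_ I) fx.
  by rewrite /Rintegral fineK.
have mF : measurable_fun setT (fun x => \int[mu]_y k (x, y)).
  have mF := measurable_int _ iF.
  exact: (measurableT_comp (fine_measurable _) mF).
have rF : rL1 (fun x => \int[mu]_y k (x, y)).
  apply/integrableP; split; first exact/measurable_EFinP.
  move/integrableP : iF => [mFe]; apply: le_lt_trans.
  rewrite le_eqVlt; apply/orP; left; apply/eqP.
  apply: ae_eq_integral => //.
  - apply: measurableT_comp => //; exact/measurable_EFinP.
  - exact: measurableT_comp.
  - by apply: ae_mono aeF => x h _; exact: (congr1 abse h).
split => //.
rewrite -rL1_EFin// -integral12_prod_meas1//.
apply: ae_eq_integral => //; first exact/measurable_EFinP.
  exact: measurable_int iF.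
by apply: ae_mono aeF => x h _; exact: h.
Qed.

Lemma L1_prod_swap (k : R * R -> R) : L1_prod k -> L1_prod (fun z => k (z.2, z.1)).
Proof.
move=> ik.
have mk : measurable_fun setT k by move/measurable_int/measurable_EFinP: ik.
have mk' : measurable_fun setT (fun z : R * R => k (z.2, z.1)).
  apply: (@measurableT_comp _ _ _ _ _ _ k _ (fun z => (z.2, z.1))) => //.
  by apply: measurable_fun_pair; [exact: measurable_snd|exact: measurable_fst].
apply/integrable12ltyP; first exact/measurable_EFinP.
move/integrable21ltyP : ik; apply; exact/measurable_EFinP.
Qed.

Lemma rintegral_swap (k : R * R -> R) : L1_prod k ->
  \int[mu]_x (\int[mu]_y k (x, y)) = \int[mu]_y (\int[mu]_x k (x, y)).
Proof.
move=> ik; apply: EFin_inj; rewrite (rintegral_prod ik).2.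
have ik' := L1_prod_swap ik; rewrite (rintegral_prod ik').2.
by rewrite -integral12_prod_meas1// -integral21_prod_meas1.
Qed.

Definition cL1_prod (k : R * R -> R[i]) :=
  cmeas k /\ L1_prod (fun z => cn (k z)).

Lemma cL1_prod_Re k : cL1_prod k -> L1_prod (fun z => complex.Re (k z)).
Proof.
by move=> [[k1 _]]; apply: L1_prod_le => // x; exact: Re_le_normc.
Qed.

Lemma cL1_prod_Im k : cL1_prod k -> L1_prod (fun z => complex.Im (k z)).
Proof.
by move=> [[_ k1]]; apply: L1_prod_le => // x; exact: Im_le_normc.
Qed.

Lemma cL1_ReIm (f : cfun R) : rL1 (fun x => complex.Re (f x)) ->
  rL1 (fun x => complex.Im (f x)) -> cL1 f.
Proof.
move=> r i; apply: (@cL1_le _ _ (fun x => `|complex.Re (f x)| + `|complex.Im (f x)|)).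
- by split; exact: rL1_measurable.
- by move=> x; exact: normc_le_ReIm.
- by apply: rL1D; exact: rL1_norm.
Qed.

Lemma cL1_cintegral k : cL1_prod k -> cL1 (fun x => J (fun y => k (x, y))).
Proof.
move=> ik; apply: cL1_ReIm => /=.
- by have [] := rintegral_prod (cL1_prod_Re ik).
- by have [] := rintegral_prod (cL1_prod_Im ik).
Qed.

Lemma cintegral_swap k : cL1_prod k ->
  J (fun x => J (fun y => k (x, y))) = J (fun y => J (fun x => k (x, y))).
Proof.
move=> ik; apply: complexP => /=.
- exact: (rintegral_swap (cL1_prod_Re ik)).
- exact: (rintegral_swap (cL1_prod_Im ik)).
Qed.

Lemma L1_prod_tonelli (k : R * R -> R) : measurable_fun setT k ->
  (forall z, 0 <= k z) ->
  (\int[mu]_x \int[mu]_y (k (x, y))%:E < +oo)%E -> L1_prod k.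
Proof.
move=> mk k0 ky; apply/integrable12ltyP; first exact/measurable_EFinP.
rewrite (_ : (fun x => _) = (fun x => \int[mu]_y (k (x, y))%:E)%E)//.
by apply/funext => x; apply: eq_integral => y _; rewrite /= ger0_norm.
Qed.

Lemma tonelli_swap (k : R * R -> R) : measurable_fun setT k ->
  (forall z, 0 <= k z) ->
  (\int[mu]_x \int[mu]_y (k (x, y))%:E = \int[mu]_y \int[mu]_x (k (x, y))%:E)%E.
Proof.
move=> mk k0.
apply: (@fubini_tonelli _ _ _ _ _ mu mu (EFin \o k)) => //.
exact/measurable_EFinP.
Qed.

Lemma L1_prod_mul (a b : R -> R) : (forall x, 0 <= a x) -> (forall x, 0 <= b x) ->
  rL1 a -> rL1 b -> L1_prod (fun z => a z.1 * b z.2).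
Proof.
move=> a0 b0 ia ib; have ma := rL1_measurable ia; have mb := rL1_measurable ib.
apply: L1_prod_tonelli.
- by apply: measurable_realfun.measurable_funM; exact: measurableT_comp.
- by move=> z; exact: mulr_ge0.
- rewrite (_ : (fun x => _) = (fun x => ((\int[mu]_y b y) * a x)%:E)); last first.
    apply/funext => x; rewrite /=; under eq_integral do rewrite EFinM.
    rewrite ge0_integralZl//; first by rewrite rL1_EFin// -EFinM mulrC.
    - exact/measurable_EFinP.
    - by move=> y _; rewrite lee_fin.
    - by rewrite lee_fin.
  have ab0 x : 0 <= (\int[mu]_y b y) * a x by rewrite mulr_ge0//; apply: Rintegral_ge0.
  exact: (rL1_lty_inv ab0 (rL1Z _ ia)).
Qed.

Lemma cL1_prod_le (k : R * R -> R[i]) (h : R * R -> R) : cmeas k ->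
  (forall z, cn (k z) <= h z) -> L1_prod h -> cL1_prod k.
Proof.
move=> mk kh ih; split => //; apply: L1_prod_le ih => //.
- exact: measurable_normc.
- by move=> z; rewrite ger0_norm ?normc_ge0.
Qed.

End Fubini.

Section Translation.
Context {R : realType}.
Notation mu := (@lebesgue_measure R).
Notation cn := Normc.normc.
Notation J f := (cintegral setT f).

Lemma measurable_affine (a s : R) : measurable_fun setT (fun x : R => a + s * x).
Proof.
apply: continuous_measurable_fun => x.
by apply: cvgD; [exact: cvg_cst|apply: cvgM; [exact: cvg_cst|exact: cvg_id]].
Qed.

(** Lebesgue measure is determined by its values on half-open intervals, so only these are checked.
    The condition on [s] covers translations and reflections together. *)
Lemma lebesgue_measure_affine (a s : R) : s ^+ 2 = 1 -> forall A, measurable A ->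
  mu A = pushforward mu (fun x => a + s * x) A.
Proof.
move=> s1.
have mf : measurable_fun [set: measurableTypeR R]
    ((fun x => a + s * x) : measurableTypeR R -> measurableTypeR R) := measurable_affine a s.
pose m : {measure set (measurableTypeR R) -> \bar R} :=
  measure_function_pushforward__canonical__measure_function_Measure mu mf.
suff h : forall X, ocitv X -> mu X = m X.
  by  move=> A mA; exact: (@lebesgue_measure_unique R m h A mA).
move=> _ [[p q] _ <-] /=.
rewrite /pushforward.
have /orP[/eqP->|/eqP->] : (s == 1) || (s == -1) by rewrite -sqrf_eq1 s1.
- have -> : (fun x : R => a + 1 * x) @^-1` `]p, q] = [set` `]p - a, q - a]].
    by apply/seteqP; split => x /=; rewrite !in_itv/= => /andP[? ?]; apply/andP; split; lra.
  rewrite !lebesgue_measure_itv/= !lte_fin -!EFinD.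
  by rewrite ltrD2r; case: ifP => // _; congr (_%:E); ring.
(* A reflection moves the closed end of the interval to the other side; the length is the same. *)
- have -> : (fun x : R => a + -1 * x) @^-1` `]p, q] = [set` `[a - q, a - p[].
    by apply/seteqP; split => x /=; rewrite !in_itv/= => /andP[? ?]; apply/andP; split; lra.
  rewrite !lebesgue_measure_itv/= !lte_fin -!EFinD.
  by rewrite ltrD2l ltrN2; case: ifP => // _; congr (_%:E); ring.
Qed.

Lemma ge0_integral_affine (a s : R) (g : R -> \bar R) : s ^+ 2 = 1 ->
  measurable_fun setT g -> (forall x, 0 <= g x)%E ->
  (\int[mu]_x g (a + s * x)%R = \int[mu]_x g x)%E.
Proof.
move=> s1 mg g0.
have mf : measurable_fun [set: measurableTypeR R]
    ((fun x => a + s * x) : measurableTypeR R -> measurableTypeR R) := measurable_affine a s.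
pose m : {measure set (measurableTypeR R) -> \bar R} :=
  measure_function_pushforward__canonical__measure_function_Measure mu mf.
transitivity (\int[m]_x g x)%E.
  by rewrite /m/= (@ge0_integral_pushforward _ _ _ _ _ _ mf).
by apply: eq_measure_integral => A mA _; rewrite [RHS](lebesgue_measure_affine a s1).
Qed.

End Translation.

Section Limits.
Context {R : realType}.
Notation mu := (@lebesgue_measure R).
Notation cn := Normc.normc.
Notation J f := (cintegral setT f).
Implicit Types (f : cfun R).

Lemma rL1_affine (a s : R) (g : R -> R) : s ^+ 2 = 1 -> rL1 g ->
  rL1 (fun x => g (a + s * x)).
Proof.
move=> s1 ig; have mg := rL1_measurable ig.
apply/integrableP; split.
  by apply/measurable_EFinP; exact: (measurableT_comp mg (measurable_affine a s)).
have /integrableP[_] := ig; apply: le_lt_trans.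
rewrite (@ge0_integral_affine _ a s (fun x => (`|(g x)%:E|)%E))//.
by do 2 apply: measurableT_comp => //.
Qed.

Lemma rintegral_affine (a s : R) (g : R -> R) : s ^+ 2 = 1 -> rL1 g ->
  \int[mu]_x g (a + s * x) = \int[mu]_x g x.
Proof.
move=> s1 ig.
have mg := rL1_measurable ig.
have mf : measurable_fun [set: measurableTypeR R]
  ((fun x => a + s * x) : measurableTypeR R -> measurableTypeR R) := measurable_affine a s.
have mG : measurable_fun [set: measurableTypeR R] (EFin \o g).
  exact/measurable_EFinP.
pose m : {measure set (measurableTypeR R) -> \bar R} :=
  measure_function_pushforward__canonical__measure_function_Measure mu mf.
rewrite /Rintegral; congr fine; transitivity (\int[m]_x (g x)%:E)%E.
  have := @integral_pushforward _ _ _ _ _ _ mf mu setT (EFin \o g) mG _ measurableT.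
  rewrite preimage_setT /m/= => -> //; exact: rL1_affine.
by apply: eq_measure_integral => A mA _; rewrite [RHS](lebesgue_measure_affine a s1).
Qed.

Lemma cL1_affine (a s : R) f : s ^+ 2 = 1 -> cL1 f ->
  cL1 (fun x => f (a + s * x)).
Proof.
move=> s1 [mf If]; split; first exact: (cmeas_comp mf (measurable_affine a s)).
exact: (rL1_affine _ s1 If).
Qed.

Lemma cintegral_affine (a s : R) f : s ^+ 2 = 1 -> cL1 f ->
  J (fun x => f (a + s * x)) = J f.
Proof.
move=> s1 If; apply: complexP => /=.
- exact: (rintegral_affine _ s1 (cL1_Re If)).
- exact: (rintegral_affine _ s1 (cL1_Im If)).
Qed.

(** Convergence in [R[i]] is expressed through the real-valued modulus, so that squeezing and
    comparison of real sequences apply directly. *)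
Definition clim (u : nat -> R[i]) (l : R[i]) :=
  (fun n => cn (u n - l)) @ \oo --> (0 : R).

Lemma clim_unique u l l' : clim u l -> clim u l' -> l = l'.
Proof.
move=> ul ul'; apply/eqP; rewrite -subr_eq0 -normc0E eq_le normc_ge0 andbT.
have h : (fun n => cn (u n - l) + cn (u n - l')) @ \oo --> (0 : R).
  by rewrite -[0]addr0; exact: cvgD.
apply: (ler_cvg_to (@cvg_cst _ (cn (l - l')) _ \oo _) h).
apply: nearW => n; rewrite (normcB _ l).
by apply: le_trans (normcD _ _); rewrite addrA subrK.
Qed.

Lemma clim_le (u : nat -> R[i]) (l : R[i]) (e : nat -> R) :
  (forall n, cn (u n - l) <= e n) -> e @ \oo --> (0 : R) -> clim u l.
Proof.
move=> ue e0; apply: (squeeze_cvgr _ (@cvg_cst _ (0:R) _ _ _) e0).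
by apply: nearW => n; rewrite normc_ge0 ue.
Qed.

Lemma rintegral_dct (h_ : nat -> R -> R) (h g : R -> R) :
  (forall n, measurable_fun setT (h_ n)) -> measurable_fun setT h ->
  {ae mu, forall x, h_ ^~ x @ \oo --> h x} -> rL1 g ->
  (forall n x, `|h_ n x| <= g x) ->
  (fun n => \int[mu]_x h_ n x) @ \oo --> \int[mu]_x h x.
Proof.
move=> mh_ mh hh ig hg.
have [] := @dominated_convergence _ _ _ mu setT measurableT
  (fun n => EFin \o h_ n) (EFin \o h) (EFin \o g).
- move=> n.
  have h1 : measurable_fun setT (EFin \o h_ n) by apply/measurable_EFinP; exact: mh_.
  exact h1.
- exact/measurable_EFinP.
- by apply: ae_mono hh => x hx _; apply/fine_cvgP; split; [exact: nearW|exact: hx].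
- exact: ig.
- by apply: aeW => x n _ /=; rewrite lee_fin.
- move=> ih _ c; have := c; rewrite -(fineK (integrable_fin_num measurableT ih)).
  exact: fine_cvg.
Qed.

(** The real theorem is applied to the moduli [cn (f_ n x - f x)], dominated by [2 * g x], and
    bounds the difference of the integrals. *)
Lemma cintegral_dct (f_ : nat -> cfun R) f (g : R -> R) :
  (forall n, cmeas (f_ n)) -> cmeas f ->
  {ae mu, forall x, clim (f_ ^~ x) (f x)} -> rL1 g ->
  (forall n x, cn (f_ n x) <= g x) -> (forall x, cn (f x) <= g x) ->
  clim (fun n => J (f_ n)) (J f).
Proof.
move=> mf_ mf ff ig fg_ fg.
have If_ n : cL1 (f_ n) by exact: (cL1_le (mf_ n) (fg_ n) ig).
have If : cL1 f by exact: (cL1_le mf fg ig).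
apply: (@clim_le _ _ (fun n => \int[mu]_x cn (f_ n x - f x))).
  by move=> n; rewrite -cintegralB//; apply: normc_cintegral; exact: cL1B.
rewrite (_ : 0 = \int[mu]_x (0 : R)); last by rewrite Rintegral_cst//= mul0r.
apply: (@rintegral_dct _ _ (fun x => 2 * g x)).
- by move=> n; apply: measurable_normc; exact: cmeasB.
- exact: measurable_cst.
- exact: ff.
- exact: rL1Z.
- move=> n x; rewrite ger0_norm ?normc_ge0//.
  apply: le_trans (normcD _ _) _; rewrite normcN.
  by have := fg_ n x; have := fg x; lra.
Qed.

End Limits.

(** * The Poisson kernel and Bessel's inequality *)

Section PoissonKernel.
Context {R : realType}.
Notation mu := (@lebesgue_measure R).
Notation cn := Normc.normc.
Notation J f := (cintegral setT f).

(** [g] is separate from [f] because [pexp e] contains [|x|]: the closed-form antiderivative used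
    later belongs to [expR (- (e * x))], which agrees with [pexp e] only on the positive
    half-line. *)
Lemma integral_even (f g F : R -> R) (l : R) : (forall x, 0 <= f x) ->
  continuous f -> f =1 f \o -%R -> (forall x : R, is_derive x 1 F (g x)) ->
  (forall x, 0 < x -> g x = f x) -> F x @[x --> +oo] --> l ->
  (\int[mu]_x (f x)%:E = (2 * (l - F 0))%:E)%E.
Proof.
move=> f0 cf ef dF gf Fl.
rewrite ge0_symfun_integralT// -set_itvcy.
have cF : continuous F.
  by move=> x; apply: differentiable_continuous; apply/derivable1_diffP; have [] := dF x.
rewrite (@ge0_continuous_FTC2y _ f F 0 l)//.
- exact: continuous_subspaceT.
- exact/cvg_at_right_filter/cF.
- move=> x; rewrite in_itv/= andbT => x0; rewrite derive1E -gf//.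
  by have [_ h] := dF x; rewrite -h.
Qed.

Definition pexp (e x : R) := expR (- (e * `|x|)).
(** The Poisson kernel of the upper half-plane without the factor [1 / (2 * pi)]: in this form it is
    exactly the Fourier transform of [pexp e]. *)
Definition poisson (e z : R) := 2 * e / (e ^+ 2 + z ^+ 2).

Variable e : R.
Hypothesis e0 : 0 < e.

Lemma pexp_ge0 x : 0 <= pexp e x. Proof. exact: expR_ge0. Qed.

Lemma pexp_le1 x : pexp e x <= 1.
Proof. by rewrite /pexp -expR0 ler_expR oppr_le0 mulr_ge0// ltW. Qed.

Lemma continuous_pexp : continuous (pexp e).
Proof.
move=> x; apply: continuous_comp; last exact: continuous_expR.
apply: cvgN; apply: cvgM; [exact: cvg_cst|exact: norm_continuous].
Qed.

Lemma measurable_pexp : measurable_fun setT (pexp e).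
Proof. by apply: continuous_measurable_fun; exact: continuous_pexp. Qed.

Lemma poisson_den z : 0 < e ^+ 2 + z ^+ 2.
Proof. by rewrite ltr_wpDr ?sqr_ge0// exprn_gt0. Qed.

Lemma poisson_ge0 z : 0 <= poisson e z.
Proof. by rewrite divr_ge0 ?mulr_ge0// ltW// poisson_den. Qed.

Lemma continuous_poisson : continuous (poisson e).
Proof.
move=> z; apply: cvgM; first exact: cvg_cst.
apply: cvgV; first by rewrite gt_eqF// poisson_den.
apply: cvgD; [exact: cvg_cst|exact: exprn_continuous].
Qed.

Lemma measurable_poisson : measurable_fun setT (poisson e).
Proof. by apply: continuous_measurable_fun; exact: continuous_poisson. Qed.

Lemma integral_poissonE : (\int[mu]_x (poisson e x)%:E = (2 * pi)%:E)%E.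
Proof.
have dF (x : R) : is_derive x 1 (fun x => 2 * atan (x / e)) (poisson e x).
  apply: is_derive_eq.
  rewrite !(scaler0, addr0, add0r, mul0r, mulr0) /poisson /GRing.scale/=.
  have := poisson_den x => h.
  have e1 := lt0r_neq0 e0; have h' := lt0r_neq0 h.
  have h2 : 1 + (x / e) ^+ 2 != 0 by rewrite gt_eqF// ltr_wpDr ?sqr_ge0.
  by field; rewrite e1 h'.
have lF : 2 * atan (x / e) @[x --> +oo] --> (pi : R).
  rewrite [X in _ --> X](_ : pi = 2 * (pi / 2)); last by rewrite mulrC divfK.
  apply: cvgM; first exact: cvg_cst.
  apply: (@cvg_comp _ _ _ (fun x => x / e) atan _ (pinfty_nbhs R)); last exact: cvgy_atan.
  apply/cvgryPge => A; near=> x; rewrite ler_pdivlMr//; near: x.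
have := integral_even (poisson_ge0) continuous_poisson _ dF (fun _ _ => erefl) lF.
rewrite mul0r atan0 mulr0 subr0; apply => x.
by rewrite /poisson /= sqrrN.
Unshelve. all: by end_near. Qed.

Lemma rL1_poisson : rL1 (poisson e).
Proof.
apply: rL1_lty; [exact: measurable_poisson|exact: poisson_ge0|].
by rewrite integral_poissonE ltry.
Qed.

Lemma rintegral_poisson : \int[mu]_x poisson e x = 2 * pi.
Proof. by rewrite /Rintegral integral_poissonE. Qed.

(** The factor [1 + cos] keeps the integrand nonnegative, as [integral_even] requires; the summand 1
    is subtracted again in [rintegral_pexp_cos]. [F1 z] is obtained from the usual antiderivatives
    of [exp (- e x)] and [exp (- e x) cos (z x)]. *)
Let F1 z (x : R) := expR (- (e * x)) *
  (- e^-1 + (z * sin (z * x) - e * cos (z * x)) / (e ^+ 2 + z ^+ 2)).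

Let is_derive_F1 z (x : R) :
  is_derive x 1 (F1 z) (expR (- (e * x)) * (1 + cos (z * x))).
Proof.
rewrite /F1; apply: is_derive_eq.
rewrite !(scaler0, addr0, add0r, mul0r, mulr0) /GRing.scale/=.
have h' := lt0r_neq0 (poisson_den z); have e1 := lt0r_neq0 e0.
by field; rewrite e1 h'.
Qed.

Let cvg_F1 z : F1 z x @[x --> +oo] --> 0.
Proof.
pose M := e^-1 + (`|z| + e) / (e ^+ 2 + z ^+ 2).
have exp0 : expR (- (e * x)) * M @[x --> +oo] --> 0.
  rewrite -[X in _ --> X](mul0r M); apply: cvgM; last exact: cvg_cst.
  apply: (@cvg_comp _ _ _ (fun x => e * x) (fun y => expR (- y)) _ (pinfty_nbhs R)).
    apply/cvgryPge => A; near=> x; rewrite -ler_pdivrMl//; near: x.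
  exact: cvgr_expR.
apply: norm_cvg0; apply: (squeeze_cvgr _ (@cvg_cst _ (0:R) _ _ _) exp0).
apply: nearW => x; rewrite normr_ge0/= /F1 normrM ger0_norm ?expR_ge0//.
rewrite ler_wpM2l ?expR_ge0// (le_trans (ler_normD _ _))// /M.
rewrite normrN ger0_norm ?invr_ge0 ?(ltW e0)// lerD2l normrM.
rewrite (@ger0_norm _ (_^-1)) ?invr_ge0 ?(ltW (poisson_den z))//.
rewrite ler_wpM2r ?invr_ge0 ?(ltW (poisson_den z))//.
rewrite (le_trans (ler_normB _ _))// !normrM (ger0_norm (ltW e0)) lerD//.
- by rewrite ler_piMr// sin_max.
- by rewrite ler_piMr ?(ltW e0)// cos_max.
Unshelve. all: by end_near. Qed.

Lemma integral_pexp_cos1 z :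
  (\int[mu]_x (pexp e x * (1 + cos (z * x)))%:E = (2 / e + poisson e z)%:E)%E.
Proof.
have pos x : 0 <= pexp e x * (1 + cos (z * x)).
  by rewrite mulr_ge0 ?pexp_ge0//; have := cos_geN1 (z * x); lra.
have cont : continuous (fun x => pexp e x * (1 + cos (z * x))).
  move=> x; apply: cvgM; first exact: continuous_pexp.
  apply: cvgD; first exact: cvg_cst.
  apply: continuous_comp; last exact: continuous_cos.
  by apply: cvgM; [exact: cvg_cst|exact: cvg_id].
rewrite (integral_even pos cont _ (is_derive_F1 z) _ (@cvg_F1 z)).
- rewrite /F1 !mulr0 oppr0 expR0 sin0 cos0 /poisson.
  have h' := lt0r_neq0 (poisson_den z); have e1 := lt0r_neq0 e0.
  by congr (_%:E); field; rewrite e1 h'.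
- by move=> x /=; rewrite /pexp normrN mulrN cosN.
- by move=> x x0; rewrite /pexp gtr0_norm.
Qed.

Lemma rL1_pexp : rL1 (pexp e).
Proof.
have := integral_pexp_cos1 0 => h.
have : rL1 (fun x => pexp e x * (1 + cos (0 * x))).
  apply: rL1_lty; last by rewrite h ltry.
  - apply: measurable_realfun.measurable_funM; first exact: measurable_pexp.
    rewrite (_ : (fun x => _) = cst 2); first exact: measurable_cst.
    by apply/funext => x; rewrite mul0r cos0.
  - by move=> x; rewrite mul0r cos0 mulr_ge0// ?pexp_ge0.
apply: rL1_le; first exact: measurable_pexp.
move=> x; rewrite ger0_norm ?pexp_ge0// mul0r cos0.
by have := pexp_ge0 x; lra.
Qed.

Lemma rL1_pexp_mul (g : R -> R) : measurable_fun setT g ->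
  (forall x, `|g x| <= 1) -> rL1 (fun x => pexp e x * g x).
Proof.
move=> mg g1; apply: rL1_le rL1_pexp.
- by apply: measurable_realfun.measurable_funM => //; exact: measurable_pexp.
- by move=> x; rewrite normrM ger0_norm ?pexp_ge0// ler_piMr ?pexp_ge0.
Qed.

Lemma measurable_scale (f : R -> R) (z : R) : continuous f ->
  measurable_fun setT (fun x : R => f (z * x)).
Proof.
move=> cf; apply: continuous_measurable_fun => x; apply: continuous_comp; last exact: cf.
by apply: cvgM; [exact: cvg_cst|exact: cvg_id].
Qed.

Lemma rintegral_pexp_cos z : \int[mu]_x (pexp e x * cos (z * x)) = poisson e z.
Proof.
have c1 : rL1 (pexp e) := rL1_pexp.
have c2 z' : rL1 (fun x => pexp e x * cos (z' * x)).
  apply: rL1_pexp_mul; first by apply: measurable_scale; exact: continuous_cos.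
  by move=> x; exact: cos_max.
have key z' : \int[mu]_x pexp e x + \int[mu]_x (pexp e x * cos (z' * x)) =
    2 / e + poisson e z'.
  rewrite -RintegralD; [|exact: measurableT|exact: c1|exact: c2].
  apply: EFin_inj; rewrite -integral_pexp_cos1 -rL1_EFin; last exact: rL1D.
  by apply: eq_integral => x _; rewrite mulrDr mulr1.
(* At frequency 0 both integrals in [key] coincide and [poisson e 0 = 2 / e], so the integral of
   [pexp e] is [2 / e]. Subtracting it from [key z] leaves the cosine integral. *)
have := key 0; have := key z.
rewrite (_ : \int[mu]_x (pexp e x * cos (0 * x)) = \int[mu]_x pexp e x); last first.
  by apply: eq_Rintegral => x _; rewrite mul0r cos0 mulr1.
rewrite [in poisson e 0]/poisson expr0n/= addr0.
have -> : 2 * e / e ^+ 2 = 2 / e by field; exact: lt0r_neq0.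
by lra.
Qed.

Lemma rintegral_pexp_sin z : \int[mu]_x (pexp e x * sin (z * x)) = 0.
Proof.
have c2 : rL1 (fun x => pexp e x * sin (z * x)).
  apply: rL1_pexp_mul; first by apply: measurable_scale; exact: continuous_sin.
  by move=> x; exact: sin_max.
have := @rintegral_affine _ 0 (-1) _ _ c2; rewrite sqrrN expr1n => /(_ erefl).
rewrite (_ : (\int[mu]_x _) = - 1 * \int[mu]_x (pexp e x * sin (z * x))); first lra.
rewrite -RintegralZ//; apply: eq_Rintegral => x _.
by rewrite add0r mulN1r /pexp normrN mulrN sinN; ring.
Qed.

Lemma fourier_pexp z : J (fun x => cis (z * x) * (pexp e x)%:C) = (poisson e z)%:C.
Proof.
apply: complexP => /=.
- rewrite -rintegral_pexp_cos; apply: eq_Rintegral => x _.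
  by rewrite mulr0 subr0 [RHS]mulrC.
- rewrite -[RHS](rintegral_pexp_sin z); apply: eq_Rintegral => x _.
  by rewrite mulr0 add0r [RHS]mulrC.
Qed.

End PoissonKernel.

Section FourierBasics.
Context {R : realType}.
Notation mu := (@lebesgue_measure R).
Notation cn := Normc.normc.
Notation J f := (cintegral setT f).
Implicit Types (f g h : cfun R).

Definition cL2 f := cmeas f /\ rL1 (fun x => cn (f x) ^+ 2).
Definition n2 f : R := \int[mu]_x cn (f x) ^+ 2.
(* [s = -1] is the Fourier transform, [s = 1] its inverse up to the factor [2 * pi]. *)
Definition ft (s : R) h : cfun R := fun xi => J (fun x => cis (s * (x * xi)) * h x).

Lemma n2_ge0 f : 0 <= n2 f.
Proof. by apply: Rintegral_ge0 => x _; exact: sqr_ge0. Qed.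

(** Integrability of the limit is part of the conclusion. This is how square integrability is
    obtained, both for transforms and for limits of Cauchy sequences. *)
Lemma fatou_bound (g_ : nat -> R -> R) (g : R -> R) (M : R) :
  (forall n, rL1 (g_ n)) -> (forall n x, 0 <= g_ n x) ->
  measurable_fun setT g -> (forall x, 0 <= g x) ->
  {ae mu, forall x, g_ ^~ x @ \oo --> g x} ->
  (forall n, \int[mu]_x g_ n x <= M) -> rL1 g /\ \int[mu]_x g x <= M.
Proof.
move=> ig_ g_0 mg g0 gg gM.
have bound : (\int[mu]_x (g x)%:E <= M%:E)%E.
  have mg_ n : measurable_fun setT (EFin \o g_ n).
    by apply/measurable_EFinP; exact: rL1_measurable.
  have := @fatou _ _ _ mu setT measurableT (fun n => EFin \o g_ n) mg_
    (fun n x _ => g_0 n x).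
  have -> : (\int[mu]_x limn_einf (fun n => (EFin \o g_ n) x) = \int[mu]_x (g x)%:E)%E.
    apply: ae_eq_integral.
    - exact: measurableT.
    - rewrite /limn_einf; apply: measurableT_comp => //.
      apply: measurable_fun_limn_esup => n; apply: measurableT_comp => //.
      exact (mg_ n).
    - by have h : measurable_fun setT (EFin \o g) by [exact/measurable_EFinP]; exact h.
    - apply: ae_mono gg => x gx _ /=.
      have h : (fun n => (g_ n x)%:E) @ \oo --> (g x)%:E.
        by apply/fine_cvgP; split; [exact: nearW|exact: gx].
      exact: (cvg_limn_einf_sup h).1.
  move=> /le_trans; apply.
  rewrite limn_einf_lim; apply: lime_le; first exact: is_cvg_einfs.
  apply: nearW => n; apply: (@le_trans _ _ (\int[mu]_x (g_ n x)%:E)%E).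
    by apply: ereal_inf_lbound; exists n => //=.
  by rewrite rL1_EFin// lee_fin.
have ig : rL1 g by apply: rL1_lty => //; apply: le_lt_trans bound (ltry _).
by split => //; rewrite -lee_fin -rL1_EFin.
Qed.

Lemma measurable_mul_affine (s : R) :
  measurable_fun setT (fun z : R * R => s * (z.1 * z.2)).
Proof.
apply: measurable_realfun.measurable_funM; first exact: measurable_cst.
by apply: measurable_realfun.measurable_funM; [exact: measurable_fst|exact: measurable_snd].
Qed.

Lemma cL1_prod_ft (s : R) h g : cL1 h -> cL1 g ->
  cL1_prod (fun z => cis (s * (z.2 * z.1)) * h z.2 * g z.1).
Proof.
move=> [mh ih] [mg ig].
apply: (@cL1_prod_le _ _ (fun z => cn (g z.1) * cn (h z.2))).
- apply: cmeasM; last by apply: (cmeas_comp mg); exact: measurable_fst.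
  apply: cmeasM; last by apply: (cmeas_comp mh); exact: measurable_snd.
  apply: cmeas_cis; under eq_fun do rewrite [X in _ * X]mulrC.
  exact: measurable_mul_affine.
- by move=> z; rewrite !Normc.normcM normc_cis mul1r mulrC.
- by apply: (L1_prod_mul (a := fun x => cn (g x)) (b := fun x => cn (h x))) => // x;
    exact: normc_ge0.
Qed.

Lemma cL1_ft_integrand s h xi : cL1 h -> cL1 (fun x => cis (s * (x * xi)) * h x).
Proof.
apply: cL1_cis; apply: measurable_realfun.measurable_funM; first exact: measurable_cst.
by apply: measurable_realfun.measurable_funM; [exact: measurable_id|exact: measurable_cst].
Qed.

Lemma normc_ft s h xi : cL1 h -> cn (ft s h xi) <= \int[mu]_x cn (h x).
Proof.
move=> ih; apply: le_trans (normc_cintegral (cL1_ft_integrand _ _ ih)) _.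
by under eq_Rintegral do rewrite Normc.normcM normc_cis mul1r.
Qed.

Lemma cL1_mul_ft s h g : cL1 h -> cL1 g -> cL1 (fun xi => ft s h xi * g xi).
Proof.
move=> ih ig; have := cL1_cintegral (cL1_prod_ft s ih ig) => /=.
rewrite (_ : (fun x => _) = (fun xi => ft s h xi * g xi))//.
apply/funext => xi; rewrite mulrC /ft -cintegralZ; last exact: cL1_ft_integrand.
by apply: eq_cintegral => x; rewrite mulrC.
Qed.

Lemma cL1_pexp e : 0 < e -> cL1 (fun x : R => (pexp e x)%:C).
Proof.
move=> e0; apply: cL1_le (rL1_pexp e0).
- by apply: cmeas_real; exact: measurable_pexp.
- by move=> x; rewrite normc_real ger0_norm// pexp_ge0.
Qed.

(** Fubini gives measurability of the parametric integral only after multiplication by an integrable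
    function of [xi]. The weight [pexp 1] is positive and is divided out afterwards. *)
Lemma cmeas_ft s h : cL1 h -> cmeas (ft s h).
Proof.
move=> ih; have [m _] := cL1_mul_ft s ih (cL1_pexp ltr01).
have : cmeas (fun xi => ft s h xi * (pexp 1 xi)%:C * ((pexp 1 xi)^-1)%:C).
  apply: cmeasM => //; apply: cmeas_real.
  rewrite (_ : (fun x => _) = (fun x => expR (1 * `|x|))).
    apply: continuous_measurable_fun => x; apply: continuous_comp; last exact: continuous_expR.
    by apply: cvgM; [exact: cvg_cst|exact: norm_continuous].
  by apply/funext => x; rewrite /pexp expRN invrK.
rewrite (_ : (fun xi => _) = ft s h)//; apply/funext => xi.
by rewrite -mulrA -rmorphM/= divff ?mulr1// gt_eqF// expR_gt0.
Qed.

(** The kernel [cis (s * (x * xi))] is symmetric in [x] and [xi], so exchanging the integrals moves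
    the transform to the other factor. All duality arguments below start from here. *)
Lemma ft_mult s h g : cL1 h -> cL1 g ->
  J (fun xi => ft s h xi * g xi) = J (fun x => h x * ft s g x).
Proof.
move=> ih ig; have := cintegral_swap (cL1_prod_ft s ih ig) => /= e.
transitivity (J (fun x => J (fun y => cis (s * (y * x)) * h y * g x))).
  apply: eq_cintegral => xi; rewrite mulrC /ft -cintegralZ; last exact: cL1_ft_integrand.
  by apply: eq_cintegral => x; rewrite mulrC.
rewrite e; apply: eq_cintegral => x; rewrite /ft -cintegralZ; last exact: cL1_ft_integrand.
by apply: eq_cintegral => y; rewrite [y * x]mulrC; ring.
Qed.

Lemma ft_conj s h xi : cL1 h -> (conjc (ft s h xi)) = ft (- s) (fun x => (conjc (h x))) xi.
Proof.
move=> ih; rewrite /ft -cintegral_conj; last exact: cL1_ft_integrand.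
apply: eq_cintegral => x. by rewrite conjcM cis_conj mulNr.
Qed.

End FourierBasics.

Section Bessel.
Context {R : realType}.
Notation mu := (@lebesgue_measure R).
Notation cn := Normc.normc.
Notation J f := (cintegral setT f).
Implicit Types (f g h : cfun R).

Lemma measurable_fun_sub_affine (s : R) :
  measurable_fun setT (fun z : R * R => s * (z.1 - z.2)).
Proof.
apply: measurable_realfun.measurable_funM; first exact: measurable_cst.
by apply: measurable_realfun.measurable_funB; [exact: measurable_fst|exact: measurable_snd].
Qed.

Lemma L1_prod_conv (a b : R -> R) (s : R) : s ^+ 2 = 1 ->
  (forall x, 0 <= a x) -> (forall x, 0 <= b x) -> rL1 a -> rL1 b ->
  L1_prod (fun z => a z.2 * b (s * (z.1 - z.2))).
Proof.
move=> s1 a0 b0 ia ib.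
have mk : measurable_fun setT (fun z : R * R => a z.2 * b (s * (z.1 - z.2))).
  apply: measurable_realfun.measurable_funM.
    by apply: measurableT_comp; [exact: rL1_measurable|exact: measurable_snd].
  by apply: measurableT_comp; [exact: rL1_measurable|exact: measurable_fun_sub_affine].
have k0 z : 0 <= a z.2 * b (s * (z.1 - z.2)) by exact: mulr_ge0.
apply: L1_prod_tonelli => //.
have /= -> := tonelli_swap mk k0.
rewrite (_ : (fun y => _) = (fun y => ((\int[mu]_x b x) * a y)%:E)).
  apply: rL1_lty_inv; last exact: rL1Z.
  by move=> x; rewrite mulr_ge0//; apply: Rintegral_ge0.
apply/funext => y.
have e : (fun x => a y * b (s * (x - y))) = (fun x => a y * b (- (s * y) + s * x)).
  by apply/funext => x; congr (_ * b _); ring.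
transitivity (\int[mu]_x (a y * b (- (s * y) + s * x))%:E)%E.
  by apply: eq_integral => x _; have := congr1 (@^~ x) e => /= ->.
rewrite rL1_EFin; last exact/rL1Z/rL1_affine.
by rewrite RintegralZ ?rintegral_affine//; [rewrite mulrC|exact: rL1_affine].
Qed.

Lemma rintegral_conv (a b : R -> R) (s : R) : s ^+ 2 = 1 ->
  (forall x, 0 <= a x) -> (forall x, 0 <= b x) -> rL1 a -> rL1 b ->
  \int[mu]_x (\int[mu]_y (a y * b (s * (x - y)))) =
  \int[mu]_x a x * \int[mu]_x b x.
Proof.
move=> s1 a0 b0 ia ib.
rewrite (rintegral_swap (L1_prod_conv s1 a0 b0 ia ib))/=.
transitivity (\int[mu]_y ((\int[mu]_x b x) * a y)); last by rewrite RintegralZ// mulrC.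
apply: eq_Rintegral => y _.
rewrite RintegralZ; last first.
  have := @rL1_affine _ (- (s * y)) s _ s1 ib.
  by congr rL1; apply/funext => x; congr b; ring.
rewrite mulrC; congr (_ * _).
rewrite -(@rintegral_affine _ (- (s * y)) s _ s1 ib).
by apply: eq_Rintegral => x _; congr b; ring.
Qed.

Lemma measurable_phase (s x : R) : measurable_fun setT (fun xi : R => s * (x * xi)).
Proof.
apply: continuous_measurable_fun => y.
by do 2 (apply: cvgM; first exact: cvg_cst); exact: cvg_id.
Qed.

Lemma poisson_le e (z : R) : 0 < e -> poisson e z <= 2 / e.
Proof.
move=> e0; rewrite /poisson ler_pdivrMr ?poisson_den// mulrAC ler_pdivlMr//.
by rewrite mulrDr -mulrA -expr2 lerDl mulr_ge0// sqr_ge0.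
Qed.

(** Modulation becomes translation. This modulated exponential is the test function through which
    Bessel's inequality, inversion and its converse all pass. *)
Lemma ft_pexp_cis e (s c y : R) : 0 < e ->
  ft (- s) (fun xi => cis (s * (c * xi)) * (pexp e xi)%:C) y =
  (poisson e (s * (c - y)))%:C.
Proof.
move=> e0; rewrite -fourier_pexp//; apply: eq_cintegral => x.
by rewrite mulrA -cisD; congr (cis _ * _); ring.
Qed.

Lemma cintegral_real (a : R -> R) : J (fun x => (a x)%:C) = (\int[mu]_x a x)%:C.
Proof. by apply: complexP => //=; rewrite Rintegral_cst//= mul0r. Qed.

(* Damping by [exp (- e |xi|)], the energy of the transform becomes a quadratic
   form in [h] whose kernel is positive and has total mass [2 pi]. *)
Lemma bessel_damped e s h : 0 < e -> s ^+ 2 = 1 -> cL1 h -> cL2 h ->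
  rL1 (fun xi => cn (ft s h xi) ^+ 2 * pexp e xi) /\
  \int[mu]_xi (cn (ft s h xi) ^+ 2 * pexp e xi) <= 2 * pi * n2 h.
Proof.
move=> e0 s1 ih [mh ih2].
have ihc : cL1 (fun x => conjc (h x)) by exact: cL1_conj.
pose M := \int[mu]_x cn (h x).
have hM xi : cn (ft s h xi) <= M by exact: normc_ft.
have M0 : 0 <= M by apply: Rintegral_ge0 => x _; exact: normc_ge0.
(* With this [g], the damped energy is the pairing of [ft s h] with [g]. By [ft_mult] it is also the
   pairing of [h] with [ft s g], which is a Poisson average of the conjugate of [h]. *)
pose g xi := conjc (ft s h xi) * (pexp e xi)%:C.
have ig : cL1 g.
  apply: (@cL1M_bounded _ (fun xi => (pexp e xi)%:C) (fun xi => conjc (ft s h xi)) M);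
    first exact: cL1_pexp.
  - by apply: cmeas_conj; exact: cmeas_ft.
  - by move=> x; rewrite normc_conj; exact: hM.
have eg xi : ft s h xi * g xi = (cn (ft s h xi) ^+ 2 * pexp e xi)%:C.
  by rewrite /g mulrA -normc_sqrE -rmorphM.
have Ig : rL1 (fun xi => cn (ft s h xi) ^+ 2 * pexp e xi).
  have := cL1_Re (cL1_mul_ft s ih ig).
  by under eq_fun do rewrite eg /=.
split => //.
have gE x : ft s g x = J (fun y => conjc (h y) * (poisson e (s * (x - y)))%:C).
  transitivity (J (fun xi => ft (- s) (fun y => conjc (h y)) xi *
      (cis (s * (x * xi)) * (pexp e xi)%:C))).
    apply: eq_cintegral => xi; rewrite /g ft_conj// [xi * x]mulrC.
    by rewrite mulrCA.
  rewrite ft_mult//; last first.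
    by apply: cL1_cis (cL1_pexp e0); exact: measurable_phase.
  by apply: eq_cintegral => y; rewrite ft_pexp_cis.
pose P x y := poisson e (s * (x - y)).
have P0 x y : 0 <= P x y by exact: poisson_ge0.
have PE x y : P x y = poisson e (s * x + - s * y) by congr poisson; ring.
have ms1 : (- s) ^+ 2 = 1 by rewrite sqrrN.
have mP x : measurable_fun setT (P x).
  rewrite (_ : P x = fun y => poisson e (s * x + - s * y)); last exact/funext/PE.
  by apply: rL1_measurable; apply: rL1_affine => //; exact: rL1_poisson.
have iP x : rL1 (P x).
  rewrite (_ : P x = fun y => poisson e (s * x + - s * y)); last exact/funext/PE.
  by apply: rL1_affine => //; exact: rL1_poisson.
have IP x : \int[mu]_y P x y = 2 * pi.
  rewrite -(rintegral_poisson e0) -(rintegral_affine (s * x) ms1 (rL1_poisson e0)).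
  by apply: eq_Rintegral => y _; exact: PE.
have imulP (a : R -> R) x : (forall y, 0 <= a y) -> rL1 a -> rL1 (fun y => a y * P x y).
  move=> a0 ia; apply: (@rL1_le _ _ (fun y => 2 / e * a y)); last exact: rL1Z.
  - by apply: measurable_realfun.measurable_funM => //; exact: rL1_measurable.
  - move=> y; have h0 : 0 <= a y * P x y by exact: mulr_ge0.
    rewrite (ger0_norm h0) mulrC; apply: ler_wpM2r => //; exact: poisson_le.
have cn0 x : 0 <= cn (h x) by exact: normc_ge0.
have cn20 x : 0 <= cn (h x) ^+ 2 by exact: sqr_ge0.
(* Schur's test: [cn (h x) * cn (h y)] is at most half the sum of the squares, and integration in
   [y] against [P x], of mass [2 * pi], gives [D x]. Each half contributes [pi * n2 h] to the
   integral of [D]. *)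
pose D x := 2^-1 * (2 * pi * cn (h x) ^+ 2 + \int[mu]_y (cn (h y) ^+ 2 * P x y)).
have conv := rintegral_prod (L1_prod_conv s1 cn20 (poisson_ge0 e0) ih2 (rL1_poisson e0)).
have iD : rL1 D by apply: rL1Z; apply: rL1D; [exact: rL1Z|exact: conv.1].
have ID : \int[mu]_x D x = 2 * pi * n2 h.
  rewrite RintegralZ; last by apply: rL1D; [exact: rL1Z|exact: conv.1].
  rewrite RintegralD//; [|exact: rL1Z|exact: conv.1].
  rewrite RintegralZ// (rintegral_conv s1 cn20 (poisson_ge0 e0) ih2 (rL1_poisson e0)).
  by rewrite rintegral_poisson// -/(n2 h); field.
have hgD x : cn (h x * ft s g x) <= D x.
  have i1 : rL1 (fun y => cn (h y) * P x y) by apply: imulP => //; case: ih.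
  have cf : cL1 (fun y => conjc (h y) * (poisson e (s * (x - y)))%:C).
    apply: (cL1_le _ _ i1); first by apply: cmeasM; [exact: cmeas_conj|exact: (cmeas_real (mP x))].
    by move=> y; rewrite Normc.normcM normc_conj normc_real ger0_norm//; exact: P0.
  rewrite Normc.normcM gE; apply: (@le_trans _ _ (cn (h x) * \int[mu]_y (cn (h y) * P x y))).
    rewrite ler_wpM2l//; apply: le_trans (normc_cintegral cf) _.
    rewrite le_eqVlt; apply/orP; left; apply/eqP; apply: eq_Rintegral => y _.
    by rewrite Normc.normcM normc_conj normc_real ger0_norm//; exact: P0.
  rewrite -RintegralZ// /D -(IP x) [_ * cn (h x) ^+ 2]mulrC -RintegralZ//.
  rewrite -RintegralD//; [|exact: rL1Z|exact: imulP].
  rewrite -RintegralZ; last by apply: rL1D; [exact: rL1Z|exact: imulP].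
  apply: le_rintegral; first exact: rL1Z.
    by apply: rL1Z; apply: rL1D; [exact: rL1Z|exact: imulP].
  move=> y; rewrite mulrA -mulrDl mulrA ler_wpM2r//.
  by have := sqr_ge0 (cn (h x) - cn (h y)); rewrite sqrrB; lra.
rewrite -ID.
have ihg : cL1 (fun x => h x * ft s g x).
  by under eq_fun do rewrite mulrC; exact: cL1_mul_ft.
have B0 : 0 <= \int[mu]_xi (cn (ft s h xi) ^+ 2 * pexp e xi).
  by apply: Rintegral_ge0 => x _; rewrite mulr_ge0 ?sqr_ge0 ?pexp_ge0.
have <- : cn (J (fun x => h x * ft s g x)) = \int[mu]_xi (cn (ft s h xi) ^+ 2 * pexp e xi).
  rewrite -ft_mult// -[RHS]ger0_norm// -normc_real; congr cn.
  by rewrite (eq_cintegral eg) cintegral_real.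
apply: le_trans (normc_cintegral ihg) _; apply: le_rintegral => //.
by case: ihg.
Qed.

Lemma cvg_pexp (x : R) : (fun n => pexp n.+1%:R^-1 x) @ \oo --> (1 : R).
Proof.
rewrite [X in _ --> X](_ : (1 : R) = expR (- (0 * `|x|))); last by rewrite mul0r oppr0 expR0.
apply: continuous_cvg; first exact: continuous_expR.
by apply: cvgN; apply: cvgM; [exact: cvg_harmonic|exact: cvg_cst].
Qed.

(** The bound of [bessel_damped] does not depend on [e], so Fatou's lemma removes the damping along
    [e = 1 / (n + 1)]. *)
Lemma bessel s h : s ^+ 2 = 1 -> cL1 h -> cL2 h ->
  cL2 (ft s h) /\ n2 (ft s h) <= 2 * pi * n2 h.
Proof.
move=> s1 ih ih2.
have e0 n : 0 < n.+1%:R^-1 :> R by rewrite invr_gt0.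
have mft := cmeas_ft s ih.
have [] := @fatou_bound _ (fun n xi => cn (ft s h xi) ^+ 2 * pexp n.+1%:R^-1 xi)
  (fun xi => cn (ft s h xi) ^+ 2) (2 * pi * n2 h).
- by move=> n; exact: (bessel_damped (e0 n) s1 ih ih2).1.
- by move=> n x; rewrite mulr_ge0 ?sqr_ge0 ?pexp_ge0.
- by apply: measurable_funX; exact: measurable_normc.
- by move=> x; exact: sqr_ge0.
- apply: aeW => x; rewrite -[X in _ --> X]mulr1.
  by apply: cvgM; [exact: cvg_cst|exact: cvg_pexp].
- by move=> n; exact: (bessel_damped (e0 n) s1 ih ih2).2.
- by move=> a b; split => //; split.
Qed.

End Bessel.

(** * Square-integrable functions and their truncations *)

Section L2Basics.
Context {R : realType}.
Notation mu := (@lebesgue_measure R).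
Notation cn := Normc.normc.
Notation J f := (cintegral setT f).
Implicit Types (f g h : cfun R).

Lemma cL2_le f (g : R -> R) : cmeas f -> (forall x, cn (f x) ^+ 2 <= g x) ->
  rL1 g -> cL2 f.
Proof.
move=> mf fg ig; split => //; apply: rL1_le ig.
- by apply: measurable_funX; exact: measurable_normc.
- by move=> x; rewrite ger0_norm ?sqr_ge0.
Qed.

Lemma cL2D f g : cL2 f -> cL2 g -> cL2 (fun x => f x + g x).
Proof.
move=> [mf If] [mg ig]; apply: (@cL2_le _ (fun x => 2 * cn (f x) ^+ 2 + 2 * cn (g x) ^+ 2)).
- exact: cmeasD.
- by move=> x; exact: normcD_sqr.
- by apply: rL1D; exact: rL1Z.
Qed.

Lemma cL2M_bounded f g (M : R) : cL2 f -> cmeas g -> (forall x, cn (g x) <= M) ->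
  cL2 (fun x => g x * f x).
Proof.
move=> [mf If] mg gM; apply: (@cL2_le _ (fun x => M ^+ 2 * cn (f x) ^+ 2)).
- exact: cmeasM.
- move=> x; rewrite Normc.normcM exprMn ler_wpM2r ?sqr_ge0//.
  by rewrite ler_pXn2r ?nnegrE ?normc_ge0//; exact: le_trans (normc_ge0 _) (gM x).
- exact: rL1Z.
Qed.

Lemma cL2Z (c : R[i]) f : cL2 f -> cL2 (fun x => c * f x).
Proof.
by move=> If; apply: (@cL2M_bounded _ (fun=> c) (cn c)) => //; exact: cmeas_cst.
Qed.

Lemma cL2N f : cL2 f -> cL2 (fun x => - f x).
Proof. by move=> /(@cL2Z (-1)); under eq_fun do rewrite mulN1r. Qed.

Lemma cL2B f g : cL2 f -> cL2 g -> cL2 (fun x => f x - g x).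
Proof. by move=> If /cL2N; exact: cL2D. Qed.

Lemma cL2_conj f : cL2 f -> cL2 (fun x => conjc (f x)).
Proof.
move=> [mf If]; split; first exact: cmeas_conj.
by under eq_fun do rewrite normc_conj.
Qed.

Lemma n2N f : n2 (fun x => - f x) = n2 f.
Proof. by apply: eq_Rintegral => x _; rewrite normcN. Qed.

Lemma n2D f g : cL2 f -> cL2 g -> n2 (fun x => f x + g x) <= 2 * n2 f + 2 * n2 g.
Proof.
move=> [mf If] [mg ig]; rewrite /n2 -RintegralZ// -RintegralZ//.
rewrite -RintegralD//; [|exact: rL1Z..].
apply: le_rintegral.
- by have [] := cL2D (conj mf If) (conj mg ig).
- by apply: rL1D; exact: rL1Z.
- by move=> x; exact: normcD_sqr.
Qed.

Lemma n2_le f g : cL2 f -> cL2 g -> (forall x, cn (f x) <= cn (g x)) -> n2 f <= n2 g.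
Proof.
move=> [_ If] [_ ig] fg; apply: le_rintegral => // x.
by rewrite ler_pXn2r// nnegrE normc_ge0.
Qed.

Lemma n2M_le f g (M : R) : cL2 f -> cmeas g -> (forall x, cn (g x) <= M) ->
  n2 (fun x => g x * f x) <= M ^+ 2 * n2 f.
Proof.
move=> If mg gM; rewrite /n2 -RintegralZ; last by case: If.
apply: le_rintegral; first by have [] := cL2M_bounded If mg gM.
  by apply: rL1Z; case: If.
move=> x; rewrite Normc.normcM exprMn ler_wpM2r ?sqr_ge0//.
by rewrite ler_pXn2r ?nnegrE ?normc_ge0//; exact: le_trans (normc_ge0 _) (gM x).
Qed.

Lemma cL1M f g : cL2 f -> cL2 g -> cL1 (fun x => f x * g x).
Proof.
move=> [mf If] [mg ig]; apply: (@cL1_le _ _ (fun x => cn (f x) ^+ 2 + cn (g x) ^+ 2)).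
- exact: cmeasM.
- by move=> x; rewrite Normc.normcM; exact: normcM_ler2.
- exact: rL1D.
Qed.

Lemma cauchy_schwarz f g : cL2 f -> cL2 g ->
  (\int[mu]_x cn (f x * g x)) ^+ 2 <= n2 f * n2 g.
Proof.
move=> If Ig; set B := \int[mu]_x _.
have B0 : 0 <= B by apply: Rintegral_ge0 => x _; exact: normc_ge0.
have A0 := n2_ge0 f.
have [_ iB] := cL1M If Ig.
have quad (l : R) : 2 * l * B <= l ^+ 2 * n2 f + n2 g.
  case: If => mf If; case: Ig => mg Ig.
  rewrite /n2 /B -RintegralZ// -RintegralZ// -RintegralD//; last exact: rL1Z.
  apply: le_rintegral; [exact: rL1Z|by apply: rL1D => //; exact: rL1Z|] => x.
  rewrite Normc.normcM -subr_ge0 [X in 0 <= X](_ : _ = (l * cn (f x) - cn (g x)) ^+ 2).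
    exact: sqr_ge0.
  by ring.
(* [quad] holds for every real [l]. If [n2 f = 0] and [B] were nonzero, an [l] making the left side
   [n2 g + 1] would contradict it. Otherwise the optimal choice [l = B / n2 f] gives the
   inequality. *)
have [A1|A1] := eqVneq (n2 f) 0.
  have [->|Bn] := eqVneq B 0; first by rewrite expr0n/= A1 mul0r.
  have := quad ((n2 g + 1) / (2 * B)); rewrite A1 mulr0 add0r.
  have -> : 2 * ((n2 g + 1) / (2 * B)) * B = n2 g + 1 by field.
  by lra.
have Ap : 0 < n2 f by rewrite lt_neqAle eq_sym A1.
have := quad (B / n2 f).
have -> : 2 * (B / n2 f) * B = B ^+ 2 / n2 f + B ^+ 2 / n2 f by field.
have -> : (B / n2 f) ^+ 2 * n2 f = B ^+ 2 / n2 f by field.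
rewrite lerD2l ler_pdivrMr//.
by rewrite mulrC.
Qed.

Lemma cintegralM_cvg (u : nat -> cfun R) f g : (forall n, cL2 (u n)) -> cL2 f ->
  cL2 g -> (fun n => n2 (fun x => u n x - f x)) @ \oo --> (0 : R) ->
  clim (fun n => J (fun x => u n x * g x)) (J (fun x => f x * g x)).
Proof.
move=> iu If Ig uf.
apply: (@clim_le _ _ _ (fun n => Num.sqrt (n2 (fun x => u n x - f x) * n2 g))); last first.
  rewrite -[X in _ --> X](_ : Num.sqrt (0 * n2 g) = 0); last by rewrite mul0r sqrtr0.
  apply: (continuous_cvg _ (@sqrt_continuous _ _)).
  by apply: cvgM => //; exact: cvg_cst.
move=> n; have iun := cL2B (iu n) If.
rewrite -cintegralB; [|exact: cL1M..].
rewrite (@eq_cintegral _ _ (fun x => (u n x - f x) * g x)); last by move=> x; rewrite mulrBl.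
apply: le_trans (normc_cintegral (cL1M iun Ig)) _.
rewrite -[leLHS]ger0_norm ?Rintegral_ge0//; last by move=> x _; exact: normc_ge0.
by rewrite -sqrtr_sqr ler_wsqrtr// cauchy_schwarz.
Qed.

(** Truncation makes a function of L2 integrable, so that [ft] applies to it, and the window is the
    one used in [is_fourier]. *)
Definition cut (N : nat) f : cfun R :=
  fun x => (\1_(`[- N%:R, N%:R] : set R) x)%:C * f x.

Lemma measurable_cutI N : measurable_fun setT (\1_(`[- N%:R, N%:R] : set R) : R -> R).
Proof. by apply: measurable_indic; exact: measurable_itv. Qed.

Lemma normc_indic (A : set R) x : cn (\1_A x)%:C = \1_A x :> R.
Proof. by rewrite normc_real ger0_norm// indicE. Qed.

Lemma indic_le1 (A : set R) x : \1_A x <= 1 :> R.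
Proof. by rewrite indicE; case: (_ \in _). Qed.

Lemma rL1_indic_itv (a b : R) : rL1 (\1_(`[a, b] : set R) : R -> R).
Proof.
apply: rL1_lty.
- by apply: measurable_indic; exact: measurable_itv.
- by move=> x; rewrite indicE.
- have -> : (\int[mu]_x (\1_(`[a, b] : set R) x)%:E)%E = mu `[a, b]%classic.
    by rewrite integral_indic// ?setIT.
  by rewrite lebesgue_measure_itv/= lte_fin; case: ifP => _; rewrite -?EFinB ltry.
Qed.

Lemma cL2_cut N f : cL2 f -> cL2 (cut N f).
Proof.
move=> If; apply: (@cL2M_bounded _ _ 1) => //.
- by apply: cmeas_real; exact: measurable_cutI.
- by move=> x; rewrite normc_indic indic_le1.
Qed.

Lemma cL1_cut N f : cL2 f -> cL1 (cut N f).
Proof.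
move=> If; apply: (@cL1M (fun x => (\1_(`[- N%:R, N%:R] : set R) x)%:C)) => //.
apply: (@cL2_le _ (\1_(`[- N%:R, N%:R] : set R))); last exact: rL1_indic_itv.
- by apply: cmeas_real; exact: measurable_cutI.
- by move=> x; rewrite normc_indic indicE; case: (_ \in _); rewrite ?expr0n ?expr1n.
Qed.

Lemma cut_cvg x : \forall N \near \oo, \1_(`[- N%:R, N%:R] : set R) x = 1 :> R.
Proof.
near=> N; rewrite indicE mem_set//= in_itv/= -ler_norml; near: N.
exact: nbhs_infty_ger.
Unshelve. all: by end_near. Qed.

Lemma cut_lim f x : clim (fun N => cut N f x) (f x).
Proof.
apply: cvg_near_cst; near=> N; rewrite /cut (near (cut_cvg x) N)// mul1r subrr.
exact: Normc.normc0.
Unshelve. all: by end_near. Qed.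

Lemma normc_cut_le N f x : cn (cut N f x) <= cn (f x).
Proof. by rewrite Normc.normcM normc_indic ler_piMl ?normc_ge0// indic_le1. Qed.

Lemma n2_cut f : cL2 f -> (fun N => n2 (fun x => cut N f x - f x)) @ \oo --> (0 : R).
Proof.
move=> If; rewrite [X in _ --> X](_ : 0 = \int[mu]_x (0 : R)); last first.
  by rewrite Rintegral_cst//= mul0r.
have [mf If2] := If.
apply: (@rintegral_dct _ _ _ (fun x => 4 * cn (f x) ^+ 2)).
- move=> n; apply: measurable_funX; apply: measurable_normc; apply: cmeasB => //.
  by have [] := cL2_cut n If.
- exact: measurable_cst.
- apply: aeW => x; rewrite -[X in _ --> X](_ : 0 ^+ 2 = 0 :> R); last by rewrite expr0n.
  by apply: (continuous_cvg _ (@exprn_continuous _ 2 _)); exact: cut_lim.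
- exact: rL1Z.
- move=> n x; rewrite ger0_norm ?sqr_ge0//.
  have := normcD_sqr (cut n f x) (- f x); rewrite normcN => /le_trans; apply.
  have h : cn (cut n f x) ^+ 2 <= cn (f x) ^+ 2.
    by rewrite ler_pXn2r ?nnegrE ?normc_ge0// normc_cut_le.
  by move: h; lra.
Qed.

End L2Basics.

(** * The Fourier-Plancherel transform and inversion *)

Section RieszFischer.
Context {R : realType}.
Notation mu := (@lebesgue_measure R).
Notation cn := Normc.normc.
Notation J f := (cintegral setT f).
Implicit Types (f g h : cfun R).

Lemma cvg_summable_diff (a : nat -> R) (M : R) :
  (forall n, \sum_(0 <= k < n) `|a k.+1 - a k| <= M) -> cvgn a.
Proof.
move=> aM.
have c : cvgn (series (fun k => a k.+1 - a k)).
  apply: normed_cvg; apply: nondecreasing_is_cvgn.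
    by apply: nondecreasing_series => k _ _; exact: normr_ge0.
  by exists M => _ [n _ <-]; exact: aM.
have : cvgn (fun n => series (fun k => a k.+1 - a k) n + a 0%N).
  by apply: is_cvgD => //; exact: is_cvg_cst.
rewrite (_ : (fun n => _) = a)//; apply/funext => n.
by rewrite seriesEnat/= telescope_sumr// subrK.
Qed.

(* Meaningful only where [u n x] converges as [n] tends to infinity. *)
Definition plim (u : nat -> R -> R) : R -> R :=
  fun x => fine (limn_esup (fun n => (u n x)%:E)).

Lemma measurable_plim (u : nat -> R -> R) :
  (forall n, measurable_fun setT (u n)) -> measurable_fun setT (plim u).
Proof.
move=> mu_; have h : measurable_fun setT (fun x => limn_esup (fun n => (u n x)%:E)).
  by apply: (measurable_fun_limn_esup (f := fun n x => (u n x)%:E)) => n;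
    exact/measurable_EFinP.
exact: (measurableT_comp (fine_measurable _) h).
Qed.

Lemma plimE (u : nat -> R -> R) x : cvgn (u ^~ x) -> u ^~ x @ \oo --> plim u x.
Proof.
move=> c; rewrite /plim.
have h : (fun n => (u n x)%:E) @ \oo --> (limn (u ^~ x))%:E.
  by apply/fine_cvgP; split; [exact: nearW|exact: c].
by rewrite (cvg_limn_einf_sup h).2.
Qed.

(** The series of [2 ^ k * cn (u k.+1 x - u k x) ^+ 2] has integral at most the sum of [2 ^- k],
    hence is finite almost everywhere. The inequality [c <= 2 ^ k * c ^ 2 + 2 ^- k] then bounds the
    increments themselves; the second terms add up to at most 2. *)
Lemma fast_cauchy_cvg (u : nat -> cfun R) : (forall n, cL2 (u n)) ->
  (forall k, n2 (fun x => u k.+1 x - u k x) <= 4^-1 ^+ k) ->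
  {ae mu, forall x, exists M : R, forall n,
     \sum_(0 <= k < n) cn (u k.+1 x - u k x) <= M}.
Proof.
move=> iu un.
pose d k x := 2 ^+ k * cn (u k.+1 x - u k x) ^+ 2.
have d0 k x : 0 <= d k x by apply: mulr_ge0; [exact: exprn_ge0|exact: sqr_ge0].
have id k : rL1 (d k) by apply: rL1Z; have [] := cL2B (iu k.+1) (iu k).
have Id k : (\int[mu]_x (d k x)%:E <= (2^-1 ^+ k)%:E)%E.
  rewrite rL1_EFin// lee_fin RintegralZ; last by have [] := cL2B (iu k.+1) (iu k).
  apply: (@le_trans _ _ (2 ^+ k * 4^-1 ^+ k)); first by apply: ler_wpM2l; [exact: exprn_ge0|exact: un].
  by rewrite -exprMn le_eqVlt; apply/orP; left; apply/eqP; congr (_ ^+ k); field.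
have mS : measurable_fun setT (fun x => (\sum_(0 <= k <oo) (d k x)%:E)%E).
  apply: (emeasurable_fun_cvg (fun n x => (\sum_(0 <= k < n) (d k x)%:E)%E)).
    move=> n; apply: emeasurable_sum => k.
    by apply/measurable_EFinP; exact: rL1_measurable.
  by move=> x _; apply: is_cvg_nneseries => k _ _; rewrite lee_fin.
have S0 x : (0 <= \sum_(0 <= k <oo) (d k x)%:E)%E.
  by apply: nneseries_ge0 => k _ _; rewrite lee_fin.
have le2 n : \sum_(0 <= k < n) (2^-1 : R) ^+ k <= 2.
  suff -> : \sum_(0 <= k < n) (2^-1 : R) ^+ k = 2 - 2 * 2^-1 ^+ n.
    by rewrite gerBl mulr_ge0// exprn_ge0.
  elim: n => [|n IHn]; first by rewrite big_nil expr0; ring.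
  by rewrite big_nat_recr//= IHn exprS; field.
have IS : (\int[mu]_x (\sum_(0 <= k <oo) (d k x)%:E) < +oo)%E.
  rewrite integral_nneseries//; last 2 first.
  - by move=> k; apply/measurable_EFinP; exact: rL1_measurable.
  - by move=> k x _; rewrite lee_fin.
  apply: (@le_lt_trans _ _ (\sum_(0 <= k <oo) (2^-1 ^+ k)%:E)%E).
    apply: lee_nneseries => [k _ _|k _]; last exact: Id.
    by apply: integral_ge0 => x _; rewrite lee_fin.
  apply: (@le_lt_trans _ _ 2%:E); last exact: ltry.
  apply: lime_le; first by apply: is_cvg_nneseries => k _ _; rewrite lee_fin exprn_ge0.
  by apply: nearW => n; rewrite sumEFin lee_fin; exact: le2.
have iS : mu.-integrable setT (fun x => (\sum_(0 <= k <oo) (d k x)%:E)%E).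
  apply/integrableP; split => //.
  by under eq_integral do rewrite gee0_abs//.
have := integrable_ae measurableT iS; apply: ae_mono => x /(_ I) fS.
exists (fine (\sum_(0 <= k <oo) (d k x)%:E)%E + 2) => n.
have leS : \sum_(0 <= k < n) d k x <= fine (\sum_(0 <= k <oo) (d k x)%:E)%E.
  rewrite -lee_fin fineK// -sumEFin.
  by apply: nneseries_lim_ge => k _ _; rewrite lee_fin.
apply: (@le_trans _ _ (\sum_(0 <= k < n) (d k x + 2^-1 ^+ k))); last first.
  by rewrite big_split/=; exact: lerD.
apply: ler_sum => k _; rewrite /d.
have p : 0 < (2 : R) ^+ k by rewrite exprn_gt0.
rewrite exprVn; move: (2 ^+ k) p (cn _) => t t0 c.
rewrite -(ler_pM2l t0) mulrDr divff ?gt_eqF// -subr_ge0.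
have := sqr_ge0 (t * c - 2^-1); rewrite sqrrB expr2.
by nra.
Qed.
End RieszFischer.

Section RieszFischerThm.
Context {R : realType}.
Notation mu := (@lebesgue_measure R).
Notation cn := Normc.normc.
Notation J f := (cintegral setT f).
Implicit Types (f g h : cfun R).

Lemma clim_ReIm (u : nat -> R[i]) (l : R[i]) :
  (fun n => complex.Re (u n)) @ \oo --> complex.Re l ->
  (fun n => complex.Im (u n)) @ \oo --> complex.Im l -> clim u l.
Proof.
move=> ur ui; apply: (@clim_le _ _ _
  (fun n => `|complex.Re (u n) - complex.Re l| + `|complex.Im (u n) - complex.Im l|)).
  by move=> n; apply: le_trans (normc_le_ReIm _) _; rewrite ReD ReN ImD ImN.
rewrite -[0]addr0; apply: cvgD; rewrite -(normr0 R);
  by apply: cvg_norm; apply/subr_cvg0.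
Qed.

Lemma clim_normc (u : nat -> R[i]) (l : R[i]) : clim u l ->
  (fun n => cn (u n)) @ \oo --> cn l.
Proof.
move=> ul; apply/cvgrPdist_le => e e0.
move/cvgrPdist_le : ul => /(_ e e0); apply: filterS => n.
rewrite sub0r normrN ger0_norm ?normc_ge0// => /le_trans h.
rewrite ler_norml; apply/andP; split.
- have := normcD (u n - l) l; rewrite subrK => h1.
  by have := h _ (lexx e); lra.
- have := normcD (l - u n) (u n); rewrite subrK normcB => h1.
  by have := h _ (lexx e); lra.
Qed.

Lemma clim_subr (c : R[i]) (u : nat -> R[i]) (l : R[i]) : clim u l ->
  clim (fun n => c - u n) (c - l).
Proof.
rewrite /clim (_ : (fun n => cn (c - u n - (c - l))) = (fun n => cn (u n - l)))//.
by apply/funext => n; rewrite -normcN; congr cn; ring.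
Qed.

Lemma riesz_fischer (u : nat -> cfun R) : (forall n, cL2 (u n)) ->
  (forall e, 0 < e -> exists N : nat, forall n m, (N <= n)%N -> (N <= m)%N ->
     n2 (fun x => u n x - u m x) <= e) ->
  exists2 F, cL2 F & (fun n => n2 (fun x => u n x - F x)) @ \oo --> (0 : R).
Proof.
move=> iu uC.
have p k : 0 < (4^-1 : R) ^+ k by rewrite exprn_gt0.
have [N HN] := boolp.choice (fun k => uC _ (p k)).
(* The sum makes [phi j] exceed [N k] for all [k <= j], without monotonicity of [N]. The summand [k]
   makes [phi] unbounded, which is used below to get past a given [n0]. *)
pose phi k := (k + \sum_(i < k.+1) N i)%N.
have phi_ge k j : (k <= j)%N -> (N k <= phi j)%N.
  move=> kj; rewrite /phi; apply: leq_trans (leq_addl _ _).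
  by rewrite -ltnS in kj; rewrite (bigD1 (Ordinal kj))//= leq_addr.
pose w k := u (phi k).
have wN k : n2 (fun x => w k.+1 x - w k x) <= 4^-1 ^+ k by apply: HN; exact: phi_ge.
pose F : cfun R := fun x => plim (fun k x => complex.Re (w k x)) x +i*
  plim (fun k x => complex.Im (w k x)) x.
have mw k : cmeas (w k) by have [] := iu (phi k).
have mF : cmeas F by split; apply: measurable_plim => k; have [] := mw k.
have wF : {ae mu, forall x, clim (w ^~ x) (F x)}.
  apply: ae_mono (fast_cauchy_cvg (fun k => iu (phi k)) wN) => x [M HM].
  apply: clim_ReIm; apply: plimE; apply: (@cvg_summable_diff _ _ M) => n;
    apply: le_trans (HM n); apply: ler_sum => k _.
  - by rewrite -ReN -ReD; exact: Re_le_normc.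
  - by rewrite -ImN -ImD; exact: Im_le_normc.
(* Fatou along the almost everywhere convergent subsequence, shifted by [n0] so that each of its
   indices satisfies the Cauchy bound. It controls the distance of the whole sequence to [F], and
   also puts [F] in L2 as a difference of two L2 functions. *)
have key e n0 : 0 < e -> (forall n m, (n0 <= n)%N -> (n0 <= m)%N ->
     n2 (fun x => u n x - u m x) <= e) -> forall n, (n0 <= n)%N ->
     cL2 (fun x => u n x - F x) /\ n2 (fun x => u n x - F x) <= e.
  move=> e0 He n n0n.
  have mnF : cmeas (fun x => u n x - F x) by apply: cmeasB => //; have [] := iu n.
  have [] := @fatou_bound _ (fun k x => cn (u n x - w (k + n0)%N x) ^+ 2)
    (fun x => cn (u n x - F x) ^+ 2) e.
  - by move=> k; have [] := cL2B (iu n) (iu (phi (k + n0)%N)).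
  - by move=> k x; exact: sqr_ge0.
  - by apply: measurable_funX; exact: measurable_normc.
  - by move=> x; exact: sqr_ge0.
  - apply: ae_mono wF => x wFx.
    apply: (continuous_cvg _ (@exprn_continuous _ 2 _)).
    apply: clim_normc; apply: clim_subr.
    by have := wFx; rewrite /clim -(cvg_shiftn n0).
  - move=> k; apply: He => //; rewrite /phi.
    by rewrite -addnA; apply: leq_trans (leq_addl k _); exact: leq_addr.
  - by move=> h1 h2; split.
have FL2 : cL2 F.
  have [n0 H0] := uC 1 ltr01; have [h _] := key 1 n0 ltr01 H0 n0 (leqnn _).
  have -> : F = fun x => u n0 x - (u n0 x - F x) by apply/funext => x; ring.
  exact: cL2B.
exists F => //; apply/cvgrPdist_le => e e0.
have [n0 H0] := uC e e0; exists n0 => // n /= n0n.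
by rewrite sub0r normrN ger0_norm ?n2_ge0//; exact: (key e n0 e0 H0 n n0n).2.
Qed.

Lemma ftB s f g xi : cL1 f -> cL1 g ->
  ft s (fun x => f x - g x) xi = ft s f xi - ft s g xi.
Proof.
move=> If Ig; rewrite /ft -cintegralB; [|exact: cL1_ft_integrand..].
by apply: eq_cintegral => x; rewrite mulrBr.
Qed.

Lemma fourier_plancherel_exists f : cL2 f -> exists2 F, cL2 F &
  (fun N => n2 (fun xi => ft (-1) (cut N f) xi - F xi)) @ \oo --> (0 : R).
Proof.
move=> If.
have s1 : (-1 : R) ^+ 2 = 1 by rewrite sqrrN expr1n.
apply: riesz_fischer => [n|e e0].
  by have [] := bessel s1 (cL1_cut n If) (cL2_cut n If).
(* If both truncations are within [d] of [f] in [n2], their difference has [n2] at most [4 * d], and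
   Bessel multiplies this by [2 * pi]. Hence [d = e / (8 * pi)]. *)
have := n2_cut If => /cvgrPdist_le /(_ (e / (8 * pi)))[].
  by rewrite divr_gt0// mulr_gt0// pi_gt0.
move=> N _ HN; exists N => n m Nn Nm.
have -> : (fun x => ft (-1) (cut n f) x - ft (-1) (cut m f) x) =
    ft (-1) (fun x => cut n f x - cut m f x).
  by apply/funext => x; rewrite ftB//; exact: cL1_cut.
have i1 := cL1B (cL1_cut n If) (cL1_cut m If).
have i2 := cL2B (cL2_cut n If) (cL2_cut m If).
apply: le_trans (bessel s1 i1 i2).2 _.
have -> : (fun x => cut n f x - cut m f x) =
    fun x => (cut n f x - f x) + - (cut m f x - f x) by apply/funext => x; ring.
have j1 := cL2B (cL2_cut n If) If; have j2 := cL2B (cL2_cut m If) If.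
have := n2D j1 (cL2N j2); rewrite n2N => h.
have pi0 : 0 <= 2 * pi :> R by rewrite mulr_ge0// pi_ge0.
apply: le_trans (ler_wpM2l pi0 h) _.
have hb k : (N <= k)%N -> n2 (fun x => cut k f x - f x) <= e / (8 * pi).
  by move=> /HN /=; rewrite sub0r normrN ger0_norm// n2_ge0.
apply: (@le_trans _ _ (2 * pi * (2 * (e / (8 * pi)) + 2 * (e / (8 * pi))))).
  by apply: ler_wpM2l => //; apply: lerD; apply: ler_wpM2l => //; exact: hb.
rewrite le_eqVlt; apply/orP; left; apply/eqP.
by move: (lt0r_neq0 (pi_gt0 R)); move: (pi : R) => p p0; field.
Qed.

End RieszFischerThm.

Section FourierSpec.
Context {R : realType}.
Notation mu := (@lebesgue_measure R).
Notation cn := Normc.normc.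
Notation J f := (cintegral setT f).
Implicit Types (f g h F : cfun R).

Lemma L2normE f : L2norm f = ((\int[mu]_x (cn (f x) ^+ 2)%:E) `^ 2^-1)%E.
Proof.
rewrite /L2norm unlock /Lnorm; congr (_ `^ _)%E; apply: eq_integral => x _.
by rewrite /= ger0_norm ?normc_ge0// powR_mulrn// normc_ge0.
Qed.

Lemma L2norm_cL2 f : cL2 f -> L2norm f = (Num.sqrt (n2 f))%:E.
Proof.
by move=> [_ If]; rewrite L2normE rL1_EFin// poweR_EFin powR12_sqrt// n2_ge0.
Qed.

Lemma L2norm_lty f : cmeas f -> (L2norm f < +oo)%E <-> cL2 f.
Proof.
move=> mf; split=> [|If]; last by rewrite L2norm_cL2// ltry.
rewrite L2normE => h; split => //; apply: rL1_lty.
- by apply: measurable_funX; exact: measurable_normc.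
- by move=> x; exact: sqr_ge0.
- move: h; case: (\int[mu]_x _)%E => [r _| |//]; first exact: ltry.
  by rewrite poweRyr.
Qed.

Lemma L2P f : L2 f <-> cL2 f.
Proof.
split=> [[mf h]|If]; first by apply/(L2norm_lty mf).
by split; [case: If|rewrite L2norm_cL2// ltry].
Qed.

Lemma L2norm_cvg0 {T : Type} (G : set_system T) {FG : Filter G} (u : T -> cfun R) :
  (forall i, cL2 (u i)) ->
  (L2norm (u i) @[i --> G] --> 0%E) <-> (n2 (u i) @[i --> G] --> (0 : R)).
Proof.
move=> iu; split => [h|h].
  have {}h : Num.sqrt (n2 (u i)) @[i --> G] --> (0 : R).
    rewrite (_ : (fun i => _) = fine \o (fun i => L2norm (u i))); first exact: (fine_cvg h).
    by apply/funext => i; rewrite /= L2norm_cL2.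
  rewrite (_ : (fun i => n2 (u i)) = (fun i => Num.sqrt (n2 (u i)) ^+ 2)).
    rewrite -[X in _ --> X](_ : 0 ^+ 2 = 0 :> R); last by rewrite expr0n.
    by apply: (continuous_cvg _ (@exprn_continuous _ 2 _)).
  by apply/funext => i; rewrite sqr_sqrtr// n2_ge0.
under eq_fun do rewrite L2norm_cL2//.
apply/fine_cvgP; split; first exact: nearW.
rewrite -[X in _ --> X]sqrtr0; apply: (continuous_cvg _ (@sqrt_continuous _ _)).
exact: h.
Qed.

Lemma cintegral_cut N f (p : R -> R[i]) :
  cintegral `[- N%:R, N%:R]%classic (fun x => p x * f x) = J (fun x => p x * cut N f x).
Proof.
rewrite /cintegral; congr (_ +i* _); rewrite Rintegral_mkcond; apply: eq_Rintegral => x _;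
  rewrite patchE /cut mulrCA indicE; case: ifPn => _.
- by rewrite mul1r.
- by rewrite mul0r.
- by rewrite mul1r.
- by rewrite mul0r.
Qed.

Lemma is_fourierP f F : cL2 f -> is_fourier f F <-> cL2 F /\
  (fun N => n2 (fun xi => ft (-1) (cut N f) xi - F xi)) @ \oo --> (0 : R).
Proof.
move=> If.
have e N xi : cintegral `[- N%:R, N%:R]%classic (fun x => cis (- (x * xi)) * f x) =
    ft (-1) (cut N f) xi.
  rewrite (cintegral_cut N f (fun x => cis (- (x * xi)))).
  by apply: eq_cintegral => x; rewrite mulN1r.
have s1 : (-1 : R) ^+ 2 = 1 by rewrite sqrrN expr1n.
have iG N : cL2 (ft (-1) (cut N f)).
  by have [] := bessel s1 (cL1_cut N If) (cL2_cut N If).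
rewrite /is_fourier; under eq_fun do under eq_fun do rewrite e.
split => [[/L2P IF h]|[IF h]]; split => //.
- by apply/L2norm_cvg0 => // N; exact: cL2B.
- exact/L2P.
- by apply/L2norm_cvg0 => // N; exact: cL2B.
Qed.

(** Existence of the L2 limit excludes the default value of [xget]. *)
Lemma fourierP f : cL2 f -> is_fourier f (fourier f).
Proof.
move=> If; have [F IF h] := fourier_plancherel_exists If.
rewrite /fourier; case: xgetP => [G _ //|/(_ F)].
by case; apply/is_fourierP.
Qed.

Lemma n2_eq0 f : cL2 f -> n2 f = 0 -> {ae mu, forall x, f x = 0}.
Proof.
move=> [mf If] f0.
have := @ae_eq_integral_abs _ _ _ mu setT measurableT (fun x => (cn (f x) ^+ 2)%:E).
move=> [|h _]; first by have /measurable_int := If; exact.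
have /h : (\int[mu]_x `|(cn (f x) ^+ 2)%:E|)%E = 0%E.
  by under eq_integral do rewrite gee0_abs ?lee_fin ?sqr_ge0//; rewrite rL1_EFin// -/(n2 f) f0.
apply: ae_mono => x /(_ I) [] /eqP.
by rewrite sqrf_eq0 normc0E => /eqP.
Qed.

Lemma cL2_limit_unique (u : nat -> cfun R) F G : (forall n, cL2 (u n)) -> cL2 F -> cL2 G ->
  (fun n => n2 (fun x => u n x - F x)) @ \oo --> (0 : R) ->
  (fun n => n2 (fun x => u n x - G x)) @ \oo --> (0 : R) ->
  {ae mu, forall x, F x = G x}.
Proof.
move=> iu IF IG uF uG.
have : {ae mu, forall x, F x - G x = 0}.
  apply: n2_eq0; first exact: cL2B.
  apply/eqP; rewrite eq_le n2_ge0 andbT.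
  have h : (fun n => 2 * n2 (fun x => u n x - F x) + 2 * n2 (fun x => u n x - G x))
      @ \oo --> (0 : R).
    rewrite -[X in _ --> X](_ : 2 * 0 + 2 * 0 = 0 :> R); last by rewrite mulr0 addr0.
    by apply: cvgD; apply: cvgM => //; exact: cvg_cst.
  apply: (ler_cvg_to (@cvg_cst _ (n2 (fun x => F x - G x)) _ \oo _) h).
  apply: nearW => n; have := n2D (cL2B (iu n) IG) (cL2N (cL2B (iu n) IF)).
  rewrite n2N addrC; congr (_ <= _); apply: eq_Rintegral => x _.
  by congr (cn _ ^+ 2); ring.
by apply: ae_mono => x /eqP; rewrite subr_eq0 => /eqP.
Qed.

Lemma is_fourier_unique f F G : cL2 f -> is_fourier f F -> is_fourier f G ->
  {ae mu, forall x, F x = G x}.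
Proof.
move=> If /(is_fourierP _ If)[IF hF] /(is_fourierP _ If)[IG hG].
apply: (cL2_limit_unique _ IF IG hF hG) => n.
by have [] := bessel (etrans (sqrrN 1) (expr1n _ _)) (cL1_cut n If) (cL2_cut n If).
Qed.

Lemma is_fourier_ae f F G : cL2 f -> is_fourier f F -> cL2 G ->
  {ae mu, forall x, F x = G x} -> is_fourier f G.
Proof.
move=> If /(is_fourierP _ If)[IF hF] IG FG; apply/is_fourierP => //; split => //.
rewrite (_ : (fun N => _) = (fun N => n2 (fun xi => ft (-1) (cut N f) xi - F xi)))//.
apply/funext => N.
have iG : cL2 (ft (-1) (cut N f)).
  by have [] := bessel (etrans (sqrrN 1) (expr1n _ _)) (cL1_cut N If) (cL2_cut N If).
rewrite /n2 /Rintegral; congr fine; apply: ae_eq_integral => //.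
- by have [_ /measurable_int] := cL2B iG IG; exact.
- by have [_ /measurable_int] := cL2B iG IF; exact.
- by apply: ae_mono FG => x -> _.
Qed.

Lemma cL2_fourier f : cL2 f -> cL2 (fourier f).
Proof. by move=> If; have /is_fourierP[] := fourierP If. Qed.

(* The sharp constant is [2 * pi]; the factor 2 is lost in [n2D] when Bessel's
   inequality is passed to the limit along the truncations. *)
Lemma n2_is_fourier f F : cL2 f -> is_fourier f F -> n2 F <= 4 * pi * n2 f.
Proof.
move=> If /(is_fourierP _ If)[IF hF].
have s1 : (-1 : R) ^+ 2 = 1 by rewrite sqrrN expr1n.
have h : (fun N => 2 * n2 (fun xi => ft (-1) (cut N f) xi - F xi) + 4 * pi * n2 f)
    @ \oo --> (4 * pi * n2 f : R).
  rewrite -[X in _ --> X](_ : 2 * 0 + 4 * pi * n2 f = _ :> R); last by rewrite mulr0 add0r.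
  by apply: cvgD; [apply: cvgM => //|]; exact: cvg_cst.
apply: (ler_cvg_to (@cvg_cst _ (n2 F) _ \oo _) h); apply: nearW => N.
have [IG GB] := bessel s1 (cL1_cut N If) (cL2_cut N If).
have -> : n2 F = n2 (fun xi => - (ft (-1) (cut N f) xi - F xi) + ft (-1) (cut N f) xi).
  by apply: eq_Rintegral => xi _; congr (cn _ ^+ 2); ring.
apply: le_trans (n2D (cL2N (cL2B IG IF)) IG) _.
rewrite n2N lerD2l; apply: (@le_trans _ _ (2 * (2 * pi * n2 f))); last first.
  by rewrite !mulrA -natrM.
apply: ler_wpM2l => //; apply: le_trans GB _; apply: ler_wpM2l.
  by rewrite mulr_ge0// pi_ge0.
by apply: n2_le => //; [exact: cL2_cut|move=> x; exact: normc_cut_le].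
Qed.

End FourierSpec.

Section Inversion.
Context {R : realType}.
Notation mu := (@lebesgue_measure R).
Notation cn := Normc.normc.
Notation J f := (cintegral setT f).
Implicit Types (f g h F u : cfun R).

(** Continuity at one point only, because the indicator functions [box] used as tests are
    discontinuous at their end points. *)
Definition ccont_at u (y : R) := forall e, 0 < e -> exists2 d, 0 < d &
  forall x, `|x - y| < d -> cn (u x - u y) <= e.

Lemma cL1_poisson e (y : R) : 0 < e -> cL1 (fun x => (poisson e (y - x))%:C).
Proof.
move=> e0; have h := cL1_affine y (etrans (sqrrN 1) (expr1n _ _))
  (cL1_le (cmeas_real (measurable_poisson e0)) (fun x => lexx _) _).
have : cL1 (fun x => (poisson e (y + -1 * x))%:C).
  apply: h; under eq_fun do rewrite normc_real ger0_norm ?poisson_ge0//.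
  exact: rL1_poisson.
by under eq_fun do rewrite mulN1r.
Qed.

Lemma cL2_bounded_cL1 f (M : R) : cL1 f -> (forall x, cn (f x) <= M) -> cL2 f.
Proof.
move=> [mf If] fM; apply: (@cL2_le _ _ (fun x => M * cn (f x))) => //.
- by move=> x; rewrite expr2 ler_wpM2r// normc_ge0.
- exact: rL1Z.
Qed.

Lemma cL2_poisson e (y : R) : 0 < e -> cL2 (fun x => (poisson e (y - x))%:C).
Proof.
move=> e0; apply: (@cL2_bounded_cL1 _ (2 / e)); first exact: cL1_poisson.
by move=> x; rewrite normc_real ger0_norm ?poisson_ge0// poisson_le.
Qed.

Lemma rintegral_poisson_shift e (y : R) : 0 < e ->
  \int[mu]_x poisson e (y - x) = 2 * pi.
Proof.
move=> e0; rewrite -(rintegral_poisson e0).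
rewrite -(rintegral_affine y (etrans (sqrrN 1) (expr1n _ _)) (rL1_poisson e0)).
by apply: eq_Rintegral => x _; rewrite mulN1r.
Qed.

(** For [|z| >= d] the quotient [(1 + z^2) / (e^2 + z^2)] is at most [1 + d^-2]. The comparison is
    with [poisson 1] instead of a constant because the tail is integrated against a function that is
    only in L2, up to a constant. *)
Lemma poisson_tail e d (z : R) : 0 < e -> 0 < d -> d <= `|z| ->
  poisson e z <= e * (1 + d^-2) * poisson 1 z.
Proof.
move=> e0 d0 dz; rewrite /poisson !expr1n mulr1.
have z2 : d ^+ 2 <= z ^+ 2.
  by rewrite -[X in _ <= X]real_normK ?num_real// ler_pXn2r// ?nnegrE// ltW.
have d2 : 0 < d ^+ 2 by rewrite exprn_gt0.
have zp : 0 < z ^+ 2 by exact: lt_le_trans z2.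
have ep : 0 < e ^+ 2 by rewrite exprn_gt0.
rewrite ler_pdivrMr ?addr_gt0// mulrA mulrAC ler_pdivlMr ?addr_gt0//.
have : 1 <= d ^- 2 * z ^+ 2 by rewrite mulrC ler_pdivlMr// mul1r.
set k := d ^- 2 => kz.
have k0 : 0 < k by rewrite invr_gt0.
rewrite [leRHS](_ : _ = 2 * e * ((1 + k) * (e ^+ 2 + z ^+ 2))); last by ring.
rewrite ler_pM2l ?mulr_gt0// mulrDl mul1r !mulrDr.
have : 0 <= k * e ^+ 2 by rewrite mulr_ge0 ?ltW.
by nra.
Qed.

Lemma cvg_harmonicM (c : R) : (fun n => n.+1%:R^-1 * c) @ \oo --> (0 : R).
Proof.
rewrite -[X in _ --> X](mul0r c); apply: cvgM; last exact: cvg_cst.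
exact: cvg_harmonic.
Qed.

Lemma harmonic_pos n : 0 < n.+1%:R^-1 :> R.
Proof. by rewrite invr_gt0. Qed.

Lemma approximate_identity u y : cL2 u -> ccont_at u y ->
  clim (fun n => J (fun x => u x * (poisson n.+1%:R^-1 (y - x))%:C))
       ((2 * pi)%:C * u y).
Proof.
move=> iu uy; apply/cvgrPdist_le => eta eta0.
have pi0 := pi_gt0 R.
(* Multiplied by the mass [2 * pi] of the kernel, this oscillation contributes [eta / 2]; the other
   half is left for the tail. *)
have [] := uy (eta / (4 * pi)); first by rewrite divr_gt0// mulr_gt0.
move=> d d0 ud.
pose C := \int[mu]_x (cn (u x - u y) * poisson 1 (y - x)).
have iuP e : 0 < e -> cL1 (fun x => (u x - u y) * (poisson e (y - x))%:C).
  move=> e0; have i1 := cL1M iu (cL2_poisson y e0).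
  have := cL1B i1 (cL1Z (u y) (cL1_poisson y e0)).
  by under eq_fun do rewrite -mulrBl.
have Ecn e x : 0 < e -> cn ((u x - u y) * (poisson e (y - x))%:C) =
    cn (u x - u y) * poisson e (y - x).
  by move=> e0; rewrite Normc.normcM normc_real ger0_norm// poisson_ge0.
have iP e : 0 < e -> rL1 (fun x => poisson e (y - x)).
  by move=> e0; exact: (cL1_Re (cL1_poisson y e0)).
have iuP1 : rL1 (fun x => cn (u x - u y) * poisson 1 (y - x)).
  by have [_] := iuP 1 ltr01; under eq_fun do rewrite Ecn//.
(* By [poisson_tail], the points at distance at least [d] from [y] contribute at most [e * K], with
   [K] independent of [e]. *)
pose K := (1 + d^-2) * C.
have bound e : 0 < e ->
    cn (J (fun x => u x * (poisson e (y - x))%:C) - (2 * pi)%:C * u y) <=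
    eta / 2 + e * K.
  move=> e0.
  have -> : (2 * pi)%:C * u y = J (fun x => u y * (poisson e (y - x))%:C).
    rewrite cintegralZ; last exact: cL1_poisson.
    by rewrite cintegral_real rintegral_poisson_shift// mulrC.
  rewrite -cintegralB; [|exact: (cL1M iu (cL2_poisson y e0))|by apply: cL1Z; exact: cL1_poisson].
  rewrite (@eq_cintegral _ _ (fun x => (u x - u y) * (poisson e (y - x))%:C)); last first.
    by move=> x; rewrite mulrBl.
  apply: le_trans (normc_cintegral (iuP e e0)) _.
  apply: (@le_trans _ _ (\int[mu]_x (eta / (4 * pi) * poisson e (y - x) +
      e * (1 + d^-2) * (cn (u x - u y) * poisson 1 (y - x))))).
    apply: le_rintegral.
    - by have [] := iuP e e0.
    - by apply: rL1D; apply: rL1Z => //; exact: iP.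
    move=> x; rewrite Ecn//.
    have P0 := poisson_ge0 e0 (y - x); have P10 := poisson_ge0 ltr01 (y - x).
    have c0 := normc_ge0 (u x - u y).
    have K0 : 0 <= e * (1 + d^-2) by rewrite mulr_ge0 ?ltW// addr_gt0// invr_gt0 exprn_gt0.
    have [xd|xd] := ltP `|x - y| d.
      rewrite -[leLHS]addr0; apply: lerD; last by apply: mulr_ge0 => //; exact: mulr_ge0.
      by apply: ler_wpM2r => //; exact: ud.
    rewrite -[leLHS]add0r; apply: lerD.
      apply: mulr_ge0 => //; apply: divr_ge0; first exact: ltW.
      by apply: mulr_ge0 => //; exact: ltW.
    rewrite [leRHS]mulrCA; apply: ler_wpM2l => //; apply: poisson_tail => //.
    by rewrite distrC.
  rewrite RintegralD//; [|by apply: rL1Z; exact: iP|exact: rL1Z].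
  rewrite (RintegralZ (eta / (4 * pi)) (iP e e0)) (RintegralZ (e * (1 + d^-2)) iuP1).
  rewrite rintegral_poisson_shift// -/C -[e * (1 + d^-2) * C]mulrA -/K lerD2r.
  rewrite le_eqVlt; apply/orP; left; apply/eqP.
  by move: (lt0r_neq0 pi0); move: (pi : R) => p p0; field.
have := cvg_harmonicM K => /cvgrPdist_le /(_ (eta / 2)).
rewrite divr_gt0// => /(_ isT); apply: filterS => n.
rewrite !sub0r !normrN => /(le_trans (ler_norm _)) h.
rewrite ger0_norm ?normc_ge0//; apply: le_trans (bound _ (harmonic_pos n)) _.
by rewrite [leRHS](splitr eta) lerD2l.
Qed.

Lemma clim_ext (v w : nat -> R[i]) l l' : v =1 w -> l = l' -> clim v l -> clim w l'.
Proof. by move=> /funext -> ->. Qed.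

(** For the truncations [cut N f] this is [ft_mult]. Both sides are continuous in the L2 function
    paired with a fixed L2 function, so the limit in [N] can be taken. *)
Lemma duality f F g : cL2 f -> is_fourier f F -> cL1 g -> cL2 g ->
  J (fun xi => F xi * g xi) = J (fun x => f x * ft (-1) g x).
Proof.
move=> If /(is_fourierP _ If)[IF hF] ig ig2.
have s1 : (-1 : R) ^+ 2 = 1 by rewrite sqrrN expr1n.
have iG N : cL2 (ft (-1) (cut N f)).
  by have [] := bessel s1 (cL1_cut N If) (cL2_cut N If).
have h1 := cintegralM_cvg iG IF ig2 hF.
have h2 := cintegralM_cvg (fun N => cL2_cut N If) If (bessel s1 ig ig2).1 (n2_cut If).
apply: (clim_unique h1); apply: clim_ext h2 => // N.
by rewrite ft_mult//; exact: cL1_cut.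
Qed.

Lemma cL1_cis_pexp e (y : R) : 0 < e -> cL1 (fun xi => cis (1 * (y * xi)) * (pexp e xi)%:C).
Proof. by move=> e0; apply: cL1_cis (cL1_pexp e0); exact: measurable_phase. Qed.

Lemma cL2_cis_pexp e (y : R) : 0 < e -> cL2 (fun xi => cis (1 * (y * xi)) * (pexp e xi)%:C).
Proof.
move=> e0; apply: (@cL2_bounded_cL1 _ 1); first exact: cL1_cis_pexp.
by move=> x; rewrite Normc.normcM normc_cis mul1r normc_real ger0_norm ?pexp_ge0 ?pexp_le1.
Qed.

Lemma clim_pexp (z : R[i]) (x : R) : clim (fun n => z * (pexp n.+1%:R^-1 x)%:C) z.
Proof.
rewrite /clim (_ : (fun n => _) = (fun n => cn z * `|pexp n.+1%:R^-1 x - 1|)); last first.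
  apply/funext => n; rewrite -[in X in _ - X](mulr1 z) -mulrBr Normc.normcM.
  by rewrite -normc_real rmorphB.
rewrite -[X in _ --> X](mulr0 (cn z)); apply: cvgM; first exact: cvg_cst.
rewrite -(normr0 R); apply: cvg_norm; apply/subr_cvg0; exact: cvg_pexp.
Qed.

Definition ift F : cfun R := fun x => ((2 * pi)^-1)%:C * ft 1 F x.

(** By [duality] with the modulated [pexp], the damped inverse integral of [F] at [y] is the Poisson
    average of [f] at [y]. When the damping disappears, the average tends to [2 * pi] times [f y],
    and the inverse integral converges by domination since [F] is integrable. *)
Lemma inversion f F y : cL2 f -> is_fourier f F -> cL1 F -> ccont_at f y ->
  f y = ift F y.
Proof.
move=> If fF iF fy.
have pi2 : (2 * pi)%:C != 0 :> R[i].
  by rewrite -normc0E normc_real normr_eq0 mulf_neq0// (lt0r_neq0 (pi_gt0 R)).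
suff h : (2 * pi)%:C * f y = ft 1 F y.
  by rewrite /ift -h mulrA -rmorphM/= mulVf ?mul1r// mulf_neq0// (lt0r_neq0 (pi_gt0 R)).
apply: (clim_unique (approximate_identity If fy)).
have [mF _] := iF.
have : clim (fun n => J (fun xi => F xi * (cis (1 * (y * xi)) * (pexp n.+1%:R^-1 xi)%:C)))
    (J (fun xi => F xi * cis (1 * (y * xi)))).
  have mc : cmeas (fun xi => cis (1 * (y * xi))) by apply: cmeas_cis; exact: measurable_phase.
  apply: (@cintegral_dct _ _ _ (fun xi => cn (F xi))).
  - move=> n; apply: cmeasM => //; apply: cmeasM => //.
    by apply: cmeas_real; exact: measurable_pexp.
  - exact: cmeasM.
  - by apply: aeW => xi; under [in X in clim X _]eq_fun do rewrite mulrA; exact: clim_pexp.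
  - by case: iF.
  - move=> n x; rewrite !Normc.normcM normc_cis mul1r normc_real ger0_norm ?pexp_ge0//.
    by rewrite ler_piMr ?normc_ge0// pexp_le1// harmonic_pos.
  - by move=> x; rewrite Normc.normcM normc_cis mulr1.
apply: clim_ext => [n|].
- rewrite (duality If fF (cL1_cis_pexp y (harmonic_pos n)) (cL2_cis_pexp y (harmonic_pos n))).
  apply: eq_cintegral => x; congr (_ * _).
  by rewrite (ft_pexp_cis 1 y x (harmonic_pos n)) mul1r.
- by apply: eq_cintegral => xi; rewrite mulrC [xi * y]mulrC.
Qed.

End Inversion.

(** * Lebesgue points and the transform of an inverse transform *)

Section LocalAverages.
Context {R : realType}.
Notation mu := (@lebesgue_measure R).

(** On a set of finite measure [e ^+ 2 + 1] is an integrable bound for [|e|]. *)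
Lemma L2_integrable_on (e : R -> R) (B : set (measurableTypeR R)) : measurable_fun setT e ->
  rL1 (fun x => e x ^+ 2) -> measurable B -> (mu B < +oo)%E ->
  mu.-integrable B (EFin \o e).
Proof.
move=> me ie mB By.
have i1 : mu.-integrable B (EFin \o (fun x => e x ^+ 2)) by apply: integrableS ie.
have i2 : mu.-integrable B (EFin \o cst (1 : R)).
  apply/integrableP; split; first by apply/measurable_EFinP; exact: measurable_cst.
  under eq_integral do rewrite /= normr1.
  by rewrite integral_cst// mul1e.
have i3 : mu.-integrable B (EFin \o (fun x => e x ^+ 2 + 1)).
  exact: (integrableD mB i1 i2).
apply: le_integrable i3 => //.
- by apply/measurable_EFinP; exact: measurable_funTS.
- move=> x _ /=; rewrite lee_fin [leRHS]ger0_norm ?addr_ge0 ?sqr_ge0//.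
  rewrite -[X in _ <= X + _]real_normK ?num_real//.
  by have := sqr_ge0 (`|e x| - 1); have := sqr_ge0 (`|e x|); rewrite sqrrB; lra.
Qed.

(** As [e] has mean zero on [ball x r], the number [|e x|] is the modulus of the mean of [e - e x]
    there, hence at most [davg e x r]. By Lebesgue differentiation this tends to 0 with [r] for
    almost every [x]. *)
Lemma ae_zero_averages (e : R -> R) : measurable_fun setT e ->
  rL1 (fun x => e x ^+ 2) ->
  (forall x r, 0 < r -> \int[mu]_(y in ball x r) e y = 0) ->
  {ae mu, forall x, e x = 0}.
Proof.
move=> me ie e0.
have ballfin (x r : R) : 0 < r -> (mu (ball x r) = (r *+ 2)%:E)%E.
  by move=> r0; rewrite (lebesgue_measure_ball _ (ltW r0)).
have le : locally_integrable setT e.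
  split => //; first exact: openT.
  move=> K _ cK.
  have mK : measurable (K : set (measurableTypeR R)) by apply: compact_measurable.
  have := @L2_integrable_on e K me ie mK (compact_finite_measure cK).
  by move=> /integrableP[_]; under eq_integral do rewrite /=.
apply: ae_mono (lebesgue_differentiation le) => x ex.
apply/eqP; rewrite -normr_le0 -lee_fin.
have bnd : \forall r \near 0^'+, (`|e x|%:E <= davg e x r)%E.
  near=> r.
  have r0 : 0 < r by near: r; exact: nbhs_right_gt.
  have mB : measurable (ball x r : set (measurableTypeR R)) by exact: measurable_ball.
  have Bf : (mu (ball x r) < +oo)%E by rewrite ballfin// ltry.
  have iB := L2_integrable_on me ie mB Bf.
  have ic : mu.-integrable (ball x r) (EFin \o cst (e x)).
    apply/integrableP; split; first by apply/measurable_EFinP; exact: measurable_cst.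
    under eq_integral do rewrite /=.
    rewrite integral_cst// /= (ballfin x r r0) -EFinM; exact: ltry.
  have id : mu.-integrable (ball x r) (EFin \o (fun y => e y - e x)).
    exact: (integrableB mB iB ic).
  rewrite /davg /iavg ballfin//.
  have -> : (\int[mu]_(y in ball x r) `|((center (e x) \o e) y)%:E| =
      (\int[mu]_(y in ball x r) `|e y - e x|)%:E)%E.
    by rewrite /Rintegral fineK//; exact: (integrable_fin_num mB (integrable_abse id)).
  have r2 : 0 < r *+ 2 by rewrite mulrn_wgt0.
  rewrite inver gt_eqF// -EFinM lee_fin ler_pdivlMl//.
  apply: le_trans (le_normr_Rintegral mB id).
  rewrite RintegralB// e0// sub0r normrN Rintegral_cst//= (ballfin x r r0) /= normrM mulrC.
  by rewrite [`|r *+ 2|]gtr0_norm.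
exact: (cvge_to_ge ex bnd).
Unshelve. all: by end_near. Qed.
End LocalAverages.

Section FourierOfInverse.
Context {R : realType}.
Notation mu := (@lebesgue_measure R).
Notation cn := Normc.normc.
Notation J f := (cintegral setT f).
Implicit Types (f g h F u : cfun R).

Lemma pi2_neq0 : 2 * pi != 0 :> R.
Proof. by rewrite mulf_neq0// (lt0r_neq0 (pi_gt0 R)). Qed.

Lemma cL2_ft s F : s ^+ 2 = 1 -> cL1 F -> cL2 F -> cL2 (ft s F).
Proof. by move=> s1 iF iF2; have [] := bessel s1 iF iF2. Qed.

Lemma cL2_ift F : cL1 F -> cL2 F -> cL2 (ift F).
Proof. by move=> iF iF2; apply: cL2Z; apply: cL2_ft => //; rewrite expr1n. Qed.

(* [P_e * g] stays below [sup |g|] and tends to [2 pi g] at the points of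
   continuity of [g], so the damping can be removed by dominated convergence. *)
Lemma ift_pairing F g (M : R) : cL1 F -> cL2 F -> cL1 g -> cL2 g ->
  (forall x, cn (g x) <= M) -> {ae mu, forall y, ccont_at g y} ->
  J (fun x => ift F x * ft (-1) g x) = J (fun xi => F xi * g xi).
Proof.
move=> iF iF2 ig ig2 gM gc.
have s1 : (-1 : R) ^+ 2 = 1 by rewrite sqrrN expr1n.
have M0 : 0 <= M by exact: le_trans (normc_ge0 (g 0)) (gM 0).
have iG := cL2_ft s1 ig ig2; have mG := cmeas_ft (-1) ig; have mF := iF.1.
have ifG := cL1M (cL2_ift iF iF2) iG.
pose p n (x : R) : R[i] := (pexp n.+1%:R^-1 x)%:C.
have ip n : cL1 (p n) by exact: cL1_pexp (harmonic_pos n).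
have iGp n : cL1 (fun x => ft (-1) g x * p n x) by exact: cL1_mul_ft.
have mp n : cmeas (p n) by case: (ip n).
have p1 n x : cn (p n x) <= 1.
  by rewrite normc_real ger0_norm ?pexp_ge0// pexp_le1// harmonic_pos.
(* [ft_mult] identifies the damped double transform of [g] with this Poisson average, so [g] is
   recovered in the limit without assuming that its transform is integrable. *)
pose q n xi := J (fun y => g y * (poisson n.+1%:R^-1 (xi - y))%:C).
have ftGp n xi : ft 1 (fun x => ft (-1) g x * p n x) xi = q n xi.
  transitivity (J (fun x => ft (-1) g x * (cis (1 * (xi * x)) * (pexp n.+1%:R^-1 x)%:C))).
    by apply: eq_cintegral => x; rewrite mulrCA [x * xi]mulrC.
  rewrite ft_mult//; last exact: cL1_cis_pexp (harmonic_pos n).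
  apply: eq_cintegral => y; congr (_ * _).
  by rewrite (ft_pexp_cis 1 xi y (harmonic_pos n)) mul1r.
have q_le n xi : cn (q n xi) <= M * (2 * pi).
  rewrite -(rintegral_poisson_shift xi (harmonic_pos n)).
  have iP := cL1_poisson xi (harmonic_pos n).
  have igP : cL1 (fun y => g y * (poisson n.+1%:R^-1 (xi - y))%:C).
    by apply: (@cL1M_bounded _ _ _ M) => //; case: ig.
  rewrite -RintegralZ; last exact: (cL1_Re iP).
  apply: le_trans (normc_cintegral igP) _; apply: le_rintegral.
  - by case: igP.
  - by apply: rL1Z; exact: (cL1_Re iP).
  - move=> y; rewrite Normc.normcM normc_real ger0_norm ?poisson_ge0 ?harmonic_pos//.
    by rewrite ler_wpM2r ?poisson_ge0 ?harmonic_pos.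
have mq n : cmeas (q n).
  by have := cmeas_ft 1 (iGp n); congr cmeas; apply/funext => xi.
have lim1 : clim (fun n => J (fun x => ift F x * ft (-1) g x * p n x))
    (J (fun x => ift F x * ft (-1) g x)).
  apply: (@cintegral_dct _ _ _ (fun x => cn (ift F x * ft (-1) g x))).
  - by move=> n; apply: cmeasM => //; case: ifG.
  - by case: ifG.
  - by apply: aeW => x; exact: clim_pexp.
  - by case: ifG.
  - by move=> n x; rewrite Normc.normcM ler_piMr ?normc_ge0.
  - by [].
apply: (clim_unique lim1).
have lim2 : clim (fun n => J (fun xi => F xi * (((2 * pi)^-1)%:C * q n xi)))
    (J (fun xi => F xi * g xi)).
  apply: (@cintegral_dct _ _ _ (fun xi => M * cn (F xi))).
  - by move=> n; apply: cmeasM => //; apply: cmeasM => //; exact: cmeas_cst.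
  - by apply: cmeasM => //; case: ig.
  - apply: ae_mono gc => xi gxi.
    have h := approximate_identity ig2 gxi.
    rewrite /clim.
    have -> : (fun n => cn (F xi * (((2 * pi)^-1)%:C * q n xi) - F xi * g xi)) =
        fun n => cn (F xi * ((2 * pi)^-1)%:C) * cn (q n xi - (2 * pi)%:C * g xi).
      apply/funext => n; rewrite -Normc.normcM; congr cn.
      rewrite mulrBr !mulrA; congr (_ - _ * _).
      by rewrite -!mulrA -rmorphM/= mulVf ?mulr1// pi2_neq0.
    rewrite -[X in _ --> X](mulr0 (cn (F xi * ((2 * pi)^-1)%:C))).
    by apply: cvgM; [exact: cvg_cst|exact: h].
  - by apply: rL1Z; case: iF.
  - move=> n xi; rewrite !Normc.normcM mulrC ler_wpM2r ?normc_ge0//.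
    rewrite normc_real ger0_norm ?invr_ge0 ?mulr_ge0 ?pi_ge0// ler_pdivrMl.
      by rewrite mulrC.
    by rewrite mulr_gt0// pi_gt0.
  - by move=> xi; rewrite Normc.normcM mulrC ler_wpM2r ?normc_ge0.
apply: clim_ext lim2 => // n.
transitivity (((2 * pi)^-1)%:C * J (fun xi => F xi * q n xi)).
  rewrite -cintegralZ; first by apply: eq_cintegral => xi; rewrite mulrCA.
  have := @cL1M_bounded _ F (q n) _ iF (mq n) (q_le n).
  by under eq_fun do rewrite mulrC.
transitivity (((2 * pi)^-1)%:C * J (fun x => ft 1 F x * (ft (-1) g x * p n x))).
  have -> : J (fun xi => F xi * q n xi) = J (fun x => ft 1 F x * (ft (-1) g x * p n x)).
    rewrite (ft_mult 1 iF (iGp n)); apply: eq_cintegral => xi.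
    by rewrite ftGp.
  by [].
rewrite -cintegralZ; last exact: cL1_mul_ft.
by apply: eq_cintegral => x; rewrite /ift !mulrA.
Qed.

Definition box (x r : R) : cfun R := fun xi => (\1_(ball x r : set R) xi)%:C.

Lemma normc_box x r xi : cn (box x r xi) <= 1.
Proof. by rewrite normc_indic indic_le1. Qed.

Lemma cL1_box x r : cL1 (box x r).
Proof.
apply: (@cL1_le _ _ (\1_(`[x - r, x + r] : set R))); last exact: rL1_indic_itv.
  apply: cmeas_real; apply: measurable_indic; exact: measurable_ball.
move=> y; rewrite normc_indic !indicE ler_nat; case: (boolP (y \in (ball x r : set R))) => // yB.
rewrite mem_set//= in_itv/=; move/set_mem : yB.
by rewrite /ball/= ltr_distlC => /andP[/ltW-> /ltW->].
Qed.

Lemma cL2_box x r : cL2 (box x r).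
Proof. exact: cL2_bounded_cL1 (cL1_box x r) (normc_box x r). Qed.

Lemma ccont_box x r y : y != x - r -> y != x + r -> ccont_at (box x r) y.
Proof.
move=> y1 y2 e e0.
have d0 : 0 < Num.min `|y - (x - r)| `|y - (x + r)|.
  by rewrite lt_min !normr_gt0 !subr_eq0 y1 y2.
exists (Num.min `|y - (x - r)| `|y - (x + r)|) => // z.
rewrite lt_min => /andP[z1 z2].
have -> : box x r z = box x r y; last by rewrite subrr Normc.normc0 ltW.
rewrite /box !indicE; congr (_%:R)%:C; congr nat_of_bool.
apply/idP/idP => /set_mem h; apply/mem_set; move: h; rewrite /ball/= !ltr_distlC.
- move=> /andP[h1 h2]; move: z1 z2 y1 y2; rewrite !ltr_norml.
  case: (ger0P (y - (x - r))) => q1; case: (ger0P (y - (x + r))) => q2 /andP[a b] /andP[c d] y1 y2;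
    apply/andP; split; lra.
- move=> /andP[h1 h2]; move: z1 z2 y1 y2; rewrite !ltr_norml.
  case: (ger0P (y - (x - r))) => q1; case: (ger0P (y - (x + r))) => q2 /andP[a b] /andP[c d] y1 y2;
    apply/andP; split; lra.
Qed.

Lemma ae_neq (a : R) : {ae mu, forall y, y != a}.
Proof.
exists [set a]; split; first exact: measurable_set1.
  exact: lebesgue_measure_set1.
by move=> y /= /negP; rewrite negbK => /eqP.
Qed.

Lemma cintegral_box u x r : J (fun xi => u xi * box x r xi) =
  (\int[mu]_(xi in ball x r) complex.Re (u xi)) +i*
  (\int[mu]_(xi in ball x r) complex.Im (u xi)).
Proof.
rewrite /cintegral; congr (_ +i* _); rewrite [RHS]Rintegral_mkcond; apply: eq_Rintegral => xi _;
  rewrite patchE /box indicE; case: ifPn => _.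
- by rewrite mulr1.
- by rewrite mulr0.
- by rewrite mulr1.
- by rewrite mulr0.
Qed.

(** Here [F] need not be continuous, so it is recovered by testing: [duality] and [ift_pairing] give
    [fourier (ift F)] and [F] the same integral against every [box]. Their difference then has zero
    mean on every ball. *)
Theorem is_fourier_ift F : cL1 F -> cL2 F -> is_fourier (ift F) F.
Proof.
move=> iF iF2; have If := cL2_ift iF iF2.
have fG := fourierP If; have IG := cL2_fourier If.
apply: (is_fourier_ae If fG iF2).
set G := fourier _ in fG IG *.
have IE := cL2B IG iF2.
have E0 x r : 0 < r -> J (fun xi => (G xi - F xi) * box x r xi) = 0.
  move=> r0; have i1 := cL1M IG (cL2_box x r); have i2 := cL1M iF2 (cL2_box x r).
  under eq_cintegral do rewrite mulrBl.
  rewrite cintegralB// (duality If fG (cL1_box x r) (cL2_box x r)).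
  rewrite (@ift_pairing F _ 1) ?subrr//; [exact: cL1_box|exact: cL2_box| |].
  - exact: normc_box.
  - by apply: ae_mono2 (ae_neq (x - r)) (ae_neq (x + r)) => y; exact: ccont_box.
have [[mr mi] sq] := IE.
have zr : {ae mu, forall x, complex.Re (G x - F x) = 0}.
  apply: ae_zero_averages => //.
  - apply: rL1_le sq; first exact: measurable_funX.
    by move=> x; rewrite normc_sqr ger0_norm ?sqr_ge0// lerDl sqr_ge0.
  - by move=> x r r0; have := E0 x r r0; rewrite cintegral_box => -[].
have zi : {ae mu, forall x, complex.Im (G x - F x) = 0}.
  apply: ae_zero_averages => //.
  - apply: rL1_le sq; first exact: measurable_funX.
    by move=> x; rewrite normc_sqr ger0_norm ?sqr_ge0// lerDr sqr_ge0.
  - by move=> x r r0; have := E0 x r r0; rewrite cintegral_box => -[].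
apply: ae_mono2 zr zi => x r0 i0; apply/eqP; rewrite -subr_eq0; apply/eqP.
exact: complexP.
Qed.

End FourierOfInverse.

(** * Functions with weighted integrable Fourier transform *)

Section WeightedClass.
Context {R : realType}.
Notation mu := (@lebesgue_measure R).
Notation cn := Normc.normc.
Notation J f := (cintegral setT f).
Implicit Types (f g h F G : cfun R) (k : nat).

(** [1 + |xi|] is submultiplicative with constant 1, which the Sobolev weight [(1 + xi^2)^(1/2)] is
    not; convolution then preserves the weighted class directly. *)
Definition wt (k : nat) (xi : R) : R := (1 + `|xi|) ^+ k.

Lemma wt_ge1 k xi : 1 <= wt k xi.
Proof. by rewrite exprn_ege1// lerDl. Qed.

Lemma wt_gt0 k xi : 0 < wt k xi.
Proof. exact: lt_le_trans ltr01 (wt_ge1 k xi). Qed.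

Lemma wt_ge0 k xi : 0 <= wt k xi. Proof. exact/ltW/wt_gt0. Qed.

Lemma wtS k xi : wt k.+1 xi = wt k xi * (1 + `|xi|).
Proof. by rewrite /wt exprSr. Qed.

Lemma wt_le k l xi : (k <= l)%N -> wt k xi <= wt l xi.
Proof. by move=> kl; rewrite /wt ler_weXn2l// lerDl. Qed.

Lemma wt_submult k xi eta : wt k xi <= wt k eta * wt k (xi - eta).
Proof.
have nn (x : R) : 0 <= 1 + `|x| by exact: addr_ge0.
rewrite /wt -exprMn; apply: lerXn2r; rewrite ?nnegrE ?mulr_ge0//.
rewrite mulrDl !mul1r mulrDr mulr1 addrA.
have h : `|xi| <= `|eta| + `|xi - eta|.
  by rewrite -{1}(subrKC eta xi) ler_normD.
have p : 0 <= `|eta| * `|xi - eta| by exact: mulr_ge0.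
by move: h p; lra.
Qed.

Lemma continuous_wt k : continuous (wt k).
Proof.
move=> x; apply: (@continuous_comp _ _ _ (fun x : R => 1 + `|x|) (fun y : R => y ^+ k)).
  by apply: cvgD; [exact: cvg_cst|exact: norm_continuous].
exact: exprn_continuous.
Qed.

Lemma measurable_wt k : measurable_fun setT (wt k).
Proof. by apply: continuous_measurable_fun; exact: continuous_wt. Qed.

Definition wabs k F (xi : R) : R := wt k xi * cn (F xi).

(** The L1 bound makes [ift F] an absolutely convergent integral at every point; the L2 bound places
    [ift F] in L2, where [fourier] recovers [F]. *)
Definition wclass k F :=
  [/\ cmeas F, rL1 (wabs k F) & rL1 (fun xi => wabs k F xi ^+ 2)].

Lemma wabs_ge0 k F xi : 0 <= wabs k F xi.
Proof. by rewrite mulr_ge0 ?wt_ge0 ?normc_ge0. Qed.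

Lemma measurable_wabs k F : cmeas F -> measurable_fun setT (wabs k F).
Proof.
move=> mF; apply: measurable_realfun.measurable_funM; first exact: measurable_wt.
exact: measurable_normc.
Qed.

Lemma wclass_le_real k F (g : R -> R) : cmeas F -> (forall xi, wabs k F xi <= g xi) ->
  rL1 g -> rL1 (fun xi => g xi ^+ 2) -> wclass k F.
Proof.
move=> mF Fg ig ig2; have m := measurable_wabs k mF; split => //.
- by apply: rL1_le ig => // xi; rewrite ger0_norm ?wabs_ge0.
- apply: rL1_le ig2; first exact: measurable_funX.
  move=> xi; rewrite ger0_norm ?sqr_ge0// ler_pXn2r ?nnegrE ?wabs_ge0//.
  exact: le_trans (wabs_ge0 k F xi) (Fg xi).
Qed.

Lemma wclass_le k l F G (M : R) : cmeas G -> (forall xi, wabs l G xi <= M * wabs k F xi) ->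
  wclass k F -> wclass l G.
Proof.
move=> mG GF [mF i1 i2]; apply: (wclass_le_real mG GF); first exact: rL1Z.
by under eq_fun do rewrite exprMn; exact: rL1Z.
Qed.

Lemma wclassS k l F : (l <= k)%N -> wclass k F -> wclass l F.
Proof.
move=> kl WF; apply: (@wclass_le k l F F 1) => //; first by case: WF.
by move=> xi; rewrite mul1r ler_wpM2r ?normc_ge0// wt_le.
Qed.

Lemma wabs0 F : wabs 0 F = fun xi => cn (F xi).
Proof. by apply/funext => xi; rewrite /wabs /wt expr0 mul1r. Qed.

Lemma wclass_cL1 k F : wclass k F -> cL1 F.
Proof.
move=> /(wclassS (leq0n k))[mF i1 _]; split => //.
by move: i1; rewrite wabs0.
Qed.

Lemma wclass_cL2 k F : wclass k F -> cL2 F.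
Proof.
move=> /(wclassS (leq0n k))[mF _ i1]; split => //.
by move: i1; rewrite wabs0.
Qed.

Lemma wclassD k F G : wclass k F -> wclass k G -> wclass k (fun xi => F xi + G xi).
Proof.
move=> [mF i1 i2] [mG j1 j2].
apply: (@wclass_le_real _ _ (fun xi => wabs k F xi + wabs k G xi)).
- exact: cmeasD.
- by move=> xi; rewrite /wabs -mulrDr ler_wpM2l ?wt_ge0// normcD.
- exact: rL1D.
- apply: (@rL1_le _ _ (fun xi => 2 * wabs k F xi ^+ 2 + 2 * wabs k G xi ^+ 2)).
  + by apply: measurable_funX; apply: measurable_realfun.measurable_funD; exact: measurable_wabs.
  + move=> xi; rewrite ger0_norm ?sqr_ge0//.
    by have := sqr_ge0 (wabs k F xi - wabs k G xi); rewrite sqrrB sqrrD; lra.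
  + by apply: rL1D; exact: rL1Z.
Qed.

Lemma wclassM_bounded k F (m : R -> R[i]) (M : R) : cmeas m -> (forall xi, cn (m xi) <= M) ->
  wclass k F -> wclass k (fun xi => m xi * F xi).
Proof.
move=> mm mM WF; apply: (@wclass_le k k F _ M) => //.
- by apply: cmeasM => //; case: WF.
- move=> xi; rewrite /wabs Normc.normcM mulrCA ler_wpM2r//.
  by rewrite mulr_ge0 ?wt_ge0 ?normc_ge0.
Qed.

Lemma wclassZ k (c : R[i]) F : wclass k F -> wclass k (fun xi => c * F xi).
Proof.
by move=> WF; apply: (@wclassM_bounded _ _ (fun=> c) (cn c)) => //; exact: cmeas_cst.
Qed.

Lemma wclassM_linear k F (m : R -> R[i]) : cmeas m -> (forall xi, cn (m xi) <= `|xi|) ->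
  wclass k.+1 F -> wclass k (fun xi => m xi * F xi).
Proof.
move=> mm mM WF; apply: (@wclass_le k.+1 k F _ 1) => //.
- by apply: cmeasM => //; case: WF.
- move=> xi; rewrite /wabs mul1r Normc.normcM wtS -mulrA.
  rewrite ler_wpM2l ?wt_ge0// ler_wpM2r ?normc_ge0//.
  by apply: le_trans (mM xi) _; rewrite lerDr.
Qed.

Lemma s_opp1 : (-1 : R) ^+ 2 = 1. Proof. by rewrite sqrrN expr1n. Qed.

Lemma rL1_reflect (g : R -> R) (xi : R) : rL1 g -> rL1 (fun eta => g (xi - eta)).
Proof.
move=> ig; have := rL1_affine xi s_opp1 ig.
by under eq_fun do rewrite mulN1r.
Qed.

Lemma rintegral_reflect (g : R -> R) (xi : R) : rL1 g ->
  \int[mu]_eta g (xi - eta) = \int[mu]_eta g eta.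
Proof.
move=> ig; rewrite -(rintegral_affine xi s_opp1 ig).
by apply: eq_Rintegral => x _; rewrite mulN1r.
Qed.

Lemma cmeas_reflect F xi : cmeas F -> cmeas (fun eta : R => F (xi - eta)).
Proof.
move=> mF; have := cmeas_comp mF (measurable_affine xi (-1)).
by under eq_fun do rewrite mulN1r.
Qed.

Lemma cL2_reflect F xi : cL2 F -> cL2 (fun eta => F (xi - eta)).
Proof.
move=> [mF iF]; split; first exact: cmeas_reflect.
exact: (rL1_reflect xi iF).
Qed.

(** The factor matches the normalization of [ift], so that products correspond to [conv] without a
    constant. *)
Definition conv F G : cfun R := fun xi =>
  ((2 * pi)^-1)%:C * J (fun eta => F eta * G (xi - eta)).

Lemma measurable_sub2 : measurable_fun setT (fun z : R * R => z.1 - z.2).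
Proof.
by apply: measurable_realfun.measurable_funB; [exact: measurable_fst|exact: measurable_snd].
Qed.

Lemma L1_prod_conv1 (a b : R -> R) : (forall x, 0 <= a x) -> (forall x, 0 <= b x) ->
  rL1 a -> rL1 b -> L1_prod (fun z => a z.2 * b (z.1 - z.2)).
Proof.
move=> a0 b0 ia ib; have := L1_prod_conv (expr1n _ _) a0 b0 ia ib.
by under eq_fun do rewrite mul1r.
Qed.

Lemma cL1_prod_conv F G : cL1 F -> cL1 G ->
  cL1_prod (fun z => F z.2 * G (z.1 - z.2)).
Proof.
move=> [mF iF] [mG iG].
apply: (@cL1_prod_le _ _ (fun z => cn (F z.2) * cn (G (z.1 - z.2)))).
- apply: cmeasM; first by apply: (cmeas_comp mF); exact: measurable_snd.
  by apply: (cmeas_comp mG); exact: measurable_sub2.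
- by move=> z; rewrite Normc.normcM.
- by apply: (L1_prod_conv1 (a := fun x => cn (F x)) (b := fun x => cn (G x))) => // x;
    exact: normc_ge0.
Qed.

Lemma cL1_conv F G : cL1 F -> cL1 G -> cL1 (conv F G).
Proof. by move=> iF iG; apply: cL1Z; exact: (cL1_cintegral (cL1_prod_conv iF iG)). Qed.

Lemma cL1_conv_integrand F G xi : cL2 F -> cL2 G -> cL1 (fun eta => F eta * G (xi - eta)).
Proof. by move=> iF iG; apply: cL1M => //; exact: cL2_reflect. Qed.

(* Weights are submultiplicative; square integrability of a convolution comes
   for free because it is integrable and, by AM-GM, bounded. *)
Lemma wclass_conv k F G : wclass k F -> wclass k G -> wclass k (conv F G).
Proof.
move=> WF WG; have iF := wclass_cL1 WF; have iG := wclass_cL1 WG.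
have jF := wclass_cL2 WF; have jG := wclass_cL2 WG.
case: WF => mF a1 a2; case: WG => mG b1 b2.
pose A := wabs k F; pose B := wabs k G.
have A0 xi : 0 <= A xi by exact: wabs_ge0.
have B0 xi : 0 <= B xi by exact: wabs_ge0.
pose C xi := \int[mu]_eta (A eta * B (xi - eta)).
have iC : rL1 C by have [] := rintegral_prod (L1_prod_conv1 A0 B0 a1 b1).
have C0 xi : 0 <= C xi by apply: Rintegral_ge0 => eta _; exact: mulr_ge0.
pose M := \int[mu]_eta A eta ^+ 2 + \int[mu]_eta B eta ^+ 2.
have AB xi eta : A eta * B (xi - eta) <= A eta ^+ 2 + B (xi - eta) ^+ 2.
  by have := A0 eta; have := B0 (xi - eta); move: (A eta) (B _) => s t *; nra.
have i2 xi : rL1 (fun eta => A eta ^+ 2 + B (xi - eta) ^+ 2).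
  by apply: rL1D => //; exact: (rL1_reflect xi b2).
have iAB xi : rL1 (fun eta => A eta * B (xi - eta)).
  apply: rL1_le (i2 xi).
    apply: measurable_realfun.measurable_funM; first exact: measurable_wabs.
    by apply: rL1_measurable; exact: rL1_reflect.
  move=> eta; have p : 0 <= A eta * B (xi - eta) by exact: mulr_ge0.
  rewrite (ger0_norm p).
  exact: AB.
have CM xi : C xi <= M.
  rewrite /M -(rintegral_reflect xi b2) -RintegralD//; last exact: (rL1_reflect xi b2).
  apply: le_rintegral; [exact: iAB|exact: i2|] => eta.
  exact: AB.
have c0 : 0 <= (2 * pi)^-1 :> R by rewrite invr_ge0 mulr_ge0// pi_ge0.
apply: (@wclass_le_real _ _ (fun xi => (2 * pi)^-1 * C xi)).
- by case: (cL1_conv iF iG).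
- move=> xi; rewrite /wabs /conv Normc.normcM normc_real (ger0_norm c0) mulrCA.
  apply: ler_wpM2l => //.
  have h := cL1_conv_integrand xi jF jG.
  apply: le_trans (ler_wpM2l (wt_ge0 k xi) (normc_cintegral h)) _.
  rewrite -RintegralZ; last by case: h.
  apply: le_rintegral; [by apply: rL1Z; case: h|exact: iAB|] => eta.
  rewrite Normc.normcM /A /B /wabs mulrACA; apply: ler_wpM2r.
    by rewrite mulr_ge0 ?normc_ge0.
  exact: wt_submult.
- exact: rL1Z.
- under eq_fun do rewrite exprMn; apply: rL1Z.
  apply: (@rL1_le _ _ (fun xi => M * C xi)); last exact: rL1Z.
    by apply: measurable_funX; exact: rL1_measurable.
  by move=> xi; rewrite ger0_norm ?sqr_ge0// expr2; apply: ler_wpM2r.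
Qed.

Lemma ift_conv F G x : cL1 F -> cL1 G -> cL2 F -> cL2 G ->
  ift (conv F G) x = ift F x * ift G x.
Proof.
move=> iF iG jF jG.
pose K (z : R * R) := cis (z.1 * x) * (F z.2 * G (z.1 - z.2)).
have iK : cL1_prod K.
  have [m i] := cL1_prod_conv iF iG; split.
    apply: cmeasM => //; apply: cmeas_cis.
    by apply: measurable_realfun.measurable_funM; [exact: measurable_fst|exact: measurable_cst].
  by under eq_fun do rewrite Normc.normcM normc_cis mul1r.
(* Translating [G] by [eta] multiplies its inverse transform by a phase. This is the inner integral
   once the order of integration is exchanged. *)
have shift eta : J (fun xi => cis (xi * x) * G (xi - eta)) = cis (eta * x) * ft 1 G x.
  have i1 := cL1_ft_integrand 1 x iG.
  have h := cintegral_affine (- eta) (expr1n _ 2) (cL1Z (cis (eta * x)) i1).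
  rewrite /ft -cintegralZ// -h; apply: eq_cintegral => xi.
  rewrite mulrA -cisD; congr (cis _ * G _); ring.
have e : ft 1 (conv F G) x = ((2 * pi)^-1)%:C * (ft 1 F x * ft 1 G x).
  transitivity (((2 * pi)^-1)%:C * J (fun xi => J (fun eta => K (xi, eta)))).
    rewrite -cintegralZ; last exact: cL1_cintegral.
    apply: eq_cintegral => xi; rewrite /conv mulrCA; congr (_ * _).
    have ae_h : cL1 (fun eta => F eta * G (xi - eta)).
      exact: cL1_conv_integrand.
    by rewrite -cintegralZ//; apply: eq_cintegral => eta; rewrite /K/= mul1r.
  congr (_ * _); rewrite (cintegral_swap iK) /=.
  transitivity (J (fun eta => ft 1 G x * (cis (1 * (eta * x)) * F eta))).
    apply: eq_cintegral => eta; rewrite /K/= mul1r mulrA [ft 1 G x * _]mulrC -shift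
      [RHS]mulrC -cintegralZ.
      by apply: eq_cintegral => xi; rewrite mulrCA.
    have := cL1_affine (- eta) (expr1n _ 2) (cL1Z (cis (eta * x)) (cL1_ft_integrand 1 x iG)).
    by congr cL1; apply/funext => xi; rewrite mulrA -cisD; congr (cis _ * G _); ring.
  by rewrite cintegralZ; [rewrite mulrC|exact: cL1_ft_integrand].
rewrite /ift e; ring.
Qed.

End WeightedClass.

(** * Derivatives, multipliers and products of inverse transforms *)

Section ClassCalculus.
Context {R : realType}.
Notation mu := (@lebesgue_measure R).
Notation cn := Normc.normc.
Notation J f := (cintegral setT f).
Implicit Types (f g h F G : cfun R) (k : nat).

Definition symD (xi : R) : R[i] := 'i%C * xi%:C.

Lemma normc_symD xi : cn (symD xi) = `|xi|.
Proof. by rewrite Normc.normcM normc_i mul1r normc_real. Qed.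

Lemma cmeas_id : cmeas (fun xi : R => xi%:C).
Proof. by apply: cmeas_real; exact: measurable_id. Qed.

Lemma cmeas_symD : cmeas symD.
Proof. by apply: cmeasM; [exact: cmeas_cst|exact: cmeas_id]. Qed.

Lemma wclass_symD k F : wclass k.+1 F -> wclass k (fun xi => symD xi * F xi).
Proof.
apply: wclassM_linear; first exact: cmeas_symD.
by move=> xi; rewrite normc_symD.
Qed.

Lemma is_derive_Re_cis (xi x : R) (z : R[i]) :
  is_derive x 1 (fun x : R => complex.Re (cis (1 * (xi * x)) * z))
    (complex.Re (cis (1 * (xi * x)) * (symD xi * z))).
Proof.
rewrite (_ : (fun x => _) = fun x : R => cos (xi * x) * complex.Re z - sin (xi * x) * complex.Im z).
  apply: is_derive_eq; rewrite !(scaler0, addr0, add0r) /GRing.scale/=.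
  by case: z => a b /=; rewrite !mul1r; ring.
by apply/funext => y; rewrite mul1r; case: z.
Qed.

Lemma is_derive_Im_cis (xi x : R) (z : R[i]) :
  is_derive x 1 (fun x : R => complex.Im (cis (1 * (xi * x)) * z))
    (complex.Im (cis (1 * (xi * x)) * (symD xi * z))).
Proof.
rewrite (_ : (fun x => _) = fun x : R => cos (xi * x) * complex.Im z + sin (xi * x) * complex.Re z).
  apply: is_derive_eq; rewrite !(scaler0, addr0, add0r) /GRing.scale/=.
  by case: z => a b /=; rewrite !mul1r; ring.
by apply/funext => y; rewrite mul1r; case: z => a b.
Qed.

Lemma is_derive_integral (phi dphi : R -> R -> R) (g : R -> R) (a : R) :
  (forall x, rL1 (phi x)) ->
  (forall x y : R, is_derive x 1 (phi ^~ y) (dphi x y)) ->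
  rL1 g -> (forall x y, `|dphi x y| <= g y) ->
  is_derive a 1 (fun x => \int[mu]_y phi x y) (\int[mu]_y dphi a y).
Proof.
move=> iphi dp ig dg.
have E x y : partial1of2 phi x y = dphi x y.
  by rewrite partial1of2E; have [_ <-] := dp x y.
have g0 y : 0 <= g y by exact: le_trans (normr_ge0 _) (dg a y).
have Ia : [set` `]a - 1, a + 1[] a by rewrite /= in_itv/=; apply/andP; split; lra.
have bd x y : [set` `]a - 1, a + 1[] x -> [set: R] y -> `|partial1of2 phi x y| <= g y.
  by move=> _ _; rewrite E.
have dphi' x y : [set` `]a - 1, a + 1[] x -> [set: R] y -> derivable (phi ^~ y) x 1.
  by move=> _ _; have [] := dp x y.
have h1 := @derivable_under_integral R _ _ mu phi setT measurableT a _ _ Ia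
  (fun x _ => iphi x) dphi' g g0 ig bd.
have h2 := @differentiation_under_integral R _ _ mu phi setT measurableT a _ _ Ia
  (fun x _ => iphi x) dphi' g g0 ig bd.
apply: DeriveDef; first exact: h1.
by rewrite -derive1E h2//; apply: eq_Rintegral => y _; exact: E.
Qed.

Lemma is_derive_ft F (a : R) : wclass 1 F ->
  is_derive a 1 (fun x : R => complex.Re (ft 1 F x))
    (complex.Re (ft 1 (fun xi => symD xi * F xi) a)) /\
  is_derive a 1 (fun x : R => complex.Im (ft 1 F x))
    (complex.Im (ft 1 (fun xi => symD xi * F xi) a)).
Proof.
move=> WF; have iF := wclass_cL1 WF; have iDF := wclass_cL1 (wclass_symD WF).
have idF : rL1 (fun xi => cn (symD xi * F xi)) by case: iDF.
split.
- apply: (@is_derive_integral (fun x xi => complex.Re (cis (1 * (xi * x)) * F xi))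
    (fun x xi => complex.Re (cis (1 * (xi * x)) * (symD xi * F xi))) _ a _ _ idF).
  + by move=> x; exact: (cL1_Re (cL1_ft_integrand 1 x iF)).
  + by move=> x xi; exact: is_derive_Re_cis.
  + by move=> x xi; apply: le_trans (Re_le_normc _) _; rewrite Normc.normcM normc_cis mul1r.
- apply: (@is_derive_integral (fun x xi => complex.Im (cis (1 * (xi * x)) * F xi))
    (fun x xi => complex.Im (cis (1 * (xi * x)) * (symD xi * F xi))) _ a _ _ idF).
  + by move=> x; exact: (cL1_Im (cL1_ft_integrand 1 x iF)).
  + by move=> x xi; exact: is_derive_Im_cis.
  + by move=> x xi; apply: le_trans (Im_le_normc _) _; rewrite Normc.normcM normc_cis mul1r.
Qed.

Lemma Re_ift F x : complex.Re (ift F x) = (2 * pi)^-1 * complex.Re (ft 1 F x).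
Proof. by rewrite /ift ReM/= mul0r subr0. Qed.

Lemma Im_ift F x : complex.Im (ift F x) = (2 * pi)^-1 * complex.Im (ft 1 F x).
Proof. by rewrite /ift ImM/= mul0r addr0. Qed.

Lemma is_derive_ift F (a : R) : wclass 1 F ->
  is_derive a 1 (fun x : R => complex.Re (ift F x))
    (complex.Re (ift (fun xi => symD xi * F xi) a)) /\
  is_derive a 1 (fun x : R => complex.Im (ift F x))
    (complex.Im (ift (fun xi => symD xi * F xi) a)).
Proof.
move=> /(@is_derive_ft _ a)[dr di]; split.
- under eq_fun do rewrite Re_ift.
  by rewrite Re_ift; apply: is_derive_eq.
- under eq_fun do rewrite Im_ift.
  by rewrite Im_ift; apply: is_derive_eq.
Qed.

Lemma cderiv_ift F : wclass 1 F -> cderiv (ift F) = ift (fun xi => symD xi * F xi).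
Proof.
move=> WF; apply/funext => x; have [dr di] := is_derive_ift x WF.
by apply: complexP; rewrite /= derive1E; [have [_ ->] := dr|have [_ ->] := di].
Qed.

Lemma ccontinuous_ift F : wclass 1 F -> ccontinuous (ift F).
Proof.
move=> WF; split => x; apply: differentiable_continuous; apply/derivable1_diffP;
  have [dr di] := is_derive_ift x WF.
- by have [] := dr.
- by have [] := di.
Qed.

Lemma ccontinuous_ccont f y : ccontinuous f -> ccont_at f y.
Proof.
move=> [fr fi] e e0; have e20 : 0 < e / 2 by rewrite divr_gt0.
have /cvgrPdist_le /(_ _ e20) := fr y; have /cvgrPdist_le /(_ _ e20) := fi y.
move=> hi hr; have : \forall x \near y, cn (f x - f y) <= e.
  near=> x; apply: le_trans (normc_le_ReIm _) _; rewrite ReD ReN ImD ImN (splitr e).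
  apply: lerD; rewrite distrC; near: x; [exact: hr|exact: hi].
move=> /nbhs_ballP[d /= d0 dh]; exists d => // x xy; apply: dh.
by rewrite /ball/= distrC.
Unshelve. all: by end_near. Qed.

Lemma ift_ae F G : cL1 F -> cL1 G -> {ae mu, forall xi, F xi = G xi} -> ift F = ift G.
Proof.
move=> iF iG FG; apply/funext => x; congr (_ * _); apply: ae_eq_cintegral.
- by case: (cL1_ft_integrand 1 x iF).
- by case: (cL1_ft_integrand 1 x iG).
- by apply: ae_mono FG => xi ->.
Qed.

(** [multiplier] integrates the chosen representative [fourier (ift F)]. By [is_fourier_ift] and
    uniqueness it agrees with [F] almost everywhere, so the integral is unchanged at every point. *)
Lemma multiplier_ift (m : R -> R[i]) F : cmeas m -> cL1 F -> cL2 F ->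
  multiplier m (ift F) = ift (fun xi => m xi * F xi).
Proof.
move=> mm iF iF2; apply/funext => x; congr (_ * _).
have If := cL2_ift iF iF2.
have aeF := is_fourier_unique If (fourierP If) (is_fourier_ift iF iF2).
have mph : cmeas (fun xi => cis (x * xi)).
  apply: cmeas_cis; have := measurable_phase 1 x.
  by under eq_fun do rewrite mul1r.
have [mG _] := cL2_fourier If; have [mF _] := iF.
rewrite /ft; transitivity (J (fun xi => cis (x * xi) * (m xi * F xi))).
  apply: ae_eq_cintegral.
  - by apply: cmeasM => //; exact: cmeasM.
  - by apply: cmeasM => //; exact: cmeasM.
  - by apply: ae_mono aeF => xi ->.
by apply: eq_cintegral => xi; rewrite mul1r [x * xi]mulrC.
Qed.

Lemma iftD F G : cL1 F -> cL1 G ->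
  (fun x => ift F x + ift G x) = ift (fun xi => F xi + G xi).
Proof.
move=> iF iG; apply/funext => x; rewrite /ift -mulrDr; congr (_ * _).
rewrite /ft -cintegralD; [|exact: cL1_ft_integrand..].
by apply: eq_cintegral => xi; rewrite mulrDr.
Qed.

Lemma iftZ (c : R[i]) F : cL1 F ->
  (fun x => c * ift F x) = ift (fun xi => c * F xi).
Proof.
move=> iF; apply/funext => x; rewrite /ift mulrCA; congr (_ * _).
rewrite /ft -cintegralZ; last exact: cL1_ft_integrand.
by apply: eq_cintegral => xi; rewrite mulrCA.
Qed.

Lemma ift_conj F : cL1 F -> (fun x => conjc (ift F x)) = ift (fun xi => conjc (F (- xi))).
Proof.
move=> iF; apply/funext => x; rewrite /ift conjcM; congr (_ * _).
  by apply: complexP; rewrite ?Re_conj ?Im_conj/= ?oppr0.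
have i1 := cL1_ft_integrand 1 x iF.
rewrite /ft -cintegral_conj// -(cintegral_affine 0 s_opp1 (cL1_conj i1)).
apply: eq_cintegral => xi; rewrite add0r mulN1r conjcM cis_conj.
by congr (cis _ * _); ring.
Qed.

Lemma wclass_conj k F : wclass k F -> wclass k (fun xi => conjc (F (- xi))).
Proof.
move=> [mF i1 i2]; have refl (g : R -> R) : rL1 g -> rL1 (fun xi => g (- xi)).
  by move=> /(rL1_reflect 0); under eq_fun do rewrite add0r.
split.
- by apply: cmeas_conj; have := cmeas_reflect 0 mF; under eq_fun do rewrite add0r.
- have := refl _ i1; congr rL1; apply/funext => xi.
  by rewrite /wabs /wt normrN normc_conj.
- have := refl _ i2; congr rL1; apply/funext => xi.
  by rewrite /wabs /wt normrN normc_conj.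
Qed.

End ClassCalculus.

Section SmoothFunctions.
Context {R : realType}.
Notation mu := (@lebesgue_measure R).
Notation cn := Normc.normc.
Notation J f := (cintegral setT f).
Implicit Types (f g h u w F G : cfun R) (k : nat).

(** The equality [f = ift F] holds at every point, so derivatives and multipliers of such functions
    can be rewritten as equalities of functions. *)
Definition smooth k f := exists2 F, wclass k F & f = ift F.

Lemma smoothS k l f : (l <= k)%N -> smooth k f -> smooth l f.
Proof. by move=> kl [F WF ->]; exists F => //; exact: wclassS WF. Qed.

Lemma smoothD k f g : smooth k f -> smooth k g -> smooth k (fun x => f x + g x).
Proof.
move=> [F WF ->] [G WG ->]; exists (fun xi => F xi + G xi); first exact: wclassD.
by rewrite iftD//; [exact: wclass_cL1 WF|exact: wclass_cL1 WG].
Qed.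

Lemma smoothZ k (c : R[i]) f : smooth k f -> smooth k (fun x => c * f x).
Proof.
move=> [F WF ->]; exists (fun xi => c * F xi); first exact: wclassZ.
by rewrite iftZ//; exact: wclass_cL1 WF.
Qed.

Lemma smoothN k f : smooth k f -> smooth k (fun x => - f x).
Proof. by move=> /(smoothZ (-1)); under eq_fun do rewrite mulN1r. Qed.

Lemma smoothB k f g : smooth k f -> smooth k g -> smooth k (fun x => f x - g x).
Proof. by move=> sf /smoothN; exact: smoothD. Qed.

Lemma ift_convE k F G : wclass k F -> wclass k G ->
  (fun x => ift F x * ift G x) = ift (conv F G).
Proof.
move=> WF WG; apply/funext => x.
by rewrite ift_conv//; (exact: wclass_cL1 WF || exact: wclass_cL1 WG ||
  exact: wclass_cL2 WF || exact: wclass_cL2 WG).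
Qed.

Lemma ift_convx k F G x : wclass k F -> wclass k G ->
  ift F x * ift G x = ift (conv F G) x.
Proof. by move=> WF WG; have /(congr1 (@^~ x)) := ift_convE WF WG. Qed.

Lemma iftDx k F G x : wclass k F -> wclass k G ->
  ift F x + ift G x = ift (fun xi => F xi + G xi) x.
Proof. by move=> WF WG; rewrite -iftD//; [exact: wclass_cL1 WF|exact: wclass_cL1 WG]. Qed.

Lemma iftZx k (c : R[i]) F x : wclass k F -> c * ift F x = ift (fun xi => c * F xi) x.
Proof. by move=> WF; rewrite -iftZ//; exact: wclass_cL1 WF. Qed.

Lemma smoothM k f g : smooth k f -> smooth k g -> smooth k (fun x => f x * g x).
Proof.
move=> [F WF ->] [G WG ->]; exists (conv F G); first exact: wclass_conv.
exact: ift_convE WF WG.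
Qed.

Lemma smooth_conj k f : smooth k f -> smooth k (fun x => conjc (f x)).
Proof.
move=> [F WF ->]; exists (fun xi => conjc (F (- xi))); first exact: wclass_conj.
by rewrite ift_conj//; exact: wclass_cL1 WF.
Qed.

Lemma smooth_cderiv k f : smooth k.+1 f -> smooth k (cderiv f).
Proof.
move=> [F WF ->]; exists (fun xi => symD xi * F xi); first exact: wclass_symD.
by rewrite cderiv_ift//; exact: wclassS WF.
Qed.

Lemma smooth_ccontinuous f : smooth 1 f -> ccontinuous f.
Proof. by move=> [F WF ->]; exact: ccontinuous_ift. Qed.

Lemma smooth_cL2 k f : smooth k f -> cL2 f.
Proof.
by move=> [F WF ->]; apply: cL2_ift; [exact: wclass_cL1 WF|exact: wclass_cL2 WF].
Qed.

Lemma normc_ift F x : cL1 F -> cn (ift F x) <= (2 * pi)^-1 * \int[mu]_xi cn (F xi).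
Proof.
move=> iF; have c0 : 0 <= (2 * pi)^-1 :> R by rewrite invr_ge0 mulr_ge0// pi_ge0.
by rewrite Normc.normcM normc_real ger0_norm// ler_wpM2l// normc_ft.
Qed.

Lemma smooth_bounded k f : smooth k f -> exists M, forall x, cn (f x) <= M.
Proof.
move=> [F WF ->]; exists ((2 * pi)^-1 * \int[mu]_xi cn (F xi)) => x.
by apply: normc_ift; exact: wclass_cL1 WF.
Qed.

Lemma cderivD f g : smooth 1 f -> smooth 1 g ->
  cderiv (fun x => f x + g x) = (fun x => cderiv f x + cderiv g x).
Proof.
move=> [F WF ->] [G WG ->]; rewrite iftD; [|exact: wclass_cL1 WF|exact: wclass_cL1 WG].
rewrite !cderiv_ift//; last exact: wclassD.
rewrite iftD; [|exact: wclass_cL1 (wclass_symD WF)|exact: wclass_cL1 (wclass_symD WG)].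
by congr ift; apply/funext => xi; rewrite mulrDr.
Qed.

Lemma cderivZ (c : R[i]) f : smooth 1 f -> cderiv (fun x => c * f x) = (fun x => c * cderiv f x).
Proof.
move=> [F WF ->]; rewrite iftZ; last exact: wclass_cL1 WF.
rewrite !cderiv_ift//; last exact: wclassZ.
rewrite iftZ; last exact: wclass_cL1 (wclass_symD WF).
by congr ift; apply/funext => xi; rewrite mulrCA.
Qed.

Lemma cderivN f : smooth 1 f -> cderiv (fun x => - f x) = (fun x => - cderiv f x).
Proof.
move=> sf; have := cderivZ (-1) sf; under eq_fun do rewrite mulN1r.
by move=> ->; apply/funext => x; rewrite mulN1r.
Qed.

Lemma cderivB f g : smooth 1 f -> smooth 1 g ->
  cderiv (fun x => f x - g x) = (fun x => cderiv f x - cderiv g x).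
Proof. by move=> sf sg; rewrite cderivD ?cderivN//; exact: smoothN. Qed.

Lemma symDD (a b : R) : symD (a + b) = symD a + symD b.
Proof. by rewrite /symD -mulrDr -rmorphD. Qed.

(** Under the convolution integral the Leibniz rule is additivity of the symbol:
    [xi = eta + (xi - eta)]. *)
Lemma cderivM f g : smooth 1 f -> smooth 1 g ->
  cderiv (fun x => f x * g x) = (fun x => cderiv f x * g x + f x * cderiv g x).
Proof.
move=> [F WF ->] [G WG ->]; rewrite (ift_convE WF WG) !cderiv_ift//; last exact: wclass_conv.
have DF := wclass_symD WF; have DG := wclass_symD WG.
have F0 := wclassS (leq0n 1) WF; have G0 := wclassS (leq0n 1) WG.
apply/funext => x.
rewrite (ift_convx x DF G0) (ift_convx x F0 DG) (iftDx x (wclass_conv DF G0) (wclass_conv F0 DG)).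
apply: (congr1 (fun F => ift F x)); apply/funext => xi.
rewrite /conv -mulrDr mulrCA; congr (_ * _).
have FL2 := wclass_cL2 WF; have GL2 := wclass_cL2 WG.
rewrite -cintegralZ; last exact: cL1_conv_integrand.
rewrite -cintegralD; [|exact: cL1_conv_integrand (wclass_cL2 DF) GL2
  |exact: cL1_conv_integrand FL2 (wclass_cL2 DG)].
apply: eq_cintegral => eta.
have -> : symD xi = symD eta + symD (xi - eta) by rewrite -symDD subrKC.
by ring.
Qed.

Lemma cderiv_conj f : smooth 1 f -> cderiv (fun x => conjc (f x)) = (fun x => conjc (cderiv f x)).
Proof.
move=> [F WF ->]; rewrite ift_conj; last exact: wclass_cL1 WF.
rewrite !cderiv_ift//; last exact: wclass_conj.
rewrite ift_conj; last exact: wclass_cL1 (wclass_symD WF).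
congr ift; apply/funext => xi; rewrite conjcM; congr (_ * _).
by apply: complexP; rewrite ?Re_conj ?Im_conj /symD ?ReM ?ImM/=; ring.
Qed.

(** * The Hilbert transform and Cotlar's identity *)

Definition symH (xi : R) : R[i] := - 'i%C * (Num.sg xi)%:C.

Lemma cmeas_symH : cmeas symH.
Proof.
apply: cmeasM; first exact: cmeas_cst.
apply: cmeas_real.
rewrite (_ : Num.sg = (fun x : R => \1_(`]0, +oo[ : set R) x - \1_(`]-oo, 0[ : set R) x)).
  by apply: measurable_realfun.measurable_funB; apply: measurable_indic; exact: measurable_itv.
apply/funext => x; rewrite !indicE !mem_setE !in_itv/= andbT.
by case: sgrP; rewrite ?subr0 ?sub0r ?subrr.
Qed.

Lemma normc_symH xi : cn (symH xi) <= 1.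
Proof.
rewrite Normc.normcM normcN normc_i mul1r normc_real normr_sg.
by case: (_ != 0); rewrite ?ler01.
Qed.

Lemma wclass_symH k F : wclass k F -> wclass k (fun xi => symH xi * F xi).
Proof. by apply: wclassM_bounded; [exact: cmeas_symH|exact: normc_symH]. Qed.

Lemma hilbert_ift k F : wclass k F -> hilbert (ift F) = ift (fun xi => symH xi * F xi).
Proof.
by move=> WF; rewrite /hilbert multiplier_ift//;
  [exact: cmeas_symH|exact: wclass_cL1 WF|exact: wclass_cL2 WF].
Qed.

Lemma smooth_hilbert k f : smooth k f -> smooth k (hilbert f).
Proof.
move=> [F WF ->]; exists (fun xi => symH xi * F xi); first exact: wclass_symH.
exact: hilbert_ift WF.
Qed.

Lemma hilbertD f g : smooth 0 f -> smooth 0 g ->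
  hilbert (fun x => f x + g x) = (fun x => hilbert f x + hilbert g x).
Proof.
move=> [F WF ->] [G WG ->]; rewrite iftD; [|exact: wclass_cL1 WF|exact: wclass_cL1 WG].
rewrite (hilbert_ift (wclassD WF WG)) (hilbert_ift WF) (hilbert_ift WG).
rewrite iftD; [|exact: wclass_cL1 (wclass_symH WF)|exact: wclass_cL1 (wclass_symH WG)].
by congr ift; apply/funext => xi; rewrite mulrDr.
Qed.

Lemma hilbertZ (c : R[i]) f : smooth 0 f ->
  hilbert (fun x => c * f x) = (fun x => c * hilbert f x).
Proof.
move=> [F WF ->]; rewrite iftZ; last exact: wclass_cL1 WF.
rewrite (hilbert_ift (wclassZ c WF)) (hilbert_ift WF).
rewrite iftZ; last exact: wclass_cL1 (wclass_symH WF).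
by congr ift; apply/funext => xi; rewrite mulrCA.
Qed.

Lemma hilbertN f : smooth 0 f -> hilbert (fun x => - f x) = (fun x => - hilbert f x).
Proof.
move=> sf; have := hilbertZ (-1) sf; under eq_fun do rewrite mulN1r.
by move=> ->; apply/funext => x; rewrite mulN1r.
Qed.

Lemma hilbertB f g : smooth 0 f -> smooth 0 g ->
  hilbert (fun x => f x - g x) = (fun x => hilbert f x - hilbert g x).
Proof. by move=> sf sg; rewrite hilbertD ?hilbertN//; exact: smoothN. Qed.

Lemma hilbert_cderiv f : smooth 1 f -> hilbert (cderiv f) = cderiv (hilbert f).
Proof.
move=> [F WF ->]; rewrite cderiv_ift// (hilbert_ift (wclass_symD WF)) (hilbert_ift WF).
rewrite cderiv_ift; last exact: wclass_symH.
by congr ift; apply/funext => xi; rewrite mulrCA.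
Qed.

(** On symbols, [|xi| = (- i sgn xi) (i xi)]. *)
Lemma absDE f : smooth 1 f -> absD f = hilbert (cderiv f).
Proof.
move=> [F WF ->]; rewrite (cderiv_ift WF).
apply: etrans (esym (hilbert_ift (wclass_symD WF))).
have mabs : cmeas (fun xi : R => `|xi|%:C) by apply: cmeas_real; exact: normr_measurable.
apply: (etrans (multiplier_ift mabs (wclass_cL1 WF) (wclass_cL2 WF))).
congr ift; apply/funext => xi; rewrite mulrA; congr (_ * _).
rewrite /symH /symD mulrACA [X in X * _](_ : _ = 1).
  by rewrite mul1r -rmorphM/= -normrEsg.
by rewrite mulNr -expr2 sqr_i opprK.
Qed.

(** After removing the factors [- i], this is [sgn xi (sgn (xi - eta) + sgn eta) = sgn eta sgn (xi -
    eta) + 1]: if [eta] and [xi - eta] have the same sign, so does [xi]; otherwise both sides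
    vanish. *)
Lemma symH_cotlar (xi eta : R) : xi != 0 -> eta != 0 -> xi - eta != 0 ->
  symH xi * (symH (xi - eta) + symH eta) = symH eta * symH (xi - eta) - 1.
Proof.
rewrite /symH => x0 y0 z0.
have keyR : Num.sg xi * (Num.sg (xi - eta) + Num.sg eta) = Num.sg eta * Num.sg (xi - eta) + 1.
  move: x0 y0 z0; rewrite subr_eq0 => x0 y0 z0.
  case: (ltgtP xi 0) x0 => // x0 _; case: (ltgtP eta 0) y0 => // y0 _;
  case: (ltgtP xi eta) z0 => // z0 _; do ?(exfalso; lra).
  all: rewrite ?(gtr0_sg x0) ?(ltr0_sg x0) ?(gtr0_sg y0) ?(ltr0_sg y0).
  all: try (rewrite gtr0_sg ?subr_gt0//; ring).
  all: try (rewrite ltr0_sg ?subr_lt0//; ring).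
have key : (Num.sg xi)%:C * ((Num.sg (xi - eta))%:C + (Num.sg eta)%:C) =
    (Num.sg eta)%:C * (Num.sg (xi - eta))%:C + 1 :> R[i].
  by have := congr1 (fun a : R => a%:C) keyR; rewrite !(rmorphM, rmorphD, rmorph1).
have i2 : 'i%C * 'i%C = -1 :> R[i] by rewrite -expr2 sqr_i.
transitivity ('i%C * 'i%C * ((Num.sg xi)%:C * ((Num.sg (xi - eta))%:C + (Num.sg eta)%:C)) : R[i]).
  by ring.
rewrite key i2; transitivity ('i%C * 'i%C * ((Num.sg eta)%:C * (Num.sg (xi - eta))%:C) - 1 : R[i]).
  by rewrite i2; ring.
by ring.
Qed.

(* On the Fourier side Cotlar's identity is the pointwise relation between
   the symbols at [xi], [eta] and [xi - eta]. *)
Lemma cotlar f g : smooth 0 f -> smooth 0 g ->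
  hilbert (fun x => f x * hilbert g x + hilbert f x * g x) =
  (fun x => hilbert f x * hilbert g x - f x * g x).
Proof.
move=> [F WF ->] [G WG ->]; rewrite (hilbert_ift WF) (hilbert_ift WG).
have HF := wclass_symH WF; have HG := wclass_symH WG.
set hF := fun xi => _ * F xi in HF *; set hG := fun xi => _ * G xi in HG *.
have C1 := wclass_conv WF HG; have C2 := wclass_conv HF WG.
have C3 := wclass_conv HF HG; have C4 := wclass_conv WF WG.
have C12 := wclassD C1 C2; have C34 := wclassD C3 (wclassZ (-1) C4).
transitivity (hilbert (ift (fun xi => conv F hG xi + conv hF G xi))).
  by congr hilbert; apply/funext => x; rewrite (ift_convx x WF HG) (ift_convx x HF WG) (iftDx x C1 C2).
transitivity (ift (fun xi => conv hF hG xi + -1 * conv F G xi)); last first.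
  apply/funext => x; rewrite (ift_convx x HF HG) (ift_convx x WF WG) -(iftDx x C3 (wclassZ (-1) C4)).
  by rewrite -(iftZx (-1) x C4) mulN1r.
rewrite (hilbert_ift C12).
apply: ift_ae.
- exact: wclass_cL1 (wclass_symH (wclassD C1 C2)).
- exact: wclass_cL1 (wclassD C3 (wclassZ (-1) C4)).
(* The symbol relation is stated for nonzero frequencies. The value [xi = 0] is discarded in the
   outer integral, and [eta = 0] and [eta = xi] in the inner one, each being a null set. *)
apply: ae_mono (ae_neq 0) => xi xi0.
have FL2 := wclass_cL2 WF; have GL2 := wclass_cL2 WG.
have hF2 := wclass_cL2 HF; have hG2 := wclass_cL2 HG.
have I1 := cL1_conv_integrand xi FL2 hG2; have I2 := cL1_conv_integrand xi hF2 GL2.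
have I3 := cL1_conv_integrand xi hF2 hG2; have I4 := cL1_conv_integrand xi FL2 GL2.
rewrite /conv -mulrDr mulrCA [-1 * _]mulrCA -[RHS]mulrDr; congr (_ * _).
rewrite -cintegralD// -cintegralZ; last exact: cL1D.
rewrite -[-1 * _]cintegralZ// -cintegralD//; last exact: cL1Z.
apply: ae_eq_cintegral.
- by case: (cL1Z (symH xi) (cL1D I1 I2)).
- by case: (cL1D I3 (cL1Z (-1) I4)).
apply: ae_mono2 (ae_neq 0) (ae_neq xi) => eta eta0; rewrite eq_sym -subr_eq0 => xe0.
have := symH_cotlar xi0 eta0 xe0; rewrite /hF /hG => e.
transitivity (symH xi * (symH (xi - eta) + symH eta) * (F eta * G (xi - eta))); first by ring.
by rewrite e; ring.
Qed.

End SmoothFunctions.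

(** * The commutator computation *)

(* The commutator computation uses only that [D] is a derivation, that [H]
   is linear and commutes with [D], and Cotlar's identity for [H]. *)
Section AbstractLax.
Context {R : realType}.
Implicit Types (u : cfun R) (k : nat).
Variables (S : nat -> cfun R -> Prop) (D H : cfun R -> cfun R).
Hypothesis SS : forall k l u, (l <= k)%N -> S k u -> S l u.
Hypothesis SD : forall k u1 u2, S k u1 -> S k u2 -> S k (fun x => u1 x + u2 x).
Hypothesis SB : forall k u1 u2, S k u1 -> S k u2 -> S k (fun x => u1 x - u2 x).
Hypothesis SN : forall k u, S k u -> S k (fun x => - u x).
Hypothesis SZ : forall k (c : R[i]) u, S k u -> S k (fun x => c * u x).
Hypothesis SM : forall k u1 u2, S k u1 -> S k u2 -> S k (fun x => u1 x * u2 x).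
Hypothesis SDer : forall k u, S k.+1 u -> S k (D u).
Hypothesis SH : forall k u, S k u -> S k (H u).
Hypothesis DD : forall u1 u2, S 1 u1 -> S 1 u2 ->
  D (fun x => u1 x + u2 x) = fun x => D u1 x + D u2 x.
Hypothesis DB : forall u1 u2, S 1 u1 -> S 1 u2 ->
  D (fun x => u1 x - u2 x) = fun x => D u1 x - D u2 x.
Hypothesis DN : forall u, S 1 u -> D (fun x => - u x) = fun x => - D u x.
Hypothesis DZ : forall (c : R[i]) u, S 1 u -> D (fun x => c * u x) = fun x => c * D u x.
Hypothesis DM : forall u1 u2, S 1 u1 -> S 1 u2 ->
  D (fun x => u1 x * u2 x) = fun x => D u1 x * u2 x + u1 x * D u2 x.
Hypothesis HD : forall u1 u2, S 0 u1 -> S 0 u2 ->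
  H (fun x => u1 x + u2 x) = fun x => H u1 x + H u2 x.
Hypothesis HB : forall u1 u2, S 0 u1 -> S 0 u2 ->
  H (fun x => u1 x - u2 x) = fun x => H u1 x - H u2 x.
Hypothesis HN : forall u, S 0 u -> H (fun x => - u x) = fun x => - H u x.
Hypothesis HZ : forall (c : R[i]) u, S 0 u -> H (fun x => c * u x) = fun x => c * H u x.
Hypothesis HDer : forall u, S 1 u -> H (D u) = D (H u).
Hypothesis Hcotlar : forall u1 u2, S 0 u1 -> S 0 u2 ->
  H (fun x => u1 x * H u2 x + H u1 x * u2 x) = fun x => H u1 x * H u2 x - u1 x * u2 x.

(** [w] plays the conjugate of [v] but is otherwise independent. The products [rho] and [g] get
    their own names so that they stay atomic under [D] and [H] and are expanded only where a
    cancellation needs it. *)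
Variables (v w rho f g : cfun R).
Hypotheses (sv : S 4 v) (sw : S 4 w) (srho : S 4 rho) (sf : S 4 f) (sg : S 4 g).
Hypothesis rhoE : forall x, rho x = v x * w x.
Hypothesis gE : forall x, g x = w x * f x.

Let h0 := H g.
Let sh0 : S 4 h0. Proof. exact: SH. Qed.

(** [Dtilde] and [Hop], with [|v|^4] written as [rho^2] and [|D|] as [H D]. *)
Let Dt u : cfun R := fun x => D u x + 2^-1 * (v x * H (fun y => w y * u y) x).
Let Ho u : cfun R := fun x => - D (D u) x + 4^-1 * (rho x * rho x * u x)
  - v x * H (D (fun y => w y * u y)) x.

(** The goal is decomposed along the syntax of the function: each [D] raises the required index by
    one, and an atom is closed from its hypothesis by monotonicity in the index. *)
Ltac smooth_tac := repeat match goal with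
  | h : S ?n ?f |- S ?k ?g => constr_eq f g; refine (@SS n k f _ h); by []
  | h : S ?n ?f |- S ?k (fun x => ?g x) =>
      constr_eq f g; refine (@SS n k f _ h); by []
  | |- S _ (H ?f) => refine (@SH _ f _)
  | |- S _ (fun x => H ?f x) => refine (@SH _ f _)
  | |- S _ (D ?f) => refine (@SDer _ f _)
  | |- S _ (fun x => D ?f x) => refine (@SDer _ f _)
  | |- S _ (fun x => - (@?f x)) => refine (@SN _ f _)
  | |- S _ (fun x => ?c * (@?f x)) => refine (@SZ _ c f _)
  | |- S _ (fun x => (@?f x) * (@?g x)) => refine (@SM _ f g _ _)
  | |- S _ (fun x => (@?f x) - (@?g x)) => refine (@SB _ f g _ _)
  | |- S _ (fun x => (@?f x) + (@?g x)) => refine (@SD _ f g _ _)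
  end.

Let gF : (fun y => w y * f y) = g.
Proof. by apply/funext => y; rewrite gE. Qed.

Let Dg : D g = fun x => D w x * f x + w x * D f x.
Proof. by rewrite -gF DM; smooth_tac. Qed.

Let DtE : Dt f = fun x => D f x + 2^-1 * (v x * h0 x).
Proof. by rewrite /Dt gF. Qed.

Let HoE : Ho f = fun x => - D (D f) x + 4^-1 * (rho x * rho x * f x) - v x * D h0 x.
Proof. by rewrite /Ho gF HDer//; smooth_tac. Qed.

Let DDDt : D (D (Dt f)) = fun x => D (D (D f)) x +
  2^-1 * (D (D v) x * h0 x + 2 * (D v x * D h0 x) + v x * D (D h0) x).
Proof.
rewrite DtE DD; [|by smooth_tac..].
rewrite DZ; [|by smooth_tac]; rewrite DM; [|by smooth_tac..].
rewrite DD; [|by smooth_tac..].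
rewrite DZ; [|by smooth_tac]; rewrite DD; [|by smooth_tac..].
rewrite !DM; [|by smooth_tac..].
by apply/funext => x; ring.
Qed.

Let HDDt x : H (D (fun y => w y * Dt f y)) x =
  H (fun y => D w y * D f y) x + H (fun y => w y * D (D f) y) x
  + 2^-1 * (H (fun y => D rho y * h0 y) x + H (fun y => rho y * D h0 y) x).
Proof.
have -> : (fun y => w y * Dt f y) = fun y => w y * D f y + 2^-1 * (rho y * h0 y).
  by apply/funext => y; rewrite DtE rhoE; ring.
rewrite DD; [|by smooth_tac..].
rewrite DZ; [|by smooth_tac]; rewrite !DM; [|by smooth_tac..].
rewrite HD; [|by smooth_tac..].
rewrite HD; [|by smooth_tac..].
rewrite HZ; [|by smooth_tac].
by rewrite HD; [|by smooth_tac..].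
Qed.

Let DHo x : D (Ho f) x = - D (D (D f)) x
  + 4^-1 * (2 * (rho x * D rho x * f x) + rho x * rho x * D f x)
  - (D v x * D h0 x + v x * D (D h0) x).
Proof.
rewrite HoE DB; [|by smooth_tac..].
rewrite DD; [|by smooth_tac..].
rewrite DN; [|by smooth_tac]; rewrite DZ; [|by smooth_tac].
rewrite !DM; [|by smooth_tac..].
by ring.
Qed.

Let HHo x : H (fun y => w y * Ho f y) x = - H (fun y => w y * D (D f) y) x
  + 4^-1 * H (fun y => rho y * rho y * g y) x - H (fun y => rho y * D h0 y) x.
Proof.
have -> : (fun y => w y * Ho f y) = fun y => - (w y * D (D f) y)
    + 4^-1 * (rho y * rho y * g y) - rho y * D h0 y.
  by apply/funext => y; rewrite HoE gE rhoE; ring.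
rewrite HB; [|by smooth_tac..].
rewrite HD; [|by smooth_tac..].
rewrite HZ; [|by smooth_tac].
by rewrite HN; [|by smooth_tac].
Qed.

(** [D] is first moved inside [H] and the Leibniz rule applied there, so that the result is written
    in the same values of [H] as [HDDt], [HHo] and [Hvtc]. *)
Let DDh0 x : D (D h0) x = H (fun y => D (D w) y * f y) x
  + 2 * H (fun y => D w y * D f y) x + H (fun y => w y * D (D f) y) x.
Proof.
rewrite -HDer; last by smooth_tac.
rewrite -HDer; last by smooth_tac.
rewrite Dg DD; [|by smooth_tac..].
rewrite !DM; [|by smooth_tac..].
rewrite HD; [|by smooth_tac..].
rewrite HD; [|by smooth_tac..].
rewrite HD; [|by smooth_tac..].
by ring.
Qed.

(** The only use of Cotlar's identity, with [D rho] and [g]. It trades the one product that does not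
    occur in the equation for the two terms containing [H (D rho)], that is [|D| rho], in [vt] and
    [vtc]; the remaining [D rho x * g x] cancels against the derivative of the quintic part of
    [Ho f]. *)
Let cot x : H (fun y => D rho y * h0 y) x =
  H (D rho) x * h0 x - D rho x * g x - H (fun y => H (D rho) y * g y) x.
Proof.
have sDrho : S 0 (D rho) by smooth_tac.
have sg0 : S 0 g by smooth_tac.
have := congr1 (@^~ x) (Hcotlar sDrho sg0); rewrite -/h0 /= => <-.
by rewrite HD; [rewrite addrK|smooth_tac..].
Qed.

Variables (vt vtc : cfun R).
Hypothesis vtE : forall x, vt x = 'i%C * (D (D v) x + H (D rho) x * v x
  - 4^-1 * (rho x * rho x * v x)).
Hypothesis vtcE : forall x, vtc x = - 'i%C * (D (D w) x + H (D rho) x * w x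
  - 4^-1 * (rho x * rho x * w x)).

Let Hvtc x : H (fun y => vtc y * f y) x = - 'i%C * (H (fun y => D (D w) y * f y) x
  + H (fun y => H (D rho) y * g y) x - 4^-1 * H (fun y => rho y * rho y * g y) x).
Proof.
have -> : (fun y => vtc y * f y) = fun y => - 'i%C * (
    D (D w) y * f y + H (D rho) y * g y - 4^-1 * (rho y * rho y * g y)).
  by apply/funext => y; rewrite vtcE gE; ring.
rewrite HZ; [|by smooth_tac]; rewrite HB; [|by smooth_tac..].
rewrite HD; [|by smooth_tac..].
by rewrite HZ; [|by smooth_tac].
Qed.

Lemma abstract_lax x : - (Ho (Dt f) x - Dt (Ho f) x) =
  - 'i%C * (2^-1 * (vt x * h0 x + v x * H (fun y => vtc y * f y) x)).
Proof.
have ii : 'i%C * 'i%C = -1 :> R[i] by rewrite -expr2 sqr_i.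
have -> : Ho (Dt f) x = - D (D (Dt f)) x + 4^-1 * (rho x * rho x * Dt f x)
  - v x * H (D (fun y => w y * Dt f y)) x by [].
have -> : Dt (Ho f) x = D (Ho f) x + 2^-1 * (v x * H (fun y => w y * Ho f y) x) by [].
rewrite DDDt HDDt DHo HHo Hvtc DtE vtE cot DDh0 gE.
(* [ring] treats ['i%C] as an atom, so the relation [i * i = -1] is used up here. *)
have E (A B h c : R[i]) : - 'i%C * (2^-1 * ('i%C * A * h + c * (- 'i%C * B))) =
    2^-1 * (A * h - c * B).
  by transitivity (- ('i%C * 'i%C) * (2^-1 * (A * h - c * B))); [ring|rewrite ii; ring].
rewrite E.
(* Once everything is expanded, these values of [H] can be treated as independent unknowns, and a
   polynomial identity over [R[i]] remains. *)
move: (H (fun y => D (D w) y * f y) x) (H (fun y => H (D rho) y * g y) x)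
  (H (fun y => rho y * rho y * g y) x) (H (fun y => D w y * D f y) x)
  (H (fun y => w y * D (D f) y) x) (H (fun y => rho y * D h0 y) x) => a1 a2 a3 a4 a5 a6.
rewrite rhoE.
by field.
Qed.

End AbstractLax.

Section LaxIdentity.
Context {R : realType}.
Implicit Types (f g h u v w : cfun R) (k : nat).

Lemma hilbert_conj f : smooth 0 f ->
  hilbert (fun x => conjc (f x)) = (fun x => conjc (hilbert f x)).
Proof.
move=> [F WF ->]; rewrite ift_conj; last exact: wclass_cL1 WF.
rewrite (hilbert_ift (wclass_conj WF)) (hilbert_ift WF).
rewrite ift_conj; last exact: wclass_cL1 (wclass_symH WF).
congr ift; apply/funext => xi; rewrite conjcM; congr (_ * _).
by apply: complexP; rewrite ?Re_conj ?Im_conj /symH ?ReM ?ImM/= sgrN; ring.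
Qed.

Lemma norm_sqrE v x : `|v x| ^+ 2 = v x * conjc (v x).
Proof. by rewrite normc_norm -rmorphXn/= normc_sqrE. Qed.

Lemma norm_exp4E v x : `|v x| ^+ 4 = v x * conjc (v x) * (v x * conjc (v x)).
Proof. by rewrite (exprM _ 2 2) norm_sqrE expr2. Qed.

End LaxIdentity.

(** * The commutator for solutions *)

Section ConcreteLax.
Context {R : realType}.
Implicit Types (f g h u v w : cfun R) (k : nat) (c : R[i]).

Lemma smooth_conjM k v u : smooth k v -> smooth k u -> smooth k (fun y => conjc (v y) * u y).
Proof. by move=> sv su; apply: smoothM => //; exact: smooth_conj. Qed.

Lemma DtildeE v f : Dtilde v f =
  fun x => cderiv f x + 2^-1 * (v x * hilbert (fun y => conjc (v y) * f y) x).
Proof. by apply/funext => x; rewrite /Dtilde -mulrA. Qed.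

Lemma HopE v u : smooth 1 v -> smooth 1 u -> Hop v u = fun x => - cderiv (cderiv u) x
  + 4^-1 * (v x * conjc (v x) * (v x * conjc (v x)) * u x)
  - v x * hilbert (cderiv (fun y => conjc (v y) * u y)) x.
Proof.
move=> sv su; apply/funext => x; rewrite /Hop norm_exp4E (absDE (smooth_conjM sv su)).
by rewrite [4^-1 * (_ * u x)]mulrA.
Qed.

Lemma smooth_Dtilde k v f : smooth k v -> smooth k.+1 f -> smooth k (Dtilde v f).
Proof.
move=> sv sf; rewrite DtildeE; apply: smoothD; first exact: smooth_cderiv.
apply: smoothZ; apply: smoothM => //; apply: smooth_hilbert; apply: smooth_conjM => //.
exact: smoothS sf.
Qed.

Lemma smooth_Hop k v f : smooth k.+1 v -> smooth k.+2 f -> smooth k (Hop v f).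
Proof.
move=> sv sf; have sf1 : smooth k.+1 f by exact: smoothS sf.
have sv0 : smooth k v by exact: smoothS sv.
have sw0 := smooth_conj sv0.
rewrite HopE; [|exact: smoothS sv|exact: smoothS sf].
apply: smoothB; first apply: smoothD.
- exact: (smoothN (smooth_cderiv (smooth_cderiv sf))).
- apply: smoothZ; apply: smoothM; last exact: smoothS sf1.
  exact: (smoothM (smoothM sv0 sw0) (smoothM sv0 sw0)).
- apply: smoothM => //; apply: smooth_hilbert; apply: smooth_cderiv.
  exact: smooth_conjM.
Qed.

Lemma DtildeZ v c u : smooth 1 v -> smooth 1 u ->
  Dtilde v (fun y => c * u y) = fun x => c * Dtilde v u x.
Proof.
move=> sv su; have s0 : smooth 0 (fun y => conjc (v y) * u y).
  by apply: smooth_conjM; [exact: smoothS sv|exact: smoothS su].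
rewrite !DtildeE (cderivZ c su).
have -> : (fun y => conjc (v y) * (c * u y)) = fun y => c * (conjc (v y) * u y).
  by apply/funext => y; rewrite mulrCA.
by rewrite (hilbertZ c s0); apply/funext => x; ring.
Qed.

Lemma HopZ v c u : smooth 1 v -> smooth 2 u ->
  Hop v (fun y => c * u y) = fun x => c * Hop v u x.
Proof.
move=> sv su; have su1 : smooth 1 u by exact: smoothS su.
have s1 := smooth_conjM sv su1.
rewrite !HopE//; last exact: smoothZ.
rewrite (cderivZ c su1) (cderivZ c (smooth_cderiv su)).
have -> : (fun y => conjc (v y) * (c * u y)) = fun y => c * (conjc (v y) * u y).
  by apply/funext => y; rewrite mulrCA.
rewrite (cderivZ c s1) (hilbertZ c (smooth_cderiv s1)).
by apply/funext => x; ring.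
Qed.

(** The two scalars multiply to -1. They have to be pulled through [Hop v] and [Dtilde v], whose
    homogeneity is available on smooth arguments; hence the regularity required of [Dtilde v f] and
    [Hop v f]. *)
Lemma commutator_scale v f x : smooth 4 v -> smooth 4 f ->
  commutator (scale_op (- 'i%C) (Hop v)) (scale_op (- 'i%C) (Dtilde v)) f x =
  - (Hop v (Dtilde v f) x - Dtilde v (Hop v f) x).
Proof.
move=> sv sf.
have sv1 : smooth 1 v by exact: smoothS sv.
have sD : smooth 2 (Dtilde v f) by apply: smooth_Dtilde; [exact: smoothS sv|exact: smoothS sf].
have sH : smooth 1 (Hop v f) by apply: smooth_Hop; [exact: smoothS sv|exact: smoothS sf].
have i2 : - 'i%C * - 'i%C = -1 :> R[i] by rewrite mulrNN -expr2 sqr_i.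
rewrite /commutator /scale_op (HopZ _ sv1 sD) (DtildeZ _ sv1 sH).
move: (Hop v (Dtilde v f) x) (Dtilde v (Hop v f) x) => a b.
by rewrite (mulrA _ _ a) (mulrA _ _ b) i2 !mulN1r opprD.
Qed.

Section Equation.
Variables (v vt : cfun R).
Hypothesis sv : smooth 4 v.
Hypothesis eqv : forall x, 'i%C * vt x + cderiv (cderiv v) x
  + absD (fun y => `|v y| ^+ 2) x * v x - 4^-1 * `|v x| ^+ 4 * v x = 0.

Let w x := conjc (v x).
Let rho x := v x * w x.

Let sw : smooth 4 w. Proof. exact: smooth_conj. Qed.
Let srho : smooth 4 rho. Proof. exact: smoothM. Qed.

Let sDrho : smooth 3 (cderiv rho). Proof. exact: smooth_cderiv. Qed.

Lemma evolutionE x : vt x = 'i%C * (cderiv (cderiv v) x + hilbert (cderiv rho) x * v x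
  - 4^-1 * (rho x * rho x * v x)).
Proof.
have := eqv x.
have -> : (fun y => `|v y| ^+ 2) = rho by apply/funext => y; exact: norm_sqrE.
have srho1 : smooth 1 rho by exact: smoothS srho.
rewrite norm_exp4E -[v x * conjc (v x)]/(rho x) (absDE srho1).
move: (hilbert (cderiv rho) x) (cderiv (cderiv v) x) (rho x) (v x) (vt x) => a b r z z' e.
have {}e : 'i%C * z' = - (b + a * z - 4^-1 * (r * r * z)).
  by apply/eqP; rewrite -subr_eq0; apply/eqP; rewrite -[RHS]e; ring.
have -> : z' = - ('i%C * ('i%C * z')) by rewrite mulrA -expr2 sqr_i mulN1r opprK.
by rewrite e mulrN opprK.
Qed.

Let conj_rho x : conjc (rho x) = rho x.
Proof. by rewrite /rho /w conjcM conjcK mulrC. Qed.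

Let conj_sigma x : conjc (hilbert (cderiv rho) x) = hilbert (cderiv rho) x.
Proof.
have s0 : smooth 0 (cderiv rho) by exact: smoothS sDrho.
have := congr1 (@^~ x) (hilbert_conj s0) => /= <-.
have srho1 : smooth 1 rho by exact: smoothS srho.
rewrite -(cderiv_conj srho1).
by congr (hilbert (cderiv _) x); apply/funext => y; exact: conj_rho.
Qed.

(** [rho] and [H (D rho)] are real, the latter because the Hilbert transform commutes with
    conjugation. Conjugating the equation thus only exchanges [v] with [w] and [i] with [- i], which
    is the second equation expected by [abstract_lax]. *)
Lemma conj_evolutionE x : conjc (vt x) = - 'i%C * (cderiv (cderiv w) x
  + hilbert (cderiv rho) x * w x - 4^-1 * (rho x * rho x * w x)).
Proof.
have c4 : conjc (4^-1 : R[i]) = 4^-1 by rewrite fmorphV rmorph_nat.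
have ci : conjc ('i%C : R[i]) = - 'i%C by apply: complexP; rewrite /= ?oppr0.
have -> : cderiv (cderiv w) x = conjc (cderiv (cderiv v) x).
  have sv1 : smooth 1 v by exact: smoothS sv.
  have sv2 : smooth 1 (cderiv v) by apply: smooth_cderiv; exact: smoothS sv.
  by rewrite /w (cderiv_conj sv1) (cderiv_conj sv2).
have cB (a b : R[i]) : conjc (a - b) = conjc a - conjc b by rewrite conjcD; congr (_ + _); exact: rmorphN.
move: (conj_rho x) (conj_sigma x); rewrite evolutionE {2}/w.
move: (rho x) (hilbert (cderiv rho) x) => r a er ea.
by rewrite conjcM ci cB conjcD !conjcM c4 er ea.
Qed.

(** The regularity of [vt] is read off the equation, which holds at every point. Membership in a
    Sobolev space would determine [vt] only up to a null set. *)
Lemma smooth_evolution : smooth 2 vt.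
Proof.
have -> : vt = fun x => 'i%C * (cderiv (cderiv v) x + hilbert (cderiv rho) x * v x
  - 4^-1 * (rho x * rho x * v x)) by apply/funext => x; exact: evolutionE.
apply: smoothZ; apply: smoothB; first apply: smoothD.
- exact: (smooth_cderiv (smooth_cderiv sv)).
- apply: smoothM; last exact: smoothS sv.
  by apply: smooth_hilbert; exact: smoothS sDrho.
- apply: smoothZ; apply: smoothM; last exact: smoothS sv.
  by apply: smoothM; exact: smoothS srho.
Qed.

Lemma lax_identity f x : smooth 4 f ->
  commutator (scale_op (- 'i%C) (Hop v)) (scale_op (- 'i%C) (Dtilde v)) f x =
  - 'i%C * (2^-1 * (vt x * hilbert (fun y => conjc (v y) * f y) x
    + v x * hilbert (fun y => conjc (vt y) * f y) x)).
Proof.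
move=> sf; rewrite commutator_scale//.
have sg : smooth 4 (fun y => w y * f y) by exact: smoothM.
have sv1 : smooth 1 v by exact: smoothS sv.
have sD : smooth 1 (Dtilde v f) by apply: smooth_Dtilde => //; exact: smoothS sf.
have := @abstract_lax R smooth cderiv hilbert smoothS smoothD smoothB smoothN smoothZ smoothM
  smooth_cderiv smooth_hilbert cderivD cderivB cderivN cderivZ cderivM hilbertD hilbertB
  hilbertN hilbertZ hilbert_cderiv cotlar v w rho f _ sv sw srho sf sg
  (fun=> erefl) (fun=> erefl) vt _ evolutionE conj_evolutionE x.
by move=> <-; rewrite (HopE sv1 sD) !DtildeE HopE//; exact: smoothS sf.
Qed.

End Equation.
End ConcreteLax.

(** * Sobolev estimates and the difference quotient *)

Section SobolevClass.
Context {R : realType}.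
Notation mu := (@lebesgue_measure R).
Notation cn := Normc.normc.
Notation J f := (cintegral setT f).
Implicit Types (f F a b : cfun R) (s : R) (k : nat).

Definition bracket s (xi : R) : R := (1 + xi ^+ 2) `^ (s / 2).

Definition sobolev_weighted s f : cfun R := fun xi => (bracket s xi)%:C * fourier f xi.

Lemma sqr1_ge1 (xi : R) : 1 <= 1 + xi ^+ 2.
Proof. by rewrite lerDl sqr_ge0. Qed.

Lemma bracket_ge0 s xi : 0 <= bracket s xi.
Proof. exact: powR_ge0. Qed.

Lemma bracket0 xi : bracket 0 xi = 1.
Proof. by rewrite /bracket mul0r powRr0. Qed.

Lemma bracket_le s r xi : s <= r -> bracket s xi <= bracket r xi.
Proof. by move=> sr; rewrite /bracket ler_powR ?sqr1_ge1// ler_pM2r. Qed.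

Lemma bracket1_sqr xi : bracket 1 xi ^+ 2 = 1 + xi ^+ 2.
Proof.
have p0 : 0 <= 1 + xi ^+ 2 by exact: le_trans ler01 (sqr1_ge1 xi).
by rewrite /bracket div1r powR12_sqrt// sqr_sqrtr.
Qed.

Lemma bracket_nat k xi : bracket k%:R xi = bracket 1 xi ^+ k.
Proof.
by rewrite /bracket -[RHS]powR_mulrn ?powR_ge0// -powRrM; congr (_ `^ _); rewrite mulrC mul1r.
Qed.

Lemma wt_bracket k xi : wt k xi <= 2 ^+ k * bracket k%:R xi.
Proof.
have b1 := bracket_ge0 1 xi.
rewrite bracket_nat -exprMn; apply: lerXn2r; rewrite ?nnegrE ?addr_ge0 ?mulr_ge0//.
have n0 : 0 <= `|xi| by [].
rewrite -(@ler_pXn2r _ 2%N)// ?nnegrE ?addr_ge0 ?mulr_ge0//.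
rewrite exprMn bracket1_sqr -(real_normK (num_real xi)).
by move: `|xi| n0 => y y0; nra.
Qed.

Lemma measurable_bracket s : measurable_fun setT (bracket s).
Proof.
apply: (@measurableT_comp _ _ _ _ _ _ (fun y : R => y `^ (s / 2)) _ (fun xi : R => 1 + xi ^+ 2)).
  exact: measurable_powR.
apply: measurable_realfun.measurable_funD; first exact: measurable_cst.
exact: measurable_funX.
Qed.

Lemma cmeas_sobolev s f : cL2 f -> cmeas (sobolev_weighted s f).
Proof.
move=> /cL2_fourier[mF _]; apply: cmeasM => //; apply: cmeas_real.
exact: measurable_bracket.
Qed.

Lemma HsP s f : Hs s f <-> cL2 f /\ cL2 (sobolev_weighted s f).
Proof.
split=> [[/L2P f2 h]|[f2 h]].
  by split => //; apply/L2norm_lty => //; exact: cmeas_sobolev.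
by split; [apply/L2P|apply/L2norm_lty => //; exact: cmeas_sobolev].
Qed.

Lemma sobolev_weighted0 f : sobolev_weighted 0 f = fourier f.
Proof. by apply/funext => xi; rewrite /sobolev_weighted bracket0 mul1r. Qed.

Lemma Hs0 f : cL2 f -> Hs 0 f.
Proof.
by move=> f2; apply/HsP; rewrite sobolev_weighted0; split => //; exact: cL2_fourier.
Qed.

Lemma normc_sobolev s f xi : cn (sobolev_weighted s f xi) = bracket s xi * cn (fourier f xi).
Proof. by rewrite Normc.normcM normc_real ger0_norm// bracket_ge0. Qed.

Lemma rL1_bracketV : rL1 (fun xi : R => (1 + xi ^+ 2)^-1).
Proof.
have -> : (fun xi : R => (1 + xi ^+ 2)^-1) = fun xi => 2^-1 * poisson 1 xi.
  by apply/funext => x; rewrite /poisson expr1n mulr1 mulrA mulVf ?mul1r ?pnatr_eq0.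
exact: rL1Z (rL1_poisson ltr01).
Qed.

(** One power of the weight is spent on integrability: an L2 bound with weight of order [k + 1]
    gives an L1 bound of order [k], since [(1 + xi^2)^-1] is integrable. This is the loss of one
    derivative behind the value of [s0]. *)
Lemma wclass_fourier k s f : k.+1%:R <= s -> Hs s f -> wclass k (fourier f).
Proof.
move=> ks /HsP[f2 [mS iS]]; have [mF _] := cL2_fourier f2.
have wS (xi : R) : wabs k.+1 (fourier f) xi <= 2 ^+ k.+1 * cn (sobolev_weighted s f xi).
  rewrite normc_sobolev mulrA ler_wpM2r ?normc_ge0//.
  apply: (le_trans (wt_bracket k.+1 xi)); rewrite ler_wpM2l ?exprn_ge0//.
  exact: bracket_le.
have i2 : rL1 (fun xi => wabs k.+1 (fourier f) xi ^+ 2).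
  have := rL1Z ((2 ^+ k.+1) ^+ 2) iS; apply: rL1_le.
    by apply: measurable_funX; exact: measurable_wabs.
  move=> xi; rewrite ger0_norm ?sqr_ge0// -exprMn.
  by apply: lerXn2r => //; rewrite nnegrE ?wabs_ge0// mulr_ge0 ?exprn_ge0 ?normc_ge0.
split => //; last first.
  apply: rL1_le i2; first by apply: measurable_funX; exact: measurable_wabs.
  move=> xi; rewrite ger0_norm ?sqr_ge0//.
  apply: lerXn2r; rewrite ?nnegrE ?wabs_ge0// ler_wpM2r ?normc_ge0//.
  exact: wt_le.
apply: rL1_le (rL1D i2 rL1_bracketV); first exact: measurable_wabs.
move=> xi; rewrite ger0_norm ?wabs_ge0//.
have -> : wabs k.+1 (fourier f) xi = (1 + `|xi|) * wabs k (fourier f) xi.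
  by rewrite /wabs wtS; ring.
have := wabs_ge0 k (fourier f) xi.
have n0 : 0 <= `|xi| by [].
have q0 : 0 < 1 + xi ^+ 2 by exact: lt_le_trans ltr01 (sqr1_ge1 xi).
have c0 : 0 < (1 + xi ^+ 2)^-1 by rewrite invr_gt0.
have cE : (1 + xi ^+ 2)^-1 * (1 + `|xi| ^+ 2) = 1.
  by rewrite (real_normK (num_real xi)) mulVf// gt_eqF.
move: (wabs k _ _) `|xi| n0 (1 + xi ^+ 2)^-1 c0 cE => a y y0 c c0 cE a0.
have e1 : (1 + y ^+ 2) * a ^+ 2 <= ((1 + y) * a) ^+ 2.
  by rewrite exprMn ler_wpM2r ?sqr_ge0//; nra.
apply: le_trans (_ : (1 + y ^+ 2) * a ^+ 2 + c <= _); last by rewrite lerD2r.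
(* Here [c = (1 + y^2)^-1]. The expanded square says [a <= (1 + y^2) * a^2 + c / 4], an AM-GM
   inequality that replaces Cauchy-Schwarz and yields an integrable majorant. *)
have m0 : 0 <= c * ((1 + y ^+ 2) * a - 2^-1) ^+ 2 by rewrite mulr_ge0 ?sqr_ge0// ltW.
have mE : c * ((1 + y ^+ 2) * a - 2^-1) ^+ 2 = (1 + y ^+ 2) * a ^+ 2 - a + c * 4^-1.
  transitivity (c * (1 + y ^+ 2) * ((1 + y ^+ 2) * a ^+ 2) - c * (1 + y ^+ 2) * a + c * 4^-1).
    by field.
  by rewrite cE !mul1r.
by rewrite mE in m0; lra.
Qed.

Lemma Hs_ift s f : 1 <= s -> ccontinuous f -> Hs s f -> wclass 0 (fourier f) /\ f = ift (fourier f).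
Proof.
move=> s1 cf hf; have W := @wclass_fourier 0 s f s1 hf; split => //.
have [f2 _] := (HsP s f).1 hf; apply/funext => y; apply: inversion => //.
- exact: fourierP.
- exact: wclass_cL1 W.
- exact: ccontinuous_ccont.
Qed.

Lemma Hs_smooth k s f : k.+1%:R <= s -> ccontinuous f -> Hs s f -> smooth k f.
Proof.
move=> ks cf hf; exists (fourier f); first exact: wclass_fourier hf.
by apply: (Hs_ift _ cf hf).2; apply: le_trans ks; rewrite ler1n.
Qed.

Lemma n2_ift F : cL1 F -> cL2 F -> n2 (ift F) <= (2 * pi)^-1 * n2 F.
Proof.
move=> i1 i2; have p0 : 0 < 2 * pi :> R by apply: mulr_gt0 => //; exact: pi_gt0.
have [c2 cb] := bessel (expr1n R 2) i1 i2.
apply: le_trans (_ : ((2 * pi)^-1) ^+ 2 * n2 (ft 1 F) <= _).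
  apply: (n2M_le (g := fun=> ((2 * pi)^-1)%:C) c2); first exact: cmeas_cst.
  by move=> x; rewrite normc_real ger0_norm// invr_ge0 ltW.
apply: le_trans (_ : ((2 * pi)^-1) ^+ 2 * (2 * pi * n2 F) <= _).
  by rewrite ler_wpM2l ?sqr_ge0.
by rewrite expr2 -mulrA mulKf ?gt_eqF.
Qed.

(** Cauchy-Schwarz against [b], the weight of order -1, bounds the L1 norm of the transform, hence
    the supremum of [f]. Since [s >= 1], the weight of order [s] dominates that of order 1, so [K]
    depends neither on [s] nor on [f]. *)
Lemma sobolev_embedding : exists2 K : R, 0 <= K & forall s f, 1 <= s -> ccontinuous f -> Hs s f ->
  (forall x, cn (f x) ^+ 2 <= K * n2 (sobolev_weighted s f)) /\
  n2 f <= K * n2 (sobolev_weighted s f).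
Proof.
have p0 : 0 < 2 * pi :> R by apply: mulr_gt0 => //; exact: pi_gt0.
pose b : cfun R := fun xi => (bracket (-1) xi)%:C.
have bE xi : cn (b xi) ^+ 2 = (1 + xi ^+ 2)^-1.
  have q0 : 0 <= 1 + xi ^+ 2 by exact: le_trans ler01 (sqr1_ge1 xi).
  rewrite normc_real ger0_norm ?bracket_ge0// /bracket mulN1r powRN powR12_sqrt//.
  by rewrite exprVn sqr_sqrtr.
have b2 : cL2 b.
  split; first by apply: cmeas_real; exact: measurable_bracket.
  by under eq_fun do rewrite bE; exact: rL1_bracketV.
(* The first summand serves the supremum bound, the second the L2 bound. *)
pose K := ((2 * pi)^-1) ^+ 2 * n2 b + (2 * pi)^-1.
have k1 : 0 <= ((2 * pi)^-1) ^+ 2 * n2 b by rewrite mulr_ge0 ?sqr_ge0 ?n2_ge0.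
have k2 : 0 <= (2 * pi)^-1 :> R by rewrite invr_ge0 ltW.
exists K; first exact: addr_ge0.
move=> s f s1 cf hf; have [W fE] := Hs_ift s1 cf hf.
have [f2 S2] := (HsP s f).1 hf; have F1 := wclass_cL1 W; have F2 := wclass_cL2 W.
have S0 := n2_ge0 (sobolev_weighted s f).
split=> [x|].
  apply: le_trans (_ : ((2 * pi)^-1 * \int[mu]_xi cn (fourier f xi)) ^+ 2 <= _).
    rewrite [in X in X <= _]fE; apply: lerXn2r; rewrite ?nnegrE ?normc_ge0//.
      by rewrite mulr_ge0// Rintegral_ge0// => xi _; exact: normc_ge0.
    exact: normc_ift.
  apply: le_trans (_ : ((2 * pi)^-1) ^+ 2 * (n2 b * n2 (sobolev_weighted s f)) <= _).
    rewrite exprMn ler_wpM2l ?sqr_ge0//.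
    apply: le_trans (cauchy_schwarz b2 S2).
    have I0 g : 0 <= \int[mu]_xi cn (g xi) by apply: Rintegral_ge0 => xi _; exact: normc_ge0.
    apply: lerXn2r; [exact: I0|exact: I0|].
    apply: le_rintegral; first by case: F1.
      by have [] := cL1M b2 S2.
    move=> xi; rewrite Normc.normcM normc_sobolev normc_real ger0_norm ?bracket_ge0//.
    rewrite mulrA ler_peMl ?normc_ge0// /bracket -powRD; last first.
      by apply/implyP => _; apply: lt0r_neq0; exact: lt_le_trans ltr01 (sqr1_ge1 xi).
    by rewrite -[leLHS](powRr0 (1 + xi ^+ 2)) ler_powR ?sqr1_ge1//; move: s1; lra.
  by rewrite mulrA ler_wpM2r// lerDl.
apply: le_trans (_ : (2 * pi)^-1 * n2 (fourier f) <= _).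
  by rewrite [in X in X <= _]fE; exact: n2_ift.
apply: le_trans (_ : (2 * pi)^-1 * n2 (sobolev_weighted s f) <= _); last first.
  by rewrite ler_wpM2r// lerDr.
rewrite ler_wpM2l//; apply: n2_le => // xi; rewrite normc_sobolev ler_peMl ?normc_ge0//.
by rewrite -(bracket0 xi) bracket_le// (le_trans ler01 s1).
Qed.

(** The symbol has modulus at most 1; the factor 2 is inherited from [n2_is_fourier]. *)
Lemma n2_hilbert f : smooth 0 f -> n2 (hilbert f) <= 2 * n2 f.
Proof.
move=> [F WF ->]; rewrite (hilbert_ift WF).
have p0 : 0 < 2 * pi :> R by apply: mulr_gt0 => //; exact: pi_gt0.
have F1 := wclass_cL1 WF; have F2 := wclass_cL2 WF; have HF := wclass_symH WF.
apply: le_trans (n2_ift (wclass_cL1 HF) (wclass_cL2 HF)) _.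
apply: le_trans (_ : (2 * pi)^-1 * n2 F <= _).
  rewrite ler_wpM2l ?invr_ge0 ?(ltW p0)//.
  by have := n2M_le F2 cmeas_symH normc_symH; rewrite expr1n mul1r.
apply: le_trans (_ : (2 * pi)^-1 * (4 * pi * n2 (ift F)) <= _).
  rewrite ler_wpM2l ?invr_ge0 ?(ltW p0)//.
  exact: n2_is_fourier (cL2_ift F1 F2) (is_fourier_ift F1 F2).
move: (n2 _) p0; move: (pi : R) => p a p0.
have -> : 4 * p * a = (2 * p) * (2 * a) by ring.
by rewrite mulKf// gt_eqF.
Qed.

(** The available bound for [hilbert] is in L2, so one factor under it must carry the L2 norm: [b]
    does, while [a] and [f] enter through their suprema. *)
Lemma trilinear a b f (A B : R) : smooth 0 b -> smooth 0 f -> cmeas a ->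
  (forall x, cn (a x) ^+ 2 <= A) -> (forall x, cn (f x) ^+ 2 <= B) ->
  n2 (fun x => a x * hilbert (fun y => conjc (b y) * f y) x) <= 2 * A * B * n2 b.
Proof.
move=> sb sf ma aA fB.
have A0 : 0 <= A by apply: le_trans (aA 0); exact: sqr_ge0.
have B0 : 0 <= B by apply: le_trans (fB 0); exact: sqr_ge0.
have root (C : R) (z : R[i]) : 0 <= C -> cn z ^+ 2 <= C -> cn z <= Num.sqrt C.
  move=> C0 zC; rewrite -[leLHS]ger0_norm ?normc_ge0// -sqrtr_sqr.
  by rewrite ler_sqrt.
have sg := smooth_conjM sb sf.
apply: le_trans (_ : A * n2 (hilbert (fun y => conjc (b y) * f y)) <= _).
  rewrite -[A in leRHS]sqr_sqrtr//; apply: n2M_le => //.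
    exact: smooth_cL2 (smooth_hilbert sg).
  by move=> x; exact: root.
apply: le_trans (_ : A * (2 * n2 (fun y => conjc (b y) * f y)) <= _).
  by rewrite ler_wpM2l//; exact: n2_hilbert.
rewrite (mulrCA A) -[leRHS]mulrA -[leRHS]mulrA ler_wpM2l// ler_wpM2l//.
have := n2M_le (cL2_conj (smooth_cL2 sb)) (smooth_cL2 sf).1 (fun x => root B _ B0 (fB x)).
rewrite sqr_sqrtr// (_ : (fun x => f x * _) = (fun y => conjc (b y) * f y)); last first.
  by apply/funext => x; rewrite mulrC.
rewrite (_ : n2 (fun x => conjc (b x)) = n2 b)//.
by apply: eq_Rintegral => x _; rewrite normc_conj.
Qed.

End SobolevClass.

Section DifferenceQuotient.
Context {R : realType}.
Notation mu := (@lebesgue_measure R).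
Notation cn := Normc.normc.
Implicit Types (f a b p q : cfun R).

(** [L2norm_cvg0] asks for every member of the family to be in L2. Here this is known only along the
    filter, so the other members are replaced by 0. *)
Lemma cvg0_L2norm_near {T : Type} (G : set_system T) {FG : Filter G} (u : T -> cfun R) :
  (\forall i \near G, cL2 (u i)) ->
  (L2norm (u i) @[i --> G] --> 0%E) <-> (n2 (u i) @[i --> G] --> (0 : R)).
Proof.
move=> u2; pose u' i : cfun R := if pselect (cL2 (u i)) then u i else fun=> 0.
have cL20 : cL2 (fun=> 0 : R[i]).
  split; first exact: cmeas_cst.
  rewrite (_ : (fun _ => _) = (fun=> 0)); first exact: integrable0.
  by apply/funext => x; rewrite Normc.normc0 expr0n.
have u'2 i : cL2 (u' i) by rewrite /u'; case: pselect.
have uE : \forall i \near G, u i = u' i.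
  by apply: filterS u2 => i ui; rewrite /u'; case: pselect.
have E1 : \forall i \near G, L2norm (u i) = L2norm (u' i).
  by apply: filterS uE => i ->.
have E2 : \forall i \near G, n2 (u i) = n2 (u' i) by apply: filterS uE => i ->.
have E1' : \forall i \near G, L2norm (u' i) = L2norm (u i) by apply: filterS E1.
have E2' : \forall i \near G, n2 (u' i) = n2 (u i) by apply: filterS E2.
split=> h.
- apply: cvg_trans (near_eq_cvg E2') _; apply/(L2norm_cvg0 u'2).
  exact: cvg_trans (near_eq_cvg E1) h.
- apply: cvg_trans (near_eq_cvg E1') _; apply/(L2norm_cvg0 u'2).
  exact: cvg_trans (near_eq_cvg E2) h.
Qed.

(** Here [a] and [b] are the solution at the moving and at the fixed time, [p] is its time
    derivative and [c] the inverse time step. The terms [cderiv f] cancel, and [c], being real,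
    passes under the conjugation inside the Hilbert transform. *)
Lemma difference_quotient f a b p (c : R[i]) x : conjc c = c ->
  smooth 0 f -> smooth 0 a -> smooth 0 b -> smooth 0 p ->
  c * (- 'i%C * Dtilde a f x - - 'i%C * Dtilde b f x)
  - - 'i%C * (2^-1 * (p x * hilbert (fun y => conjc (b y) * f y) x
                   + b x * hilbert (fun y => conjc (p y) * f y) x)) =
  - 'i%C * 2^-1 *
    ((c * (a x - b x) - p x) * hilbert (fun y => conjc (a y) * f y) x
     + p x * hilbert (fun y => conjc (a y - b y) * f y) x
     + b x * hilbert (fun y => conjc (c * (a y - b y) - p y) * f y) x).
Proof.
move=> cc sf sa sb sp.
have sA := smooth_conjM sa sf; have sB := smooth_conjM sb sf.
have sP := smooth_conjM sp sf.
have cB (z z' : R[i]) : conjc (z - z') = conjc z - conjc z'.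
  by rewrite conjcD; congr (_ + _); exact: rmorphN.
have -> : hilbert (fun y => conjc (a y - b y) * f y) x =
    hilbert (fun y => conjc (a y) * f y) x - hilbert (fun y => conjc (b y) * f y) x.
  have /(congr1 (@^~ x)) <- := hilbertB sA sB.
  by apply: (congr1 (fun u => hilbert u x)); apply/funext => y; rewrite cB mulrBl.
have -> : hilbert (fun y => conjc (c * (a y - b y) - p y) * f y) x =
    c * (hilbert (fun y => conjc (a y) * f y) x - hilbert (fun y => conjc (b y) * f y) x)
    - hilbert (fun y => conjc (p y) * f y) x.
  have /(congr1 (@^~ x)) <- := hilbertB sA sB.
  have /(congr1 (@^~ x)) <- := hilbertZ c (smoothB sA sB).
  have /(congr1 (@^~ x)) <- := hilbertB (smoothZ c (smoothB sA sB)) sP.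
  apply: (congr1 (fun u => hilbert u x)); apply/funext => y.
  by rewrite !cB conjcM cc cB; ring.
rewrite !DtildeE.
move: (hilbert (fun y => conjc (a y) * f y) x) (hilbert (fun y => conjc (b y) * f y) x)
  (hilbert (fun y => conjc (p y) * f y) x) (cderiv f x) (a x) (b x) (p x).
by move=> Ha Hb Hp df a0 b0 p0; ring.
Qed.

Lemma le_sum3 (s12 t1 t2 t3 b1 b2 b3 : R) : s12 <= 2 * t1 + 2 * t2 -> t1 <= b1 -> t2 <= b2 ->
  t3 <= b3 -> 2 * s12 + 2 * t3 <= 4 * b1 + 4 * b2 + 2 * b3.
Proof. lra. Qed.

(** Substituting [a - b = h (q + p)] expresses everything that depends on the moving time through
    [Q] and [h], which will tend to 0, and fixed bounds for [f], [b] and [p]. The factors 4, 4, 2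
    come from splitting the three terms with [n2D] twice. *)
Lemma n2_quotient_le f a b p q (h Q B N P Mp Mb : R) :
  smooth 0 f -> smooth 0 a -> smooth 0 b -> smooth 0 p -> smooth 0 q ->
  (forall x, a x - b x = h%:C * (q x + p x)) ->
  (forall x, cn (q x) ^+ 2 <= Q) -> n2 q <= Q ->
  (forall x, cn (f x) ^+ 2 <= B) -> (forall x, cn (p x) ^+ 2 <= Mp) ->
  (forall x, cn (b x) ^+ 2 <= Mb) -> n2 b <= N -> n2 p <= P ->
  n2 (fun x => - 'i%C * 2^-1 *
    (q x * hilbert (fun y => conjc (a y) * f y) x
     + p x * hilbert (fun y => conjc (a y - b y) * f y) x
     + b x * hilbert (fun y => conjc (q y) * f y) x)) <=
  4 * (2 * Q * B * (2 * N + 2 * (h ^+ 2 * (2 * Q + 2 * P))))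
  + 4 * (2 * Mp * B * (h ^+ 2 * (2 * Q + 2 * P))) + 2 * (2 * Mb * B * Q).
Proof.
move=> sf sa sb sp sq abE qQ n2q fB pM bM n2b n2p.
have Q0 : 0 <= Q by apply: le_trans (qQ 0); exact: sqr_ge0.
have B0 : 0 <= B by apply: le_trans (fB 0); exact: sqr_ge0.
have Mp0 : 0 <= Mp by apply: le_trans (pM 0); exact: sqr_ge0.
have Mb0 : 0 <= Mb by apply: le_trans (bM 0); exact: sqr_ge0.
have sd := smoothB sa sb.
have L2 := @smooth_cL2 R 0.
have dD : n2 (fun x => a x - b x) <= h ^+ 2 * (2 * Q + 2 * P).
  rewrite (_ : (fun x => a x - b x) = fun x => (fun=> h%:C) x * (q x + p x)); last first.
    by apply/funext => x; exact: abE.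
  apply: le_trans (n2M_le (g := fun=> h%:C) (M := `|h|) (L2 _ (smoothD sq sp)) _ _) _.
  - exact: cmeas_cst.
  - by move=> x; rewrite normc_real.
  rewrite real_normK ?num_real// ler_wpM2l ?sqr_ge0//.
  by apply: le_trans (n2D (L2 _ sq) (L2 _ sp)) _; rewrite lerD// ler_pM2l.
have aN : n2 a <= 2 * N + 2 * (h ^+ 2 * (2 * Q + 2 * P)).
  rewrite [X in n2 X](_ : a = fun x => b x + (a x - b x)); last first.
    by apply/funext => x; rewrite addrC subrK.
  by apply: le_trans (n2D (L2 _ sb) (L2 _ sd)) _; rewrite lerD// ler_pM2l.
have cm (u : cfun R) (su : smooth 0 u) : cmeas u by case: (L2 _ su).
have sHa := smoothM sq (smooth_hilbert (smooth_conjM sa sf)).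
have sHd := smoothM sp (smooth_hilbert (smooth_conjM sd sf)).
have sHq := smoothM sb (smooth_hilbert (smooth_conjM sq sf)).
have T1 := trilinear sa sf (cm _ sq) qQ fB.
have T2 := trilinear sd sf (cm _ sp) pM fB.
have T3 := trilinear sq sf (cm _ sb) bM fB.
have c1 : cn (- 'i%C * 2^-1 : R[i]) <= 1.
  rewrite Normc.normcM normcN normc_i mul1r.
  rewrite (_ : 2^-1 = (2^-1 : R)%:C); last by rewrite fmorphV rmorph_nat.
  by rewrite normc_real ger0_norm ?invr_ge0// invf_le1// ler1n.
have cmc : cmeas (fun _ : R => - 'i%C * 2^-1 : R[i]) by exact: cmeas_cst.
have := n2M_le (L2 _ (smoothD (smoothD sHa sHd) sHq)) cmc (fun=> c1).
rewrite expr1n mul1r => /le_trans; apply.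
apply: le_trans (n2D (L2 _ (smoothD sHa sHd)) (L2 _ sHq)) _.
have S12 := n2D (L2 _ sHa) (L2 _ sHd).
have W1 : 2 * Q * B * n2 a <= 2 * Q * B * (2 * N + 2 * (h ^+ 2 * (2 * Q + 2 * P))).
  by rewrite ler_wpM2l// !mulr_ge0.
have W2 : 2 * Mp * B * n2 (fun x => a x - b x) <= 2 * Mp * B * (h ^+ 2 * (2 * Q + 2 * P)).
  by rewrite ler_wpM2l// !mulr_ge0.
have W3 : 2 * Mb * B * n2 q <= 2 * Mb * B * Q by rewrite ler_wpM2l// !mulr_ge0.
have T1' := le_trans T1 W1; have T2' := le_trans T2 W2; have T3' := le_trans T3 W3.
exact: le_sum3 S12 T1' T2' T3'.
Qed.

Lemma cvg0Ml {T : Type} (G : set_system T) {FG : Filter G} (c : R) (u : T -> R) :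
  u i @[i --> G] --> (0 : R) -> c * u i @[i --> G] --> (0 : R).
Proof. by move=> u0; rewrite -(mulr0 c); apply: cvgM => //; exact: cvg_cst. Qed.

Lemma quotient_bound_cvg0 {T : Type} (G : set_system T) {FG : Filter G} (Q h : T -> R)
    (B N P Mp Mb : R) :
  Q i @[i --> G] --> (0 : R) -> h i @[i --> G] --> (0 : R) ->
  (4 * (2 * Q i * B * (2 * N + 2 * (h i ^+ 2 * (2 * Q i + 2 * P))))
  + 4 * (2 * Mp * B * (h i ^+ 2 * (2 * Q i + 2 * P))) + 2 * (2 * Mb * B * Q i))
  @[i --> G] --> (0 : R).
Proof.
move=> Q0 h0.
have c0 (c : R) : (fun=> c) i @[i --> G] --> c by exact: cvg_cst.
have D0 : h i ^+ 2 * (2 * Q i + 2 * P) @[i --> G] --> (0 : R).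
  have : h i * h i * (2 * Q i + 2 * P) @[i --> G] --> 0 * 0 * (0 + 2 * P).
    by apply: (cvgM (cvgM h0 h0) (cvgD (cvg0Ml 2 Q0) (c0 (2 * P)))).
  by rewrite !mul0r.
have E : 2 * Q i * B * (2 * N + 2 * (h i ^+ 2 * (2 * Q i + 2 * P))) @[i --> G] -->
    0 * B * (2 * N + 0).
  by apply: (cvgM (cvgM (cvg0Ml 2 Q0) (c0 B)) (cvgD (c0 (2 * N)) (cvg0Ml 2 D0))).
rewrite !mul0r in E.
rewrite -[X in _ --> X](addr0 (0 : R)) -[X in _ --> X + _](addr0 (0 : R)).
apply: (cvgD (cvgD (cvg0Ml 4 E) (cvg0Ml 4 (cvg0Ml (2 * Mp * B) D0)))
  (cvg0Ml 2 (cvg0Ml (2 * Mb * B) Q0))).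
Qed.

End DifferenceQuotient.

Theorem proposition3p5 (R : realType) :
  exists2 s0 : R, 2 <= s0 &
    forall (s T : R) (v : R -> R -> R[i]),
      s0 <= s -> 0 < T -> solution s T v ->
      forall t : R, t \in `[0, T] ->
        op_derivative s0 T (fun t' => scale_op (- 'i%C) (Dtilde (v t'))) t
          (commutator (scale_op (- 'i%C) (Hop (v t)))
                      (scale_op (- 'i%C) (Dtilde (v t)))).
Proof.
(* [Hs_smooth] loses one derivative, so order 5 gives [smooth 4] for [v] and [f], the class in which
   [lax_identity] is stated. It also leaves [s - 2 >= 1], so [sobolev_embedding] applies to the
   error [q] of the time derivative. *)
exists 5%:R; first by rewrite ler_nat.
move=> s T v s5 T0 [cv [hv _] [vt vtP]] t tT f cf hf.
have sf : smooth 4 f by exact: Hs_smooth hf.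
have sv t' : t' \in `[0, T] -> smooth 4 (v t').
  by move=> t'T; apply: (Hs_smooth s5) (cv _ t'T) (hv _ t'T).
have [[hvs hvt qlim] eqv] := vtP _ tT.
have svt2 := smooth_evolution (sv _ tT) eqv.
have svt : smooth 0 (vt t) by exact: smoothS svt2.
have sv0 t' : t' \in `[0, T] -> smooth 0 (v t') by move=> /sv; exact: smoothS.
have sv1 t' : t' \in `[0, T] -> smooth 1 (v t') by move=> /sv; exact: smoothS.
have sf0 : smooth 0 f by exact: smoothS sf.
have -> : commutator (scale_op (- 'i%C) (Hop (v t))) (scale_op (- 'i%C) (Dtilde (v t))) f =
    fun x => - 'i%C * (2^-1 * (vt t x * hilbert (fun y => conjc (v t y) * f y) x
      + v t x * hilbert (fun y => conjc (vt t y) * f y) x)).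
  by apply/funext => x; rewrite (lax_identity (sv _ tT) eqv x sf).
have sw : smooth 0 (fun x => - 'i%C * (2^-1 * (vt t x * hilbert (fun y => conjc (v t y) * f y) x
      + v t x * hilbert (fun y => conjc (vt t y) * f y) x))).
  apply: smoothZ; apply: smoothZ; apply: smoothD.
    exact: (smoothM svt (smooth_hilbert (smooth_conjM (sv0 _ tT) sf0))).
  exact: (smoothM (sv0 _ tT) (smooth_hilbert (smooth_conjM svt sf0))).
have sA t' : t' \in `[0, T] -> smooth 0 (scale_op (- 'i%C) (Dtilde (v t')) f).
  by move=> t'T; apply: smoothZ; apply: smooth_Dtilde; [exact: sv0|exact: smoothS sf].
split; [by move=> t' t'T; apply: Hs0; exact: smooth_cL2 (sA _ t'T)|exact: Hs0 (smooth_cL2 sw)|].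
pose q t' : cfun R := fun x => ((t' - t)^-1)%:C * (v t' x - v t x) - vt t x.
have sq1 t' : t' \in `[0, T] -> smooth 1 (q t').
  move=> t'T; apply: smoothB; last exact: smoothS svt2.
  by apply: smoothZ; apply: smoothB; exact: sv1.
have sq0 t' : t' \in `[0, T] -> smooth 0 (q t') by move=> /sq1; exact: smoothS.
pose G := within `[0, T]%classic t^'.
have FG : Filter G by exact: within_filter.
have GT : \forall t' \near G, t' \in `[0, T].
  by apply: withinT.
have Gt : \forall t' \near G, t' != t.
  exact: (@cvg_within _ t^' _ `[0, T]%classic _ (nbhs_dnbhs_neq t)).
pose S t' := sobolev_weighted (s - 2) (q t').
(* A norm that tends to 0 is eventually finite, which makes the error a member of the Sobolev space
   for [t'] close to [t]. *)
have q_Hs : \forall t' \near G, Hs (s - 2) (q t').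
  apply: filterS2 GT (cvg_is_fine qlim) => t' t'T qfin.
  split; first by apply/L2P; exact: smooth_cL2 (sq0 _ t'T).
  by rewrite ltey_eq qfin.
have S2 : \forall t' \near G, cL2 (S t').
  by apply: filterS q_Hs => t' /HsP[].
have Slim : n2 (S t') @[t' --> G] --> (0 : R).
  exact (proj1 (cvg0_L2norm_near S2) qlim).
have hlim : (t' - t) @[t' --> G] --> (0 : R).
  have idG : t' @[t' --> G] --> t.
    by apply: cvg_within_filter; exact: nbhs_dnbhs.
  have h := cvgB idG (@cvg_cst _ t _ G FG); rewrite subrr in h.
  exact (h FG).
have [K K0 embed] := @sobolev_embedding R.
have [Bf fB] := smooth_bounded sf0; have [Bp pB] := smooth_bounded svt.
have [Bv vB] := smooth_bounded (sv0 _ tT).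
have sqrB u (B : R) : (forall x : R, Normc.normc (u x : R[i]) <= B) ->
    forall x, Normc.normc (u x) ^+ 2 <= B ^+ 2.
  move=> uB x; have n0 := normc_ge0 (u x).
  by apply: lerXn2r; rewrite ?nnegrE// (le_trans n0 (uB x)).
pose g t' : cfun R := fun x => ((t' - t)^-1)%:C *
  (scale_op (- 'i%C) (Dtilde (v t')) f x - scale_op (- 'i%C) (Dtilde (v t)) f x)
  - (- 'i%C * (2^-1 * (vt t x * hilbert (fun y => conjc (v t y) * f y) x
      + v t x * hilbert (fun y => conjc (vt t y) * f y) x))).
have g2 t' : t' \in `[0, T] -> cL2 (g t').
  move=> t'T; apply: (@smooth_cL2 R 0); apply: smoothB => //; apply: smoothZ.
  by apply: smoothB; exact: sA.
(* The right-hand side of [n2_quotient_le] with [h = t' - t]. By [sobolev_embedding] the single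
   quantity [K * n2 (S t')] bounds both the squared supremum and the squared L2 norm of [q t']. *)
pose bound t' := let Q := K * n2 (S t') in let D := (t' - t) ^+ 2 * (2 * Q + 2 * n2 (vt t)) in
  4 * (2 * Q * Bf ^+ 2 * (2 * n2 (v t) + 2 * D))
  + 4 * (2 * Bp ^+ 2 * Bf ^+ 2 * D) + 2 * (2 * Bv ^+ 2 * Bf ^+ 2 * Q).
have gbound : \forall t' \near G, n2 (g t') <= bound t'.
  near=> t'; have t'T : t' \in `[0, T] by near: t'.
  have t't : t' - t != 0 by rewrite subr_eq0; near: t'.
  have qH : Hs (s - 2) (q t') by near: t'.
  have s1 : 1 <= s - 2 by move: s5; lra.
  have [qS n2q] := embed _ _ s1 (smooth_ccontinuous (sq1 _ t'T)) qH.
  have gE : g t' = fun x => - 'i%C * 2^-1 *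
      (q t' x * hilbert (fun y => conjc (v t' y) * f y) x
       + vt t x * hilbert (fun y => conjc (v t' y - v t y) * f y) x
       + v t x * hilbert (fun y => conjc (q t' y) * f y) x).
    apply/funext => x; apply: difference_quotient => //.
    - by apply: complexP; rewrite /= ?oppr0.
    - exact: sv0.
    - exact: sv0.
  rewrite gE; apply: n2_quotient_le (sqrB _ _ fB) (sqrB _ _ pB) (sqrB _ _ vB) _ _ => //.
  - exact: sv0.
  - exact: sv0.
  - exact: sq0.
  - by move=> x; rewrite /q subrK mulrA -rmorphM/= divff// mul1r.
have bound0 : bound t' @[t' --> G] --> (0 : R).
  have Qlim : K * n2 (S t') @[t' --> G] --> (0 : R) by exact: (cvg0Ml K Slim).
  exact: (quotient_bound_cvg0 (Bf ^+ 2) (n2 (v t)) (n2 (vt t)) (Bp ^+ 2) (Bv ^+ 2) Qlim hlim).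
have glim : n2 (g t') @[t' --> G] --> (0 : R).
  apply: squeeze_cvgr (cvg_cst 0) bound0.
  by apply: filterS gbound => t' ->; rewrite n2_ge0.
have Fg2 : \forall t' \near G, cL2 (sobolev_weighted 0 (g t')).
  by apply: filterS GT => t' /g2 ?; rewrite sobolev_weighted0; exact: cL2_fourier.
(* At order 0 the Sobolev norm is the L2 norm of the transform, not of the function itself;
   [n2_is_fourier] passes from one to the other at the cost of [4 * pi]. *)
suff Flim : n2 (sobolev_weighted 0 (g t')) @[t' --> G] --> (0 : R).
  exact (proj2 (cvg0_L2norm_near Fg2) Flim).
apply: squeeze_cvgr (cvg_cst 0) (_ : 4 * pi * n2 (g t') @[t' --> G] --> (0 : R)).
  apply: filterS GT => t' /g2 gt2; rewrite n2_ge0 sobolev_weighted0/=.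
  exact: n2_is_fourier gt2 (fourierP gt2).
exact: (cvg0Ml (4 * pi) glim).
Unshelve. all: by end_near.
Qed.
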